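(* Let $G$ be a Lie group acting on a manifold $M$, and suppose two $G$-invariant vector fields $X$ and $Y$ on $M$ are isomorphic. Then there exists a family of maps $\{F_t:M\to G\}$ depending smoothly on $t$ so that the flows $\Phi^X_t$, $\Phi^Y_t$ of $X$ and $Y$ respectively satisfy $$\Phi^X_t(m)=F_t(m)\cdot\Phi^Y_t(m)$$ for all $(t,m)\in\mathbb R\times M$ for which $\Phi^X_t(m)$ is defined.
   Context: Everything is smooth ($C^\infty$). $\mathfrak g$ is the Lie algebra of $G$. $\Gamma(TM)^G$ is the space of $G$-invariant vector fields on $M$, and $C^\infty(M,\mathfrak g)^G$ is the space of smooth maps $\psi:M\to\mathfrak g$ with $\psi(g\cdot m)=\mathrm{Ad}(g)\psi(m)$ for all $g\in G$, $m\in M$. For such $\psi$ the vector field $\psi_M\in\Gamma(TM)^G$ is defined by $\psi_M(m)=\frac{d}{dt}\big|_{t=0}\exp(t\psi(m))\cdot m$ for all $m\in M$. Two invariant vector fields $X,Y\in\Gamma(TM)^G$ are isomorphic if there is $\psi\in C^\infty(M,\mathfrak g)^G$ with $X=Y+\psi_M$.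
   Formalization: The family F_t is claimed smooth, jointly in (t,m), only on the set of (t,m) where the flow of X is defined; for incomplete flows it cannot in general be chosen smooth in t on all of R × M. *)

(* Defs.v *)
From HB Require Import structures.
From mathcomp Require Import all_boot all_order all_algebra.
From mathcomp Require Import all_classical all_reals all_analysis.

Set Implicit Arguments.
Unset Strict Implicit.
Unset Printing Implicit Defensive.

Import Order.TTheory GRing.Theory Num.Theory.
Import numFieldNormedType.Exports.

Local Open Scope classical_set_scope.
Local Open Scope ring_scope.

(* Only used on open sets [U] of finite-dimensional spaces, where it is the
   usual notion: all iterated directional derivatives of [f] exist and are
   continuous on [U].  The values of [f] outside [U] are irrelevant. *)
Fixpoint Ck {R : realType} {E E' : normedModType R} (k : nat) (U : set E)
    (f : E -> E') : Prop :=
  match k with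
  | 0 => forall x, U x -> {for x, continuous f}
  | k'.+1 => (forall x, U x -> differentiable f x)
             /\ (forall v : E, Ck k' U ('D_v f))
  end.

Definition Cinfty {R : realType} {E E' : normedModType R} (U : set E)
    (f : E -> E') : Prop :=
  forall k, Ck k U f.

(* A chart is a homeomorphism from an open set [cdom] onto an open set of the
   model space [E].  [cmap] and its inverse [cinv] are total functions, with
   unspecified values outside [cdom] and [cmap @` cdom]. *)
Record chart {R : realType} (T : topologicalType) (E : normedModType R) :=
  Chart {
    cdom : set T;
    cmap : T -> E;
    cinv : E -> T;
    open_cdom : open cdom;
    open_cimg : open (cmap @` cdom);
    cmapK : forall x, cdom x -> cinv (cmap x) = x;
    continuous_cmap : forall x, cdom x -> {for x, continuous cmap};
    continuous_cinv : forall y, (cmap @` cdom) y -> {for y, continuous cinv}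
  }.

(* [chart_at p] is a chosen chart around [p], through which the tangent space
   at [p] is identified with the model space.  Smooth compatibility of the
   charts is required below, in [manifold]. *)
Record charted_space {R : realType} (E : normedModType R) := ChartedSpace {
  carrier :> topologicalType;
  atlas : set (chart carrier E);
  chart_at : carrier -> chart carrier E;
  chart_at_atlas : forall p, atlas (chart_at p);
  chart_at_dom : forall p, cdom (chart_at p) p
}.

Section ModelAndProduct.
Context {R : realType}.

Section Model.
Variable E : normedModType R.

Let id_open_img : open ((@idfun E) @` setT).
Proof. by rewrite image_id; exact: openT. Qed.

Definition id_chart : chart E E :=
  @Chart R E E setT idfun idfun openT id_open_img (fun _ _ => erefl)
    (fun x _ => @cvg_id E (nbhs x)) (fun x _ => @cvg_id E (nbhs x)).

Definition model_space : charted_space E :=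
  @ChartedSpace R E E [set id_chart] (fun=> id_chart) (fun=> erefl) (fun=> I).

End Model.

Section Product.
Variables E E' : normedModType R.

Section Chart.
Variables (T T' : topologicalType) (a : chart T E) (b : chart T' E').

Let pdom : set (T * T')%type := cdom a `*` cdom b.
Let pmap (p : T * T') : E * E' := (cmap a p.1, cmap b p.2).
Let pinv (q : E * E') : T * T' := (cinv a q.1, cinv b q.2).

Let pimgE : pmap @` pdom = (cmap a @` cdom a) `*` (cmap b @` cdom b).
Proof.
rewrite eqEsubset; split.
  by move=> _ [[x y] /= [ax b_y] <-]; split => /=; [exists x|exists y].
by move=> [u v] /= [[x ax <-] [y b_y <-]]; exists (x, y).
Qed.

Let open_setX (S S' : topologicalType) (A : set S) (B : set S') :
  open A -> open B -> open (A `*` B).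
Proof.
move=> oA oB; rewrite openE => -[x y] /= [Ax By]; exists (A, B) => //=.
by split; apply: open_nbhs_nbhs.
Qed.

Let pcdom_open : open pdom.
Proof. by apply: open_setX; exact: open_cdom. Qed.

Let pcimg_open : open (pmap @` pdom).
Proof. by rewrite pimgE; apply: open_setX; exact: open_cimg. Qed.

Let pcmapK p : pdom p -> pinv (pmap p) = p.
Proof. by case: p => x y /= [ax b_y]; rewrite /pinv /= !cmapK. Qed.

Let pcmap_cont p : pdom p -> {for p, continuous pmap}.
Proof.
move=> [ax b_y]; apply: cvg_pair.
  by apply: (@cvg_comp _ _ _ fst (cmap a)) (continuous_cmap ax); exact: cvg_fst.
by apply: (@cvg_comp _ _ _ snd (cmap b)) (continuous_cmap b_y); exact: cvg_snd.
Qed.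

Let pcinv_cont q : (pmap @` pdom) q -> {for q, continuous pinv}.
Proof.
rewrite pimgE => -[ax b_y]; apply: cvg_pair.
  by apply: (@cvg_comp _ _ _ fst (cinv a)) (continuous_cinv ax); exact: cvg_fst.
by apply: (@cvg_comp _ _ _ snd (cinv b)) (continuous_cinv b_y); exact: cvg_snd.
Qed.

Definition prod_chart : chart (T * T')%type (E * E')%type :=
  Chart pcdom_open pcimg_open pcmapK pcmap_cont pcinv_cont.

End Chart.

Variables (M : charted_space E) (N : charted_space E').

Let prod_atlas : set (chart (M * N)%type (E * E')%type) :=
  [set c | exists a b, [/\ atlas a, atlas b & c = prod_chart a b]].
Let prod_chart_at (p : M * N) := prod_chart (chart_at p.1) (chart_at p.2).

Let prod_chart_at_atlas p : prod_atlas (prod_chart_at p).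
Proof.
by exists (chart_at p.1), (chart_at p.2); split => //; exact: chart_at_atlas.
Qed.

Let prod_chart_at_dom p : cdom (prod_chart_at p) p.
Proof. by split; exact: chart_at_dom. Qed.

Definition prod_space : charted_space (E * E')%type :=
  ChartedSpace prod_chart_at_atlas prod_chart_at_dom.

End Product.
End ModelAndProduct.

Section SmoothMaps.
Context {R : realType} {E E' : normedModType R}.
Variables (M : charted_space E) (N : charted_space E').

Definition smooth_at (f : M -> N) (p : M) : Prop :=
  exists (a : chart M E) (b : chart N E') (U : set M),
    [/\ atlas a, atlas b & [/\ open U, U p, U `<=` cdom a, f @` U `<=` cdom b
      & Cinfty (cmap a @` U) (cmap b \o f \o cinv a)]].

(* [f] is smooth on a neighbourhood of every point of [D]; for open [D] this
   only depends on the restriction of [f] to [D]. *)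
Definition smooth_on (D : set M) (f : M -> N) : Prop :=
  forall p, D p -> smooth_at f p.

Definition smooth (f : M -> N) : Prop := forall p, smooth_at f p.

End SmoothMaps.
Arguments smooth_at {R E E'} M N f p.
Arguments smooth_on {R E E'} M N D f.
Arguments smooth {R E E'} M N f.

Record manifold (R : realType) (n : nat) := Manifold {
  mspace :> charted_space 'rV[R]_n;
  atlas_compatible : forall a b : chart mspace 'rV[R]_n, atlas a -> atlas b ->
    Cinfty (cmap a @` (cdom a `&` cdom b)) (cmap b \o cinv a);
  manifold_hausdorff : hausdorff_space mspace;
  manifold_second_countable : @second_countable mspace
}.

Section TangentVectors.
Context {R : realType}.

(* T_p M: the vector [v] is the tangent vector at [p] whose coordinates in the
   chart [chart_at p] are [v]. *)
Definition tangent {E : normedModType R} {M : charted_space E} (p : M) : normedModType R := E.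

Definition tangent_map {E E' : normedModType R} {M : charted_space E}
    {N : charted_space E'} (f : M -> N) (p : M) (v : tangent p) : tangent (f p) :=
  'D_v (cmap (chart_at (f p)) \o f \o cinv (chart_at p)) (cmap (chart_at p) p).

(* The coordinates in the chart [a] of a tangent vector at [p]. *)
Definition tangent_coord {E : normedModType R} {M : charted_space E}
    (a : chart M E) (p : M) (v : tangent p) : E :=
  'D_v (cmap a \o cinv (chart_at p)) (cmap (chart_at p) p).

Definition smooth_vector_field {E : normedModType R} {M : charted_space E}
    (X : forall p : M, tangent p) : Prop :=
  forall a : chart M E, atlas a ->
    Cinfty (cmap a @` cdom a) (fun x => tangent_coord a (X (cinv a x))).

Definition velocity {E : normedModType R} {M : charted_space E}
    (gamma : R -> M) (t : R) : tangent (gamma t) :=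
  derive1 (cmap (chart_at (gamma t)) \o gamma) t.

Definition differentiable_curve_at {E : normedModType R}
    {M : charted_space E} (gamma : R -> M) (t : R) : Prop :=
  {for t, continuous gamma}
  /\ derivable (cmap (chart_at (gamma t)) \o gamma) t 1.

End TangentVectors.

Section Flow.
Context {R : realType} {E : normedModType R} {M : charted_space E}.
Variable X : forall p : M, tangent p.

Definition integral_curve (J : set R) (gamma : R -> M) : Prop :=
  forall t, J t ->
    differentiable_curve_at gamma t /\ velocity gamma t = X (gamma t).

Definition flows_to (t : R) (m p : M) : Prop :=
  exists (J : set R) (gamma : R -> M),
    [/\ open J, is_interval J, J 0, J t
      & [/\ integral_curve J gamma, gamma 0 = m & gamma t = p]].

(* The set of [(t, m)] such that the maximal integral curve starting at [m] is
   defined at time [t]. *)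
Definition flow_domain : set (R * M) :=
  [set q | exists p, flows_to q.1 q.2 p].

(* The (maximal, local) flow; its value is [m] outside [flow_domain]. *)
Definition flow (t : R) (m : M) : M := xget m [set p | flows_to t m p].

End Flow.

Record lie_group (R : realType) (d : nat) := LieGroup {
  lie_manifold :> manifold R d;
  lone : lie_manifold;
  lmul : lie_manifold -> lie_manifold -> lie_manifold;
  linv : lie_manifold -> lie_manifold;
  lmulA : associative lmul;
  lmul1g : left_id lone lmul;
  lmulg1 : right_id lone lmul;
  lmulVg : left_inverse lone linv lmul;
  lmulgV : right_inverse lone linv lmul;
  smooth_lmul : smooth (prod_space lie_manifold lie_manifold) lie_manifold
                  (fun p => lmul p.1 p.2);
  smooth_linv : smooth lie_manifold lie_manifold linv
}.

Section LieGroup.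
Context {R : realType} {d : nat} (G : lie_group R d).

Definition lie_algebra : normedModType R := tangent (lone G).

Definition Ad (g : G) : lie_algebra -> lie_algebra :=
  tangent_map (fun h : G => lmul (lmul g h) (linv g)) (p := lone G).

Definition one_parameter_subgroup (xi : lie_algebra) (gamma : R -> G) : Prop :=
  [/\ smooth (model_space R) G gamma,
      forall s t, gamma (s + t) = lmul (gamma s) (gamma t)
    & velocity gamma 0 = xi].

(* Every [xi] generates exactly one one-parameter subgroup, so the default
   value of [xget] is never used. *)
Definition lie_exp (xi : lie_algebra) : G :=
  xget (lone G)
    [set g | exists2 gamma, one_parameter_subgroup xi gamma & g = gamma 1].

End LieGroup.

Record smooth_action {R : realType} {d n : nat} (G : lie_group R d)
    (M : manifold R n) := SmoothAction {
  act :> G -> M -> M;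
  act1 : forall m, act (lone G) m = m;
  actM : forall g h m, act (lmul g h) m = act g (act h m);
  smooth_act : smooth (prod_space G M) M (fun q => act q.1 q.2)
}.

Section InvariantVectorFields.
Context {R : realType} {d n : nat} {G : lie_group R d} {M : manifold R n}.
Variable A : smooth_action G M.

Definition invariant_vector_field (X : forall m : M, tangent m) : Prop :=
  smooth_vector_field X
  /\ forall (g : G) (m : M), tangent_map (A g) (X m) = X (A g m).

Definition smooth_equivariant (psi : M -> lie_algebra G) : Prop :=
  smooth M (model_space (lie_algebra G)) psi
  /\ forall (g : G) (m : M), psi (A g m) = Ad g (psi m).

(* The velocity at time 0 is based at [lie_exp 0 . m], that is at [m]. *)
Definition induced_vector_field (psi : M -> lie_algebra G) (m : M) :
    tangent m :=
  velocity (fun t : R => A (lie_exp (t *: psi m)) m) 0.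

Definition isomorphic_vector_fields (X Y : forall m : M, tangent m) : Prop :=
  exists2 psi : M -> lie_algebra G, smooth_equivariant psi
    & forall m, X m = Y m + induced_vector_field psi m.

End InvariantVectorFields.

(* Main.v *)
(** Write [X = Y + psi_M].  Along an integral curve [x] of [X] solve
    [F' = dR_F (psi x)], [F 0 = 1] in [G].  Differentiating [x = F . y] gives
    [X x = psi_M x + dF (y')], so that, [Y] being invariant, [y = F^-1 . x] is an
    integral curve of [Y].  The equation for [F] is right-invariant: a solution
    over a short time interval starting at [1] continues any given one by right
    multiplication.  Hence [F] exists as long as [x] does, and near any point of
    the flow domain [(F, x)] is a finite composition of local solutions near
    [(1, x)], which depend smoothly on [(t, m)] by the theory of ordinary
    differential equations in a vector space. *)
Require Import Defs.
From HB Require Import structures.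
From mathcomp Require Import all_boot all_order all_algebra.
From mathcomp Require Import all_classical all_reals all_analysis.
From mathcomp Require Import ring lra.
Import Order.TTheory GRing.Theory Num.Theory.
Import numFieldNormedType.Exports.
Local Open Scope classical_set_scope.
Local Open Scope ring_scope.

Set Implicit Arguments.
Unset Strict Implicit.
Unset Printing Implicit Defensive.

(** * Calculus of [C^k] maps between finite-dimensional spaces *)

(** The obstacle is an order of quantifiers: a local flow is shown to be $C^k$ on a box that shrinks
    as $k$ grows, so no single local solution is known to be smooth. Therefore the lifted solution
    is pinned down by uniqueness alone, as a relation between $(t, m)$ and its value in $G \times
    M$. For each $k$ separately it is then shown to coincide, near a given point of the flow domain,
    with a map that is $C^k$ there. As smoothness is tested point by point on an open set,
    neighbourhoods depending on $k$ do no harm. The equation for $F$ is read off the curve $t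
    \mapsto F(t) F(s)^{-1}$, which passes through $1$ at $t = s$: the chart at the identity
    suffices, and right invariance becomes a cancellation. The field $\psi_M$ is defined through the
    exponential map, itself a choice among one-parameter subgroups. Their existence and uniqueness
    come from the same equation with constant right-hand side; after that $\psi_M(m)$ is the
    differential at $1$ of the orbit map of $m$, and the exponential disappears. Because $y$ is
    obtained as $F^{-1} \cdot x$ on the whole interval of $x$, the flow of $Y$ is defined wherever
    that of $X$ is. *)

Section Calculus.
Context {R : realType}.
Implicit Types E F H : normedModType R.

(** A predicate, because the induction on the order of smoothness passes from [E] to [E * E], and so
    has to range over a class of spaces closed under products. The vectors [e i] need only span. *)
Definition findim E : Prop :=
  exists (I : finType) (e : I -> E) (c : I -> {linear E -> R^o}),
    (forall i, continuous (c i)) /\ forall x, x = \sum_i c i x *: e i.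

Lemma Ck_sub E F k (U V : set E) (f : E -> F) :
  V `<=` U -> Ck k U f -> Ck k V f.
Proof.
move=> VU; elim: k f => [|k IH] f /=; first by move=> h x /VU; exact: h.
by move=> [h1 h2]; split=> [x /VU|v]; [exact: h1|exact: IH].
Qed.

(** ['D_v f] is a total function and [Ck] tests it only at the points of [U], so [Ck k [set x] f] is
    a meaningful condition at a single point, and [Ck k U f] is the conjunction of these. *)
Lemma Ck_pointwise E F k (U : set E) (f : E -> F) :
  (forall x, U x -> Ck k [set x] f) -> Ck k U f.
Proof.
elim: k f => [|k IH] f /= h; first by move=> x /h; apply.
split=> [x /h [+ _]|v]; first exact.
by apply: IH => x /h [_]; exact.
Qed.

Lemma CkS E F k (U : set E) (f : E -> F) :
  Ck k.+1 U f <->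
  (forall x, U x -> differentiable f x) /\ (forall v, Ck k U ('D_v f)).
Proof. by []. Qed.

Lemma CkS_Ck E F k (U : set E) (f : E -> F) : Ck k.+1 U f -> Ck k U f.
Proof.
elim: k f => [|k IH] f /= [h1 h2].
  by move=> x /h1; exact: differentiable_continuous.
by split=> // v; apply: IH; exact: h2.
Qed.

Lemma Ck_continuous E F k (U : set E) (f : E -> F) x :
  Ck k U f -> U x -> {for x, continuous f}.
Proof. by elim: k f => [|k IH] f; [exact | move=> /CkS_Ck; exact: IH]. Qed.

Lemma Ck_le E F k l (U : set E) (f : E -> F) :
  (l <= k)%N -> Ck k U f -> Ck l U f.
Proof.
move=> /subnK <-; elim: (k - l)%N => // j IH; rewrite addSn => /CkS_Ck.
exact: IH.
Qed.

(** The difference [g - f] vanishes near [x], hence is differentiable there with differential zero,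
    and [g] is the sum of [f] and this difference. *)
Lemma near_differentiable E F (f g : E -> F) x :
  (\near x, f x = g x) -> differentiable f x -> differentiable g x.
Proof.
move=> fg df.
have fgx : f x = g x := nbhs_singleton fg.
have gE : g = f + (g \- f) by rewrite funeqE => y; rewrite /= addrC subrK.
rewrite gE; apply: differentiableD => //; apply/diff_locallyP.
suff H : continuous (\0 : E -> F) /\ (g \- f) \o shift x =
    cst ((g \- f) x) + (\0 : {linear E -> F}) +o_ (0 : E) id.
  have -> : 'd (g \- f) x = \0 :> (E -> F).
    by apply: (@diff_unique _ _ _ _ (\0 : {linear E -> F})) => //; case: H.
  exact: H.
split; first exact: cst_continuous.
have near0 : \forall h \near (0 : E), (g \- f) (h + x) = 0.
  move: fg; rewrite (near_shift 0) subr0; apply: filterS => h /= ->.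
  by rewrite subrr.
apply/eqaddoP => _/posnumP[e]; apply: filterS near0 => h /= hE.
rewrite !fctE /= in hE *; rewrite hE fgx subrr addr0 subr0 normr0.
by rewrite mulr_ge0.
Qed.

Lemma open_near_eq E F (U : set E) (f g : E -> F) x :
  open U -> {in U, f =1 g} -> U x -> \forall y \near x, f y = g y.
Proof.
move=> oU fg Ux; apply: filterS (open_nbhs_nbhs (conj oU Ux)) => y Uy.
by apply: fg; rewrite inE.
Qed.

Lemma Ck_ext E F k (U : set E) (f g : E -> F) :
  open U -> {in U, f =1 g} -> Ck k U f -> Ck k U g.
Proof.
move=> oU; elim: k f g => [|k IH] f g fg /=.
  move=> h x Ux; have nfg := open_near_eq oU fg Ux.
  have := h x Ux; rewrite /prop_for /continuous_at -(nbhs_singleton nfg) => fx.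
  by apply: cvg_trans fx; apply: near_eq_cvg; apply: filterS nfg.
move=> [h1 h2]; split=> [x Ux|v].
  apply: near_differentiable (h1 x Ux).
    exact: (open_near_eq oU fg Ux).
apply: IH (h2 v) => x; rewrite inE => Ux; apply: near_eq_derive.
exact: (open_near_eq oU fg Ux).
Qed.

Lemma Ck_cst E F k (U : set E) (a : F) : Ck k U (cst a).
Proof.
elim: k a => [|k IH] a /=; first by move=> x _; exact: cst_continuous.
split=> // v; rewrite (_ : 'D_v _ = cst 0); first exact: IH.
by rewrite funeqE => x; rewrite derive_cst.
Qed.

Lemma derive_linear E F (L : {linear E -> F}) v x :
  continuous L -> 'D_v L x = L v.
Proof.
move=> cL; rewrite deriveE ?diff_lin //.
exact: linear_differentiable.
Qed.

Lemma Ck_linear E F (L : {linear E -> F}) k (U : set E) :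
  continuous L -> Ck k U L.
Proof.
move=> cL; case: k => [|k] /=; first by move=> x _; exact: cL.
split=> [x _|v]; first exact: linear_differentiable.
rewrite (_ : 'D_v _ = cst (L v)); first exact: Ck_cst.
by rewrite funeqE => x; rewrite derive_linear.
Qed.

Lemma Ck_add E F k (U : set E) (f g : E -> F) :
  open U -> Ck k U f -> Ck k U g -> Ck k U (fun x => f x + g x).
Proof.
move=> oU; elim: k f g => [|k IH] f g /=.
  by move=> hf hg x Ux; apply: cvgD; [exact: hf|exact: hg].
move=> [df hf] [dg hg]; split=> [x Ux|v].
  by apply: differentiableD; [exact: df|exact: dg].
apply: (@Ck_ext _ _ _ _ (fun x => 'D_v f x + 'D_v g x)) => //; last exact: IH.
move=> x; rewrite inE => Ux; rewrite deriveD //; apply: diff_derivable.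
  exact: df.
exact: dg.
Qed.

Lemma Ck_sum E F k (U : set E) (I : finType) (f : I -> E -> F) :
  open U -> (forall i, Ck k U (f i)) -> Ck k U (fun x => \sum_i f i x).
Proof.
move=> oU hf; elim: (index_enum I) => [|i s IH].
  apply: (@Ck_ext _ _ _ _ (cst 0)) => //; last exact: Ck_cst.
  by move=> x _; rewrite big_nil.
apply: (@Ck_ext _ _ _ _ (fun x => f i x + \sum_(j <- s) f j x)) => //.
  by move=> x _; rewrite big_cons.
exact: Ck_add.
Qed.

Lemma derive_comp E F H (f : E -> F) (g : F -> H) v x :
  differentiable f x -> differentiable g (f x) ->
  'D_v (g \o f) x = 'D_('D_v f x) g (f x).
Proof.
move=> df dg; rewrite !deriveE //; last exact: differentiable_comp.
by rewrite diff_comp.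
Qed.

Lemma Ck_linear_comp E F H (L : {linear F -> H}) k (U : set E) (f : E -> F) :
  open U -> continuous L -> Ck k U f -> Ck k U (L \o f).
Proof.
move=> oU cL; elim: k f => [|k IH] f /=.
  by move=> hf x Ux; apply: continuous_comp; [exact: hf|exact: cL].
move=> [df hf]; split=> [x Ux|v].
  by apply: differentiable_comp; [exact: df|exact: linear_differentiable].
apply: (@Ck_ext _ _ _ _ (L \o 'D_v f)) => //; last exact: IH.
move=> x; rewrite inE => Ux; rewrite derive_comp ?derive_linear //.
  exact: df.
exact: linear_differentiable.
Qed.

(** Scaling is packed as a continuous bilinear map; the product rule is then its differential
    composed with that of the pair [(a, f)]. *)
Lemma differentiable_scale E F (a : E -> R^o) (f : E -> F) x :
  differentiable a x -> differentiable f x ->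
  differentiable (fun y => a y *: f y) x /\
  forall v, 'D_v (fun y => a y *: f y) x = 'D_v a x *: f x + a x *: 'D_v f x.
Proof.
move=> da df.
have bil : bilinear_for (GRing.Scale.Law.clone _ _ *:%R _)
    (GRing.Scale.Law.clone _ _ *:%R _) (fun (r : R^o) (w : F) => r *: w).
  split=> [u|u] b y z /=; first by rewrite scalerDl -scalerA.
  by rewrite scalerDr !scalerA mulrC.
pose bM := bilinear_isBilinear.Build R R^o F F _ _ _ bil.
pose b : {bilinear R^o -> F -> F} := HB.pack (fun (r : R^o) (w : F) => r *: w) bM.
have cb : continuous (fun p : R^o * F => b p.1 p.2).
  by move=> p; exact: scale_continuous.
have dp : differentiable (fun y => (a y, f y)) x by exact: differentiable_pair.
have db := differentiable_bilin (a x, f x) cb.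
split; first exact: (differentiable_comp dp db).
move=> v; rewrite -[LHS]/('D_v ((fun p => b p.1 p.2) \o (fun y => (a y, f y))) x).
rewrite deriveE; last exact: (differentiable_comp dp db).
rewrite (diff_comp dp db) /= (diff_bilin (a x, f x) cb) /= (diff_pair da df) /=.
by rewrite !deriveE // addrC.
Qed.

Lemma Ck_scale E F k (U : set E) (a : E -> R^o) (f : E -> F) :
  open U -> Ck k U a -> Ck k U f -> Ck k U (fun x => a x *: f x).
Proof.
move=> oU; elim: k a f => [|k IH] a f.
  by move=> /= ha hf x Ux; apply: cvgZ; [exact: ha|exact: hf].
move=> Ca Cf; have /CkS[da ha] := Ca; have /CkS[df hf] := Cf; split=> [x Ux|v].
  by have [] := differentiable_scale (da _ Ux) (df _ Ux).
apply: (@Ck_ext _ _ _ _ (fun x => 'D_v a x *: f x + a x *: 'D_v f x)) => //.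
  move=> x; rewrite inE => Ux.
  by have [_ ->] := differentiable_scale (da _ Ux) (df _ Ux).
by apply: Ck_add => //; apply: IH => //; apply: CkS_Ck.
Qed.

Lemma derive_basis E F (I : finType) (e : I -> E) (c : I -> {linear E -> R^o})
    (f : E -> F) x v :
  (forall y, y = \sum_i c i y *: e i) -> differentiable f x ->
  'D_v f x = \sum_i c i v *: 'D_(e i) f x.
Proof.
move=> ce df; rewrite deriveE // {1}(ce v) linear_sum.
by apply: eq_bigr => i _; rewrite linearZ deriveE.
Qed.

(** The chain rule produces a derivative of [g] in the direction ['D_v f x], which moves with [x].
    Expanding that direction in the spanning family leaves only the fixed directions [e i], to which
    the induction hypothesis applies. *)
Lemma Ck_comp E F H k (U : set E) (V : set F) (f : E -> F) (g : F -> H) :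
  findim F -> open U -> open V -> (forall x, U x -> V (f x)) ->
  Ck k U f -> Ck k V g -> Ck k U (g \o f).
Proof.
move=> [I [e [c [cc ce]]]] oU oV; elim: k f g => [|k IH] f g UV.
  by move=> /= hf hg x Ux; apply: continuous_comp; [exact: hf|exact/hg/UV].
move=> Cf Cg; have /CkS[df hf] := Cf; have /CkS[dg hg] := Cg; split=> [x Ux|v].
  by apply: differentiable_comp; [exact: df|exact/dg/UV].
apply: (@Ck_ext _ _ _ _
  (fun x => \sum_i (c i \o 'D_v f) x *: ('D_(e i) g \o f) x)) => //.
  move=> x; rewrite inE => Ux; rewrite derive_comp; [|exact: df|exact/dg/UV].
  by rewrite (derive_basis _ ce) //; exact/dg/UV.
apply: Ck_sum => // i; apply: Ck_scale => //; first exact: Ck_linear_comp.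
by apply: IH => //; exact: CkS_Ck.
Qed.

Lemma derive_pair E F H (f : E -> F) (g : E -> H) v x :
  differentiable f x -> differentiable g x ->
  'D_v (fun y => (f y, g y)) x = ('D_v f x, 'D_v g x).
Proof.
move=> df dg; rewrite !deriveE //; last exact: differentiable_pair.
by rewrite diff_pair.
Qed.

Lemma Ck_pair E F H k (U : set E) (f : E -> F) (g : E -> H) :
  open U -> Ck k U f -> Ck k U g -> Ck k U (fun x => (f x, g x)).
Proof.
move=> oU; elim: k f g => [|k IH] f g /=.
  by move=> hf hg x Ux; apply: cvg_pair; [exact: hf|exact: hg].
move=> [df hf] [dg hg]; split=> [x Ux|v].
  by apply: differentiable_pair; [exact: df|exact: dg].
apply: (@Ck_ext _ _ _ _ (fun x => ('D_v f x, 'D_v g x))) => //; last exact: IH.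
by move=> x; rewrite inE => Ux; rewrite derive_pair; [|exact: df|exact: dg].
Qed.

Lemma Ck_fst E F k (U : set (E * F)) : Ck k U (fst : E * F -> E).
Proof.
have l : linear (fst : E * F -> E) by [].
pose lM := GRing.isLinear.Build _ _ _ _ _ l.
pose L : {linear (E * F)%type -> E} := HB.pack (fst : E * F -> E) lM.
by apply: (@Ck_linear _ _ L) => x; exact: cvg_fst.
Qed.

Lemma Ck_snd E F k (U : set (E * F)) : Ck k U (snd : E * F -> F).
Proof.
have l : linear (snd : E * F -> F) by [].
pose lM := GRing.isLinear.Build _ _ _ _ _ l.
pose L : {linear (E * F)%type -> F} := HB.pack (snd : E * F -> F) lM.
by apply: (@Ck_linear _ _ L) => x; exact: cvg_snd.
Qed.

Lemma Ck_id E k (U : set E) : Ck k U (@idfun E).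
Proof. by apply: (@Ck_linear _ _ (idfun : {linear E -> E})) => x; exact: cvg_id. Qed.

(** Joint regularity in point and direction, again by expanding the direction. This is what makes
    the tangent system of an equation regular enough to be solved. *)
Lemma Ck_derive E F k (U : set E) (f : E -> F) :
  findim E -> open U -> Ck k.+1 U f ->
  Ck k (U `*` [set: E]) (fun p : E * E => 'D_(p.2) f p.1).
Proof.
move=> fdE oU [df hf]; have [I [e [c [cc ce]]]] := fdE.
have oW : open (U `*` [set: E]).
  rewrite openE => -[x y] [/= Ux _]; exists (U, setT) => //=.
  by split; [exact: open_nbhs_nbhs|exact: filterT].
apply: (@Ck_ext _ _ _ _
  (fun p => \sum_i (c i \o snd) p *: ('D_(e i) f \o fst) p)) => //.
  move=> [x v]; rewrite inE => -[/= Ux _]; rewrite -(derive_basis _ ce) //.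
  exact: df.
apply: Ck_sum => // i; apply: Ck_scale => //.
  by apply: Ck_linear_comp => //; exact: Ck_snd.
apply: Ck_comp (Ck_fst _ _) (hf (e i)) => //.
by case=> x v [].
Qed.

Lemma findim_prod E F : findim E -> findim F -> findim (E * F)%type.
Proof.
move=> [I [e [c [cc ce]]]] [J [e' [c' [cc' ce']]]].
have l1 : linear (fst : E * F -> E) by [].
have l2 : linear (snd : E * F -> F) by [].
pose l1M := GRing.isLinear.Build _ _ _ _ _ l1.
pose L1 : {linear (E * F)%type -> E} := HB.pack (fst : E * F -> E) l1M.
pose l2M := GRing.isLinear.Build _ _ _ _ _ l2.
pose L2 : {linear (E * F)%type -> F} := HB.pack (snd : E * F -> F) l2M.
exists (I + J)%type, (fun k => match k with inl i => (e i, 0) | inr j => (0, e' j) end),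
  (fun k => match k return {linear (E * F)%type -> R^o} with
     inl i => (c i \o L1 : {linear _ -> _}) | inr j => (c' j \o L2 : {linear _ -> _}) end).
split=> [[i|j] p|[x y]].
- by apply: continuous_comp; [exact: cvg_fst|exact: cc].
- by apply: continuous_comp; [exact: cvg_snd|exact: cc'].
rewrite big_sumType /=.
have -> : \sum_i c i x *: (e i, (0 : F)) = (x, 0).
  rewrite [in RHS](ce x); elim/big_rec2: _ => //= i a [b1 b2] _ [-> ->].
  by rewrite -[LHS]/(c i x *: e i + a, c i x *: 0 + 0) /= scaler0 addr0.
have -> : \sum_i c' i y *: ((0 : E), e' i) = (0, y).
  rewrite [in RHS](ce' y); elim/big_rec2: _ => //= i a [b1 b2] _ [-> ->].
  by rewrite -[LHS]/(c' i y *: 0 + 0, c' i y *: e' i + a) /= scaler0 addr0.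
by rewrite -[RHS]/(x + 0, 0 + y) addr0 add0r.
Qed.

Lemma findim_R : findim (R : normedModType R).
Proof.
exists unit, (fun=> 1), (fun=> idfun); split=> [_ x|x]; first exact: cvg_id.
by rewrite big_const /= card_unit /= addr0 /GRing.scale /= mulr1.
Qed.

Lemma findim_rV n : findim 'rV[R]_n.
Proof.
have l (j : 'I_n) : linear (fun x : 'rV[R]_n => x ord0 j : R^o).
  by move=> a x y; rewrite !mxE.
pose L j : {linear 'rV[R]_n -> R^o} :=
  HB.pack (fun x : 'rV[R]_n => x ord0 j : R^o) (GRing.isLinear.Build _ _ _ _ _ (l j)).
exists 'I_n, (fun j => delta_mx ord0 j), L; split=> [j x|x].
  exact: (@coord_continuous _ _ _ ord0 j).
exact: row_sum_delta.
Qed.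

End Calculus.

(** * Curves: mean value, Gronwall and antiderivatives *)

Section Curves.
Context {R : realType}.
Implicit Types E F : normedModType R.

Lemma findim_linear_continuous E F (L : {linear E -> F}) :
  findim E -> continuous L.
Proof.
move=> [I [e [c [cc ce]]]] x.
suff : Ck 0 [set: E] L by move=> h; exact: (h x Logic.I).
apply: (@Ck_ext _ _ _ _ _ (fun x => \sum_i c i x *: L (e i))); first exact: openT.
  by move=> y _; rewrite {2}(ce y) linear_sum; apply: eq_bigr => i _; rewrite linearZ.
apply: Ck_sum; first exact: openT.
move=> i; apply: Ck_scale; first exact: openT.
  by apply: Ck_linear; exact: cc.
exact: Ck_cst.
Qed.

Lemma findim_norm E : findim E ->
  exists (I : finType) (e : I -> E) (c : I -> {linear E -> R^o}) (K N : R),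
    [/\ forall i, continuous (c i), forall x, x = \sum_i c i x *: e i,
        0 < K, forall i x, `|c i x| <= K * `|x| & 0 < N /\ \sum_i `|e i| <= N].
Proof.
move=> [I [e [c [cc ce]]]].
have /choice[k hk] : forall i, exists k : R, 0 < k /\ forall x, `|c i x| <= k * `|x|.
  by move=> i; have [k k0 hk] := linear_lipschitz (cc i); exists k.
have s0 : 0 <= \sum_i k i by apply: sumr_ge0 => i _; exact: ltW (hk i).1.
have s1 : 0 <= \sum_i `|e i| by apply: sumr_ge0.
exists I, e, c, (\sum_i k i + 1), (\sum_i `|e i| + 1); split => //.
- by rewrite ltr_wpDl.
- move=> i x; apply: le_trans ((hk i).2 x) _; apply: ler_wpM2r => //.
  rewrite (bigD1 i) //= -addrA lerDl addr_ge0 //.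
  by apply: sumr_ge0 => j _; exact: ltW (hk j).1.
- by split; [rewrite ltr_wpDl|rewrite lerDl].
Qed.

Lemma is_derive_comp E F (f : E -> F) (u : R -> E) t w :
  is_derive t (1 : R) u w -> differentiable f (u t) ->
  is_derive t (1 : R) (f \o u) ('D_w f (u t)).
Proof.
move=> hu df; have /derivable1_diffP du := @ex_derive _ _ _ _ _ _ _ hu.
apply: DeriveDef; first by apply/derivable1_diffP/differentiable_comp.
by rewrite derive_comp // (@derive_val _ _ _ _ _ _ _ hu).
Qed.

Lemma is_derive_linear E F (L : {linear E -> F}) (u : R -> E) t w :
  continuous L -> is_derive t (1 : R) u w ->
  is_derive t (1 : R) (L \o u) (L w).
Proof.
move=> cL hu; rewrite -(derive_linear w (u t) cL); apply: is_derive_comp => //.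
exact: linear_differentiable.
Qed.

Lemma is_derive_continuous E (u : R -> E) t w :
  is_derive t (1 : R) u w -> {for t, continuous u}.
Proof.
move=> hu; apply: differentiable_continuous; apply/derivable1_diffP.
exact: (@ex_derive _ _ _ _ _ _ _ hu).
Qed.

(** Unordered, since flows are followed forwards and backwards in time. *)
Definition between (s t r : R) := s <= r <= t \/ t <= r <= s.

Lemma between_dist (s t r : R) : between s t r -> `|r - s| <= `|t - s|.
Proof.
by case=> /andP[h1 h2]; rewrite ler_norml; apply/andP; split;
  move: (ler_norm (t - s)) (ler_norm (s - t)); rewrite [`|s - t|]distrC; lra.
Qed.

Lemma norm_lt_add E (x y z : E) (r : R) : `|x - y| < r - `|y - z| -> `|x - z| < r.
Proof.
move=> h; rewrite (_ : x - z = (x - y) + (y - z)); last by rewrite addrA subrK.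
apply: le_lt_trans (ler_normD _ _) _.
by rewrite -ltrBrDr.
Qed.

(* The mean value inequality for curves holds with constant 1 in every normed
   space; the weaker form here follows coordinatewise from the real case. *)
Definition mean_value_const E (K : R) := 0 < K /\
  forall (u du : R -> E) (s t M : R),
    (forall r, between s t r -> is_derive r (1 : R) u (du r) /\ `|du r| <= M) ->
    `|u t - u s| <= K * M * `|t - s|.

Lemma findim_mean_value E : findim E -> exists K, mean_value_const E K.
Proof.
move=> /findim_norm[I [e [c [K [N [cc ce K0 hK [N0 hN]]]]]]].
exists (K * N); split; first exact: mulr_gt0.
move=> u du.
have main (s t M : R) : s <= t ->
    (forall r, between s t r -> is_derive r (1 : R) u (du r) /\ `|du r| <= M) ->
    `|u t - u s| <= K * N * M * `|t - s|.
  move=> st h.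
  have M0 : 0 <= M.
    by have [|_] := h s _; [left; rewrite lexx|apply: le_trans; exact: normr_ge0].
  have hi i : `|c i (u t - u s)| <= K * M * `|t - s|.
    have dci r : between s t r -> is_derive r (1 : R) (c i \o u : R -> R) (c i (du r)).
      by move=> /h[hr _]; apply: is_derive_linear.
    have [||r rst] := @MVT_segment R (c i \o u : R -> R) (fun r => c i (du r)) s t st.
    - by move=> r rst; apply: dci; left; rewrite !ltW ?(itvP rst).
    - apply: derivable_within_continuous => r rst.
      have hr : between s t r by left; move: rst; rewrite in_itv.
      exact: (@ex_derive _ _ _ _ _ _ _ (dci r hr)).
    move=> rE; rewrite linearB /=; move: rE => /= ->; rewrite normrM ler_wpM2r //.
    apply: le_trans (hK _ _) _; rewrite ler_pM2l //.
    by have [|_] := h r _; first by left; move: rst; rewrite in_itv.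
  rewrite {1}(ce (u t - u s)); apply: le_trans (ler_norm_sum _ _ _) _.
  have -> : K * N * M * `|t - s| = K * M * `|t - s| * N by ring.
  apply: le_trans (_ : K * M * `|t - s| * \sum_i `|e i| <= _); last first.
    by apply: ler_wpM2l => //; rewrite !mulr_ge0 // ltW.
  by rewrite mulr_sumr; apply: ler_sum => i _; rewrite normrZ ler_wpM2r.
move=> s t M h; have [st|/ltW ts] := leP s t; first exact: main.
rewrite distrC [`|t - s|]distrC; apply: main => // r [] rh; apply: h; [right|left] => //.
Qed.

Lemma short_gronwall E (K L eta T : R) (u du : R -> E) :
  mean_value_const E K -> 0 <= L -> 0 <= eta -> K * L * T <= 2^-1 ->
  (forall t, `|t| < T -> is_derive t (1 : R) u (du t) /\ `|du t| <= L * `|u t| + eta) ->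
  forall t, `|t| < T -> `|u t| <= 2 * (`|u 0| + K * eta * T).
Proof.
move=> [K0 mv] L0 eta0 KLT h t tT.
have T0 : 0 <= T by apply: le_trans (ltW tT).
have [] := @EVT_max R (fun r => `|u r|) (- `|t|) `|t|.
- by rewrite ge0_cp.
- apply: continuous_in_subspaceT => r; rewrite inE /= in_itv /= => rt.
  apply: (@continuous_comp _ _ _ u (fun x : E => `|x|)); last exact: norm_continuous.
  have [|hd _] := h r; first by rewrite (le_lt_trans _ tT) // ler_norml.
  exact: is_derive_continuous hd.
move=> c; rewrite in_itv /= -ler_norml => ct hc.
have cT : `|c| < T by exact: le_lt_trans tT.
have hu r : `|r| <= `|t| -> `|u r| <= `|u c|.
  by move=> rt; apply: hc; rewrite in_itv /= -ler_norml.
have : `|u c - u 0| <= K * (L * `|u c| + eta) * `|c - 0|.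
  apply: (mv u du) => r hr.
  have rc : `|r| <= `|c| by have := between_dist hr; rewrite !subr0.
  have [|hd hle] := h r; first exact: le_lt_trans cT.
  split => //; apply: le_trans hle _; rewrite lerD2r ler_wpM2l //.
  by apply: hu; apply: le_trans ct.
rewrite subr0 => h1.
have h2 : K * (L * `|u c| + eta) * `|c| <= K * (L * `|u c| + eta) * T.
  apply: ler_wpM2l; last exact: ltW.
  by apply: mulr_ge0; [exact: ltW|rewrite addr_ge0 ?mulr_ge0].
have h3 : K * (L * `|u c| + eta) * T = K * L * T * `|u c| + K * eta * T by ring.
have h4 : K * L * T * `|u c| <= 2^-1 * `|u c| by rewrite ler_wpM2r.
have h5 : `|u c| <= `|u 0| + `|u c - u 0| by rewrite -{1}(subrK (u 0) (u c)) addrC ler_normD.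
have h6 := hu t (lexx _).
lra.
Qed.

(** The intervals of radius [2 * C * 2^-n] around [u n] are nested, because the steps from [n] on
    add up to at most that radius; the supremum of their left ends lies in all of them. *)
Lemma nested_limit (u : nat -> R) (C : R) : 0 <= C ->
  (forall n, `|u n.+1 - u n| <= C * 2^-1 ^+ n) ->
  exists l, forall n, `|u n - l| <= 2 * C * 2^-1 ^+ n.
Proof.
move=> C0 h.
pose a n := u n - 2 * C * 2^-1 ^+ n; pose b n := u n + 2 * C * 2^-1 ^+ n.
have p0 n : 0 <= C * 2^-1 ^+ n by rewrite mulr_ge0 // exprn_ge0.
have aS n : a n <= a n.+1.
  by move: (h n); rewrite /a exprS ler_norml => /andP[]; have := p0 n; lra.
have bS n : b n.+1 <= b n.
  by move: (h n); rewrite /b exprS ler_norml => /andP[]; have := p0 n; lra.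
have ab n : a n <= b n by rewrite /a /b; have := p0 n; lra.
have aD n m : a n <= a (n + m)%N.
  by elim: m => [|m IH]; rewrite ?addn0 // addnS; exact: le_trans IH (aS _).
have bD n m : b (n + m)%N <= b n.
  by elim: m => [|m IH]; rewrite ?addn0 // addnS; exact: le_trans (bS _) IH.
have anbm n m : a n <= b m.
  by apply: le_trans (aD n m) _; apply: le_trans (ab _) _; rewrite addnC.
have ub : has_ubound (range a) by exists (b 0%N) => _ [n _ <-].
exists (sup (range a)) => n; rewrite ler_norml.
have l1 : a n <= sup (range a) by apply: ub_le_sup => //; exists n.
have l2 : sup (range a) <= b n.
  by apply: ge_sup; [exists (a 0%N), 0%N|move=> _ [m _ <-]].
by move: l1 l2; rewrite /a /b; lra.
Qed.

(** [K] is chosen before the sequence, so the rate is the same for all times and all initial points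
    of the Picard iterates. *)
Lemma findim_geometric_limit E : findim E -> forall C, 0 <= C -> exists K, 0 <= K /\
  forall u : nat -> E, (forall n, `|u n.+1 - u n| <= C * 2^-1 ^+ n) ->
  exists l, forall n, `|u n - l| <= K * 2^-1 ^+ n.
Proof.
move=> /findim_norm[I [e [c [K [N [cc ce K0 hK [N0 hN]]]]]]] C C0.
exists (2 * (K * C) * N); split; first by rewrite !mulr_ge0 // ltW.
move=> u hu.
have KC0 : 0 <= K * C by rewrite mulr_ge0 // ltW.
have /choice[l hl] : forall i, exists l : R, forall n,
    `|c i (u n) - l| <= 2 * (K * C) * 2^-1 ^+ n.
  move=> i; apply: nested_limit => // n; rewrite -linearB /= -mulrA.
  by apply: le_trans (hK _ _) _; rewrite ler_pM2l.
exists (\sum_i l i *: e i) => n; rewrite {1}(ce (u n)) -sumrB.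
apply: le_trans (ler_norm_sum _ _ _) _.
have p0 : 0 <= 2 * (K * C) * 2^-1 ^+ n by rewrite mulr_ge0 ?exprn_ge0 // mulr_ge0.
apply: le_trans (_ : (2 * (K * C) * 2^-1 ^+ n) * \sum_i `|e i| <= _); last first.
  by rewrite [leRHS]mulrAC ler_wpM2l.
rewrite mulr_sumr; apply: ler_sum => i _.
by rewrite -scalerBl normrZ ler_wpM2r.
Qed.

Lemma real_antiderivative (c : R -> R) (T : R) : 0 < T -> continuous c ->
  exists C : R -> R, C 0 = 0 /\ forall t, `|t| < T -> is_derive t (1 : R) C (c t).
Proof.
move=> T0 cc.
(* Integrating from [- T] makes every [t] of the open interval, positive or negative, an interior
   upper bound; the value at 0 is subtracted afterwards. *)
pose C0 (t : R) : R := \int[lebesgue_measure]_(x in `[- T, t]) c x.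
exists (fun t => C0 t - C0 0); split => [|t]; first by rewrite subrr.
rewrite ltr_norml => /andP[t1 t2].
have tt : t < t + 1 by rewrite ltrDl.
have ic : lebesgue_measure.-integrable `[- T, t + 1] (EFin \o c).
  apply: continuous_compact_integrable; first exact: segment_compact.
  exact: continuous_subspaceT.
have [d1] := continuous_FTC1_closed tt ic t1 (cc t).
rewrite derive1E => d2.
have := @is_deriveB _ _ _ C0 (cst (C0 0)) t 1 (c t) 0 (DeriveDef d1 d2) (is_derive_cst _ _ _).
by rewrite subr0.
Qed.

(** The 1-Lipschitz retraction of the line onto [[- T, T]]: composing with it extends a curve that
    is controlled only there to a continuous curve on the whole line. *)
Definition clamp (T t : R) : R := Num.max (- T) (Num.min T t).

Lemma clamp_le T t : 0 <= T -> `|clamp T t| <= T.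
Proof.
move=> T0; rewrite ler_norml /clamp le_max lexx /= ge_max ge_min lexx /= andbT.
lra.
Qed.

Lemma clamp_id T t : `|t| <= T -> clamp T t = t.
Proof. by rewrite ler_norml => /andP[h1 h2]; rewrite /clamp min_r // max_r. Qed.

Lemma clamp_lip T s t : 0 <= T -> `|clamp T t - clamp T s| <= `|t - s|.
Proof.
move=> T0; rewrite /clamp !maxEle !minEle.
by case: (leP T t) => ?; case: (leP T s) => ?;
  do 2 ?case: (leP (- T) _) => ?; rewrite ler_norml; apply/andP;
  split; move: (ler_norm (t - s)) (ler_norm (s - t)); rewrite [`|s - t|]distrC; lra.
Qed.

Lemma lip_continuous E (u : R -> E) K :
  (forall s t, `|u t - u s| <= K * `|t - s|) -> continuous u.
Proof.
move=> h t; apply/cvgrPdist_lt => eps eps0.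
have K1 : 0 < `|K| + 1 by rewrite ltr_wpDl.
apply/nbhs_ballP; exists (eps / (`|K| + 1)) => /=; first by rewrite divr_gt0.
move=> s; rewrite /ball_ /= ltr_pdivlMr // => ts.
apply: le_lt_trans (h _ _) _; apply: le_lt_trans ts.
rewrite mulrC ler_wpM2l //.
by apply: le_trans (ler_norm K) _; rewrite lerDl.
Qed.

Lemma antiderivative E (T : R) (c : R -> E) : findim E -> 0 < T ->
  (exists K, forall s t, `|s| <= T -> `|t| <= T -> `|c t - c s| <= K * `|t - s|) ->
  exists C : R -> E, C 0 = 0 /\ forall t, `|t| <= T -> is_derive t (1 : R) C (c t).
Proof.
move=> [I [e [l [lc le_]]]] T0 [K hK].
have cc : continuous (c \o clamp T).
  apply: (@lip_continuous _ _ `|K|) => s t /=.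
  apply: le_trans (hK _ _ (clamp_le _ (ltW T0)) (clamp_le _ (ltW T0))) _.
  apply: le_trans (ler_wpM2r _ (ler_norm K)) _ => //.
  by rewrite ler_wpM2l // clamp_lip // ltW.
(* Integration takes place on the larger interval of radius [2 * T], so that the derivative exists
   also at the endpoints [- T] and [T]. *)
have T20 : 0 < 2 * T by rewrite mulr_gt0.
have /choice[C hC] : forall i, exists C : R -> R, C 0 = 0 /\
    forall t, `|t| < 2 * T -> is_derive t (1 : R) C (l i (c (clamp T t))).
  move=> i; apply: (@real_antiderivative (fun t => l i (c (clamp T t))) (2 * T)) => // t.
  by apply: (@continuous_comp _ _ _ (c \o clamp T) (l i)); [exact: cc|exact: lc].
exists (fun t => \sum_i C i t *: e i); split.
  by rewrite big1 // => i _; rewrite (hC i).1 scale0r.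
move=> t tT.
have tT2 : `|t| < 2 * T by lra.
rewrite (le_ (c t)).
have hi i : is_derive t (1 : R) (fun t => C i t *: e i) (l i (c t) *: e i).
  have h := (hC i).2 t tT2; rewrite clamp_id // in h.
  have /derivable1_diffP dC := @ex_derive _ _ _ _ _ _ _ h.
  have [d1 d2] := differentiable_scale dC (differentiable_cst (e i) t).
  apply: DeriveDef; first exact/derivable1_diffP.
  by rewrite d2 derive_cst scaler0 addr0 (@derive_val _ _ _ _ _ _ _ h).
elim: (index_enum I) => [|i s IH].
  under eq_fun do rewrite big_nil.
  by rewrite big_nil; exact: is_derive_cst.
under eq_fun do rewrite big_cons.
by rewrite big_cons; exact: is_deriveD.
Qed.

End Curves.

(** * Existence of local flows *)

Section LocalFlow.
Context {R : realType}.
Implicit Types E F : normedModType R.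

Lemma open_ball_sub E (U : set E) x0 : open U -> U x0 ->
  exists2 r : R, 0 < r & forall x, `|x - x0| < r -> U x.
Proof.
move=> oU Ux0; have /nbhs_ballP[r r0 h] := open_nbhs_nbhs (conj oU Ux0).
exists r => // x xr; apply: h; rewrite -ball_normE /ball_ /=.
by rewrite distrC.
Qed.

Lemma for_continuousP E F (f : E -> F) x :
  {for x, continuous f} <->
  forall eps : R, 0 < eps -> exists2 del, 0 < del &
    forall y, `|y - x| < del -> `|f y - f x| < eps.
Proof.
split.
  move=> /cvgrPdist_lt h eps eps0; have /nbhs_ballP[del d0 hd] := h _ eps0.
  exists del => // y yx; rewrite distrC; apply: hd.
  by rewrite -ball_normE /ball_ /= distrC.
move=> h; apply/cvgrPdist_lt => eps eps0; have [del d0 hd] := h _ eps0.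
apply/nbhs_ballP; exists del => // y; rewrite -ball_normE /ball_ /= => yx.
by rewrite distrC; apply: hd; rewrite distrC.
Qed.

Lemma near_norm_lt E (x0 y : E) (r : R) : `|y - x0| < r ->
  \forall z \near y, `|z - x0| < r.
Proof.
move=> yr; apply/nbhs_ballP; exists (r - `|y - x0|); first by rewrite /= subr_gt0.
move=> z; rewrite -ball_normE /ball_ /= ltrBrDr => h.
apply: le_lt_trans h; rewrite -{1}(subrK y z) -addrA distrC.
by apply: ler_normD.
Qed.

Lemma open_symmetric_interval (T : R) : open [set t : R | `|t| < T].
Proof.
rewrite openE => t /= tT; have := @near_norm_lt R 0 t T; rewrite subr0 => /(_ tT).
by apply: filterS => s; rewrite subr0.
Qed.

Lemma prod_norm_lt E F (p : E * F) (r : R) :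
  (`|p| < r) = (`|p.1| < r) && (`|p.2| < r).
Proof. by rewrite prod_normE gt_max. Qed.

(** The inverse of one plus the sum of the inverses avoids a minimum, and with it the case of an
    empty [I]. *)
Lemma finite_pos_lower_bound (I : finType) (r : I -> R) :
  (forall i, 0 < r i) -> exists2 rho : R, 0 < rho & forall i, rho <= r i.
Proof.
move=> r0; exists (\sum_i (r i)^-1 + 1)^-1.
  by rewrite invr_gt0 ltr_wpDl // sumr_ge0 // => i _; rewrite invr_ge0 ltW.
move=> i; rewrite -[leRHS]invrK lef_pV2 ?posrE ?invr_gt0 //.
  rewrite (bigD1 i) //= -addrA lerDl addr_ge0 // sumr_ge0 // => j _.
  by rewrite invr_ge0 ltW.
by rewrite ltr_wpDl // sumr_ge0 // => j _; rewrite invr_ge0 ltW.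
Qed.

Lemma finite_upper_bound (I : finType) (r : I -> R) :
  exists2 rho : R, 0 < rho & forall i, r i <= rho.
Proof.
exists (\sum_i `|r i| + 1); first by rewrite ltr_wpDl // sumr_ge0.
move=> i; rewrite (bigD1 i) //= -addrA; apply: le_trans (ler_norm _) _.
by rewrite lerDl addr_ge0 // sumr_ge0.
Qed.

Lemma ball_convex E (x0 x y : E) (r a : R) : `|x - x0| < r -> `|y - x0| < r ->
  0 <= a <= 1 -> `|x + a *: (y - x) - x0| < r.
Proof.
move=> hx hy /andP[a0 a1].
have -> : x + a *: (y - x) - x0 = (1 - a) *: (x - x0) + a *: (y - x0).
  have e : y - x = (y - x0) - (x - x0) by rewrite opprB addrA subrK.
  rewrite addrAC e [in LHS]scalerBr scalerBl scale1r -[RHS]addrA.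
  by rewrite [- _ + a *: (y - x0)]addrC.
apply: le_lt_trans (ler_normD _ _) _; rewrite !normrZ !ger0_norm ?subr_ge0 //.
have [->|an1] := eqVneq a 1; first by rewrite subrr mul0r add0r mul1r.
have h1 : (1 - a) * `|x - x0| < (1 - a) * r by rewrite ltr_pM2l // subr_gt0 lt_neqAle an1.
have h2 : a * `|y - x0| <= a * r by rewrite ler_wpM2l // ltW.
lra.
Qed.

Lemma is_derive_segment E F (f : E -> F) (x h : E) (a : R) :
  differentiable f (x + a *: h) ->
  is_derive a (1 : R) (fun a : R => f (x + a *: h)) ('D_h f (x + a *: h)).
Proof.
move=> df.
have d1 : is_derive a (1 : R) (fun a : R => x + a *: h) h.
  have dl : is_derive a (1 : R) (fun a : R => a *: h) h.
    have dz : differentiable (fun a : R => a *: h) a by exact: ex_diff.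
    apply: DeriveDef; first exact/derivable1_diffP.
    by rewrite deriveE // diff_val scale1r.
  have := @is_deriveD _ _ _ (cst x) (fun a : R => a *: h) a 1 0 h (is_derive_cst _ _ _) dl.
  by rewrite add0r.
exact: (is_derive_comp d1 df).
Qed.

Lemma local_lipschitz E F (U : set E) (f : E -> F) x0 :
  findim E -> findim F -> open U -> U x0 -> Ck 1 U f ->
  exists r L : R, [/\ 0 < r, 0 < L, forall x, `|x - x0| < r -> U x,
    forall x v, `|x - x0| < r -> `|'D_v f x| <= L * `|v| &
    forall x y, `|x - x0| < r -> `|y - x0| < r -> `|f y - f x| <= L * `|y - x|].
Proof.
move=> /findim_norm[I [e [c [K [N [cc ce K0 hK [N0 hN]]]]]]].
move=> /findim_mean_value[kF [kF0 mv]] oU Ux0 [df Cf].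
have [r0 r00 hr0] := open_ball_sub oU Ux0.
have /choice[del hdel] : forall i, exists del : R, 0 < del /\
    forall y, `|y - x0| < del -> `|'D_(e i) f y - 'D_(e i) f x0| < 1.
  by move=> i; have /for_continuousP/(_ 1 ltr01)[d d0 hd] := Cf (e i) x0 Ux0; exists d.
have [rho rho0 hrho] := finite_pos_lower_bound (fun i => (hdel i).1).
have [B B0 hB] := finite_upper_bound (fun i => `|'D_(e i) f x0| + 1).
(* [K] bounds the coordinates of a direction, [B] the derivatives along the [e i] near [x0], and
   there are [#|I|] terms; the added 1 keeps the constant positive when [I] is empty. *)
pose L0 := K * B * (#|I|%:R + 1).
have L00 : 0 < L0 by rewrite !mulr_gt0 // ltr_wpDl.
pose r := Num.min r0 rho.
have rr0 x : `|x - x0| < r -> U x by rewrite lt_min => /andP[/hr0].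
have hD x v : `|x - x0| < r -> `|'D_v f x| <= L0 * `|v|.
  move=> xr; rewrite (derive_basis _ ce); last exact/df/rr0.
  apply: le_trans (ler_norm_sum _ _ _) _.
  apply: le_trans (_ : \sum_(i in I) (K * `|v|) * B <= _).
    apply: ler_sum => i _; rewrite normrZ ler_pM //.
    apply: le_trans (hB i); rewrite -lerBlDl.
    have xd : `|x - x0| < del i.
      by move: xr; rewrite lt_min => /andP[_ /lt_le_trans]; apply.
    have := (hdel i).2 x xd => /ltW; apply: le_trans.
    by rewrite lerBlDr; rewrite -{1}(subrK ('D_(e i) f x0) ('D_(e i) f x)) ler_normD.
  rewrite sumr_const -mulr_natr /L0.
  have -> : K * B * (#|I|%:R + 1) * `|v| = K * `|v| * B * (#|I|%:R + 1) by ring.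
  by rewrite ler_wpM2l ?lerDl // !mulr_ge0 // ltW.
have h0 : 0 < r by rewrite lt_min r00.
exists r, (Num.max L0 (kF * L0)); split => //.
- by rewrite lt_max L00.
- move=> x v xr; apply: le_trans (hD x v xr) _.
  by rewrite ler_wpM2r // le_max lexx.
move=> x y xr yr.
have e1 : x + (1 : R) *: (y - x) = y by rewrite scale1r addrC subrK.
have e0 : x + (0 : R) *: (y - x) = x by rewrite scale0r addr0.
have := mv (fun a : R => f (x + a *: (y - x)))
   (fun a : R => 'D_(y - x) f (x + a *: (y - x))) 0 1 (L0 * `|y - x|).
rewrite e1 e0 subr0 normr1 mulr1 => h.
apply: le_trans (h _) _; last first.
  by rewrite mulrA ler_wpM2r // le_max lexx orbT.
move=> a a01; have {}a01 : 0 <= a <= 1.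
  by case: a01 => // /andP[h1 h2]; move: (le_trans h1 h2); lra.
have hb := ball_convex xr yr a01.
split; last exact: hD.
by apply: is_derive_segment; exact/df/rr0.
Qed.

(** Along the segment from [x] to [y] the remainder has derivative ['D_(y - x) f] at the moving
    point minus its value at [x]. The derivatives along the [e i] are locally Lipschitz, so this is
    quadratic in [y - x], and the mean value inequality concludes. *)
Lemma local_taylor E (U : set E) (f : E -> E) x0 :
  findim E -> open U -> U x0 -> Ck 2 U f ->
  exists r L C : R, [/\ 0 < r, 0 < L, 0 < C, forall x, `|x - x0| < r -> U x &
    [/\ forall x v, `|x - x0| < r -> `|'D_v f x| <= L * `|v|,
     forall x y, `|x - x0| < r -> `|y - x0| < r -> `|f y - f x| <= L * `|y - x| &
     forall x y, `|x - x0| < r -> `|y - x0| < r ->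
       `|f y - f x - 'D_(y - x) f x| <= C * `|y - x| ^+ 2]].
Proof.
move=> fE oU Ux0 Cf; have /CkS[df Cdf] := Cf.
have [r1 [L [r10 L0 U1 D1 lip1]]] := local_lipschitz fE fE oU Ux0 (CkS_Ck Cf).
have [I [e [c [K [N [cc ce K0 hK [N0 hN]]]]]]] := findim_norm fE.
have [kE [kE0 mv]] := findim_mean_value fE.
have /choice[rl hrl] : forall i, exists rl : R * R, [/\ 0 < rl.1, 0 < rl.2 &
    forall x y, `|x - x0| < rl.1 -> `|y - x0| < rl.1 ->
      `|'D_(e i) f y - 'D_(e i) f x| <= rl.2 * `|y - x|].
  move=> i; have [r [l [r0 l0 _ _ h]]] := local_lipschitz fE fE oU Ux0 (Cdf (e i)).
  by exists (r, l).
have [rho rho0 hrho] : exists2 rho : R, 0 < rho & forall i, rho <= (rl i).1.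
  by apply: finite_pos_lower_bound => i; have [] := hrl i.
have [B B0 hB] := finite_upper_bound (fun i => (rl i).2).
pose C := K * B * (#|I|%:R + 1).
have C0 : 0 < C by rewrite !mulr_gt0 // ltr_wpDl.
pose r := Num.min r1 rho.
have rr1 x : `|x - x0| < r -> `|x - x0| < r1 by rewrite lt_min => /andP[].
have dfr x : `|x - x0| < r -> differentiable f x by move=> /rr1/U1; exact: df.
have hD x y v : `|x - x0| < r -> `|y - x0| < r ->
    `|'D_v f y - 'D_v f x| <= C * `|y - x| * `|v|.
  move=> xr yr; rewrite !(derive_basis _ ce) //; try exact: dfr.
  rewrite -sumrB; apply: le_trans (ler_norm_sum _ _ _) _.
  apply: le_trans (_ : \sum_(i in I) (K * `|v|) * (B * `|y - x|) <= _).
    apply: ler_sum => i _; rewrite -scalerBr normrZ ler_pM //.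
    have [r0 l0 h] := hrl i.
    have xd z : `|z - x0| < r -> `|z - x0| < (rl i).1.
      by rewrite lt_min => /andP[_ /lt_le_trans]; apply.
    by apply: le_trans (h x y (xd _ xr) (xd _ yr)) _; rewrite ler_wpM2r.
  rewrite sumr_const -mulr_natr /C.
  have -> : K * B * (#|I|%:R + 1) * `|y - x| * `|v| =
    K * `|v| * (B * `|y - x|) * (#|I|%:R + 1) by ring.
  by rewrite ler_wpM2l ?lerDl // !mulr_ge0 // ltW.
exists r, L, (kE * C); split => //.
- by rewrite lt_min r10.
- exact: mulr_gt0.
- by move=> x /rr1/U1.
split.
- by move=> x v /rr1; exact: D1.
- by move=> x y /rr1 + /rr1; exact: lip1.
move=> x y xr yr.
have e1 : x + (1 : R) *: (y - x) = y by rewrite scale1r addrC subrK.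
have e0 : x + (0 : R) *: (y - x) = x by rewrite scale0r addr0.
have := mv (fun a : R => f (x + a *: (y - x)) - a *: 'D_(y - x) f x)
   (fun a : R => 'D_(y - x) f (x + a *: (y - x)) - 'D_(y - x) f x)
   0 1 (C * `|y - x| ^+ 2).
rewrite e1 e0 scale1r scale0r !subr0 normr1 mulr1 [f y - _ - f x]addrAC mulrA; apply.
move=> a a01; have {}a01 : 0 <= a <= 1.
  by case: a01 => // /andP[h1 h2]; move: (le_trans h1 h2); lra.
have hb := ball_convex xr yr a01; split.
  apply: is_deriveB; first by apply: is_derive_segment; exact: dfr.
  have dz : differentiable (fun a : R => a *: 'D_(y - x) f x) a by exact: ex_diff.
  apply: DeriveDef; first exact/derivable1_diffP.
  by rewrite deriveE // diff_val scale1r.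
apply: le_trans (hD _ _ _ xr hb) _.
rewrite addrAC subrr add0r normrZ expr2 -mulrA ler_wpM2l ?(ltW C0) // ler_wpM2r //.
by case/andP: a01 => a0 a1; rewrite ger0_norm // ler_piMl.
Qed.

(** The Gronwall bound without error term. Equal initial values give uniqueness; different ones give
    Lipschitz dependence on the initial value. *)
Lemma solution_dist E (W : set E) (f : E -> E) (K L T : R) (u v : R -> E) :
  mean_value_const E K -> 0 <= L -> K * L * T <= 2^-1 ->
  (forall x y, W x -> W y -> `|f y - f x| <= L * `|y - x|) ->
  (forall t, `|t| < T -> W (u t) /\ is_derive t (1 : R) u (f (u t))) ->
  (forall t, `|t| < T -> W (v t) /\ is_derive t (1 : R) v (f (v t))) ->
  forall t, `|t| < T -> `|u t - v t| <= 2 * `|u 0 - v 0|.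
Proof.
move=> mv L0 KLT lip hu hv t tT.
have := @short_gronwall R E K L 0 T (fun t => u t - v t)
  (fun t => f (u t) - f (v t)) mv L0 (lexx _) KLT.
rewrite mulr0 mul0r addr0; apply => // s sT.
have [Wu du] := hu s sT; have [Wv dv] := hv s sT; split.
  exact: is_deriveB.
by rewrite addr0; apply: lip.
Qed.

Lemma le_geometric (a b K : R) : 0 <= K -> (forall n, a <= b + K * 2^-1 ^+ n) -> a <= b.
Proof.
move=> K0 h; apply/ler_addgt0Pr => eps eps0.
have : (fun n => K * 2^-1 ^+ n) @ \oo --> (0 : R).
  by apply: cvg_geometric; rewrite ger0_norm // invf_lt1 // ltr1n.
move=> /cvgrPdist_lt/(_ _ eps0)[n _ /(_ n (leqnn _))] /=.
rewrite sub0r normrN => hn; apply: le_trans (h n) _; rewrite lerD2l.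
by apply: ltW; apply: le_lt_trans (ler_norm _) hn.
Qed.

Definition local_flow E (U : set E) (f : E -> E) (x0 : E) (T r : R)
    (phi : R -> E -> E) :=
  forall x, `|x - x0| < r -> phi 0 x = x /\
    forall t, `|t| < T -> U (phi t x) /\ is_derive t (1 : R) (phi^~ x) (f (phi t x)).

Lemma between_le (s t r T : R) : `|s| <= T -> `|t| <= T -> between s t r -> `|r| <= T.
Proof.
by rewrite !ler_norml => /andP[? ?] /andP[? ?] [] /andP[? ?]; apply/andP; split; lra.
Qed.

Lemma picard E (U : set E) (f : E -> E) x0 :
  findim E -> open U -> U x0 -> Ck 1 U f ->
  exists T r phi, [/\ 0 < T, 0 < r, local_flow U f x0 T r phi &
    forall t x, `|t| < T -> `|x - x0| < r ->
      {for (t, x), continuous (fun p : R * E => phi p.1 p.2)}].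
Proof.
move=> fE oU Ux0 Cf; have [K mvc] := findim_mean_value fE; have [K0 mv] := mvc.
have [r0 [L [r00 L0 U0 _ lip]]] := local_lipschitz fE fE oU Ux0 Cf.
pose B := `|f x0| + L * r0 + 1.
have B0 : 0 < B by rewrite ltr_wpDl // addr_ge0 // mulr_ge0 // ltW.
have hB x : `|x - x0| < r0 -> `|f x| <= B.
  move=> xr; have x00 : `|x0 - x0| < r0 by rewrite subrr normr0.
  have h1 := lip _ _ x00 xr.
  have h2 : L * `|x - x0| <= L * r0 by rewrite ler_wpM2l // ltW.
  have h3 : `|f x| <= `|f x - f x0| + `|f x0| by rewrite -{1}(subrK (f x0) (f x)) ler_normD.
  by rewrite /B; lra.
(* The first summand gives [K * L * T <= 1/2], the contraction factor; the second keeps curves of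
   speed at most [B] starting in the ball of radius [r0 / 2] inside the ball of radius [r0]. *)
pose T := (2 * K * L + 4 * K * B / r0)^-1.
have TD0 : 0 < 2 * K * L + 4 * K * B / r0.
  by rewrite addr_gt0 // ?divr_gt0 // !mulr_gt0.
have T0 : 0 < T by rewrite invr_gt0.
have a0 : 0 < 4 * K * B / r0 by rewrite divr_gt0 // !mulr_gt0.
have b0 : 0 < 2 * K * L by rewrite !mulr_gt0.
have KLT : K * L * T <= 2^-1.
  rewrite /T ler_pdivrMr // ; lra.
have KBT : K * B * T < r0 / 2.
  rewrite /T ltr_pdivrMr //.
  have -> : r0 / 2 * (2 * K * L + 4 * K * B / r0) = r0 * K * L + 2 * K * B.
    by field; rewrite gt_eqF.
  have : 0 < r0 * K * L by rewrite !mulr_gt0.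
  have : 0 < K * B by rewrite mulr_gt0.
  lra.
have KBT0 : 0 <= K * B * T by rewrite !mulr_ge0 // ltW.
(* Picard iteration: the iterates [X n x] stay in the ball where [f] is
   [L]-Lipschitz, and consecutive ones differ by at most [K B T 2^-n]. *)
pose lipT (c : R -> E) := exists k, forall s t, `|s| <= T -> `|t| <= T ->
  `|c t - c s| <= k * `|t - s|.
(* Choice turns antiderivatives into a total operator on curves, with an arbitrary value on curves
   that are not Lipschitz, so that the iterates can be defined before they are known to be
   Lipschitz. *)
have /choice[A hA] : forall c : R -> E, exists C : R -> E, lipT c ->
    C 0 = 0 /\ forall t, `|t| <= T -> is_derive t (1 : R) C (c t).
  move=> c; have [lc|nlc] := pselect (lipT c); last by exists c.
  by have [C hC] := antiderivative fE T0 lc; exists C.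
pose r := r0 / 2.
pose X := fix X (n : nat) (x : E) : R -> E :=
  if n is n'.+1 then fun t => x + A (fun s => f (X n' x s)) t else cst x.
(* The class preserved by the iteration: a speed bound makes the curve Lipschitz and keeps it in the
   ball, hence [f] along it is Lipschitz in time and can be integrated again. *)
pose good (x : E) (u : R -> E) := u 0 = x /\
  exists du, forall t, `|t| <= T -> is_derive t (1 : R) u (du t) /\ `|du t| <= B.
have T00 : `|0 : R| <= T by rewrite normr0 ltW.
have goodlip x u : good x u -> forall s t, `|s| <= T -> `|t| <= T ->
    `|u t - u s| <= K * B * `|t - s|.
  move=> [_ [du hdu]] s t sT tT; apply: (mv u du) => q hq; apply: hdu.
  exact: between_le hq.
have goodin x u : good x u -> forall t, `|t| <= T -> `|u t - x| <= K * B * T.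
  move=> gu t tT; have := goodlip x u gu 0 t T00 tT; rewrite gu.1 subr0 => /le_trans.
  by apply; rewrite ler_wpM2l // mulr_ge0 // ltW.
have inball x y : `|x - x0| < r -> `|y - x| <= K * B * T -> `|y - x0| < r0.
  move=> xr yx; have -> : y - x0 = (y - x) + (x - x0) by rewrite addrA subrK.
  by apply: le_lt_trans (ler_normD _ _) _; move: xr; rewrite /r; lra.
have flip x u : `|x - x0| < r -> (forall t, `|t| <= T -> `|u t - x| <= K * B * T) ->
    (forall s t, `|s| <= T -> `|t| <= T -> `|u t - u s| <= K * B * `|t - s|) ->
    lipT (fun t => f (u t)).
  move=> xr uin ulip; exists (L * (K * B)) => s t sT tT.
  apply: le_trans (lip _ _ _ _) _; try by apply: (inball x) => //; exact: uin.
  by rewrite -mulrA ler_pM2l //; exact: ulip.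
have step x u : `|x - x0| < r -> (forall t, `|t| <= T -> `|u t - x| <= K * B * T) ->
    lipT (fun t => f (u t)) ->
    good x (fun t => x + A (fun s => f (u s)) t) /\ forall t, `|t| <= T ->
      is_derive t (1 : R) (fun t => x + A (fun s => f (u s)) t) (f (u t)).
  move=> xr uin /hA[A0 dA].
  have d t : `|t| <= T ->
      is_derive t (1 : R) (fun t => x + A (fun s => f (u s)) t) (f (u t)).
    move=> tT; have := @is_deriveD _ _ _ (cst x) _ t 1 0 _ (is_derive_cst _ _ _) (dA t tT).
    by rewrite add0r.
  split => //; split; first by rewrite A0 addr0.
  exists (fun t => f (u t)) => t tT; split; first exact: d.
  by apply: hB; apply: (inball x) => //; exact: uin.
have Xgood n x : `|x - x0| < r -> good x (X n x).
  move=> xr; elim: n => [|n IH] /=.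
    split => //; exists (fun=> 0) => t _; split; first exact: is_derive_cst.
    by rewrite normr0 ltW.
  apply: (step x (X n x) xr _ _).1; first exact: goodin.
  by apply: (flip x) => //; [exact: goodin|exact: goodlip IH].
have Xderiv n x t : `|x - x0| < r -> `|t| <= T ->
    is_derive t (1 : R) (X n.+1 x) (f (X n x t)).
  move=> xr tT; have g := Xgood n x xr.
  apply: (step x (X n x) xr _ _).2 => //; first exact: goodin.
  by apply: (flip x) => //; [exact: goodin|exact: goodlip g].
have Xin n x t : `|x - x0| < r -> `|t| <= T -> `|X n x t - x0| < r0.
  by move=> xr tT; apply: (inball x) => //; apply: goodin => //; exact: Xgood.
have Xdist n x t : `|x - x0| < r -> `|t| <= T ->
    `|X n.+1 x t - X n x t| <= (K * B * T) * 2^-1 ^+ n.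
  move=> xr; elim: n t => [|n IH] t tT.
    by rewrite expr0 mulr1; apply: goodin => //; exact: (Xgood 1%N).
  have := mv (fun t => X n.+2 x t - X n.+1 x t) (fun t => f (X n.+1 x t) - f (X n x t))
    0 t (L * ((K * B * T) * 2^-1 ^+ n)).
  rewrite (Xgood n.+1 x xr).1 (Xgood n.+2 x xr).1 subrr !subr0 => h.
  apply: le_trans (h _) _.
    move=> q /(between_le T00 tT) qT; split.
      by apply: is_deriveB; exact: Xderiv.
    apply: le_trans (lip _ _ _ _) _; try exact: Xin.
    by rewrite ler_pM2l //; exact: IH.
  have p0 : 0 <= K * B * T * 2^-1 ^+ n by rewrite mulr_ge0 // exprn_ge0.
  have h1 : K * L * `|t| <= 2^-1.
    by apply: le_trans KLT; rewrite ler_wpM2l // mulr_ge0 // ltW.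
  have := ler_wpM2r p0 h1; rewrite exprS; move: (2^-1 ^+ n) => z; lra.
have [K' [K'0 lim]] := findim_geometric_limit fE KBT0.
have /choice[phi hphi] : forall p : R * E, exists l, `|p.2 - x0| < r -> `|p.1| <= T ->
    forall n, `|X n p.2 p.1 - l| <= K' * 2^-1 ^+ n.
  move=> [t x] /=; have [[xr tT]|h] := pselect (`|x - x0| < r /\ `|t| <= T).
    have [l hl] := lim (fun n => X n x t) (fun n => Xdist n x t xr tT).
    by exists l.
  by exists 0 => xr tT; case: h.
have phin x t : `|x - x0| < r -> `|t| <= T -> `|phi (t, x) - x| <= K * B * T.
  move=> xr tT; apply: (le_geometric K'0) => n.
  have -> : phi (t, x) - x = (X n x t - x) + (phi (t, x) - X n x t).
    by rewrite [RHS]addrC addrA subrK.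
  apply: le_trans (ler_normD _ _) _; apply: lerD.
    by apply: goodin => //; exact: Xgood.
  by rewrite distrC; exact: (hphi (t, x)).
have phlip x : `|x - x0| < r -> forall s t, `|s| <= T -> `|t| <= T ->
    `|phi (t, x) - phi (s, x)| <= K * B * `|t - s|.
  move=> xr s t sT tT; apply: (@le_geometric _ _ (K' + K')) => [|n]; first exact: addr_ge0.
  have -> : phi (t, x) - phi (s, x) =
     (phi (t, x) - X n x t) + (X n x t - X n x s) + (X n x s - phi (s, x)).
    by rewrite !addrA !subrK.
  apply: le_trans (ler_normD _ _) _.
  have h1 := ler_normD (phi (t, x) - X n x t) (X n x t - X n x s).
  have h2 := goodlip _ _ (Xgood n x xr) s t sT tT.
  have h3 := hphi (t, x) xr tT n; have h4 := hphi (s, x) xr sT n.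
  move: h1 h3 h4; rewrite [`|phi (t, x) - _|]distrC /=; lra.
have phstep x (xr : `|x - x0| < r) := step x (fun s => phi (s, x)) xr
  (fun t => phin x t xr) (flip x _ xr (fun t => phin x t xr) (phlip x xr)).
(* The limit is a fixed point: the iterate [X n.+1] is within a multiple of [2^-n] of both sides, by
   the contraction estimate on the right-hand one. *)
have phE x t : `|x - x0| < r -> `|t| <= T ->
    phi (t, x) = x + A (fun s => f (phi (s, x))) t.
  move=> xr tT; have [[z0 _] dz] := phstep x xr.
  apply/eqP; rewrite -subr_eq0 -normr_le0.
  apply: (@le_geometric _ _ (K' + K')) => [|n]; first exact: addr_ge0.
  set z := fun t => x + _ in z0 dz *; rewrite -[x + _]/(z t).
  have -> : phi (t, x) - z t = (phi (t, x) - X n.+1 x t) + (X n.+1 x t - z t).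
    by rewrite addrA subrK.
  apply: le_trans (ler_normD _ _) _; rewrite distrC.
  have := mv (fun t => X n.+1 x t - z t) (fun t => f (X n x t) - f (phi (t, x)))
    0 t (L * (K' * 2^-1 ^+ n)).
  rewrite (Xgood n.+1 x xr).1 (z0 : z 0 = x) subrr !subr0 => h.
  have h1 : `|X n.+1 x t - z t| <= 2^-1 * (K' * 2^-1 ^+ n).
    apply: le_trans (h _) _.
      move=> q /(between_le T00 tT) qT; split.
        by apply: is_deriveB; [exact: Xderiv|exact: dz].
      apply: le_trans (lip _ _ _ _) _; try exact: Xin.
        by apply: (inball x) => //; exact: phin.
      by rewrite ler_pM2l //; exact: (hphi (q, x)).
    rewrite mulrA mulrAC ler_wpM2r ?mulr_ge0 ?exprn_ge0 //.
    by apply: le_trans KLT; rewrite ler_wpM2l // mulr_ge0 // ltW.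
  have h2 := hphi (t, x) xr tT n.+1; move: h2; rewrite exprS /=.
  have : 0 <= K' * 2^-1 ^+ n by rewrite mulr_ge0 // exprn_ge0.
  by move: h1; move: (2^-1 ^+ n) => w; lra.
have flow x t : `|x - x0| < r -> `|t| < T ->
    `|phi (t, x) - x0| < r0 /\ is_derive t (1 : R) (fun s => phi (s, x)) (f (phi (t, x))).
  move=> xr tT; split; first by apply: (inball x) => //; apply: phin => //; exact: ltW.
  have [_ dz] := phstep x xr.
  (* The fixed-point identity holds for times in [[- T, T]] only; it can be differentiated where it
     holds on a neighbourhood, hence the strict bound on [t]. *)
  apply: near_eq_is_derive (dz t (ltW tT)).
  apply: filterS (open_nbhs_nbhs (conj (@open_symmetric_interval T) tT)) => s /= sT.
  by rewrite [RHS]phE // ltW.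
exists T, r, (fun t x => phi (t, x)); split => //; first by rewrite divr_gt0.
  move=> x xr; split=> [|t tT].
    by rewrite phE // (phstep x xr).1.1.
  by have [h1 h2] := flow x t xr tT; split => //; exact: U0.
move=> t x tT xr; apply/for_continuousP => eps eps0.
(* [K * B] is the Lipschitz constant in time and [2] the one in the initial point, so the two
   increments add up to at most [eps / 2]. *)
pose del := Num.min (Num.min (T - `|t|) (r - `|x - x0|)) (eps / (2 * (K * B + 2))).
have KB0 : 0 < K * B by rewrite mulr_gt0.
exists del.
  by rewrite !lt_min !subr_gt0 tT xr divr_gt0 // mulr_gt0 // addr_gt0.
move=> [s y]; rewrite prod_norm_lt /= !lt_min.
move=> /andP[/andP[/andP[h1 h2] h3] /andP[/andP[h4 h5] h6]].
have sT : `|s| < T.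
  by rewrite -[s]subr0; apply: (@norm_lt_add _ _ _ t); rewrite subr0.
have yr : `|y - x0| < r by exact: (norm_lt_add h5).
have d1 := phlip y yr t s (ltW tT) (ltW sT).
have d2 := @solution_dist E [set x | `|x - x0| < r0] f K L T
  (fun t => phi (t, y)) (fun t => phi (t, x)) mvc (ltW L0) KLT lip
  (fun t => flow y t yr) (fun t => flow x t xr) t tT.
have e0 z : `|z - x0| < r -> phi (0, z) = z.
  by move=> zr; rewrite phE // (phstep z zr).1.1.
rewrite !e0 // in d2.
have -> : phi (s, y) - phi (t, x) = (phi (s, y) - phi (t, y)) + (phi (t, y) - phi (t, x)).
  by rewrite addrA subrK.
apply: le_lt_trans (ler_normD _ _) _.
have d3 : K * B * `|s - t| <= K * B * (eps / (2 * (K * B + 2))).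
  by rewrite ler_pM2l // ltW.
have d4 : K * B * (eps / (2 * (K * B + 2))) + 2 * (eps / (2 * (K * B + 2))) = eps / 2.
  by field; rewrite gt_eqF // addr_gt0.
have d5 : `|phi (s, y) - phi (t, y)| + `|phi (t, y) - phi (t, x)| <=
    K * B * (eps / (2 * (K * B + 2))) + 2 * (eps / (2 * (K * B + 2))).
  apply: lerD; first exact: le_trans d1 d3.
  by apply: le_trans d2 _; rewrite ler_pM2l // ltW.
by apply: le_lt_trans d5 _; rewrite d4 ltr_pdivrMr // ltr_pMr // ltr1n.
Qed.

End LocalFlow.

(** * Smooth dependence on initial conditions *)

Section SmoothDependence.
Context {R : realType}.
Implicit Types E F : normedModType R.

Lemma differentiable_eps E F (f : E -> F) x (L : {linear E -> F}) :
  continuous L ->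
  (forall eps : R, 0 < eps -> exists2 del, 0 < del & forall h : E, `|h| < del ->
    `|f (h + x) - f x - L h| <= eps * `|h|) ->
  differentiable f x /\ forall v, 'D_v f x = L v.
Proof.
move=> cL hf.
have fE : f \o shift x = cst (f x) + L +o_ (0 : E) id.
  apply/eqaddoP => eps eps0; have [del del0 hd] := hf _ eps0.
  apply/nbhs_ballP; exists del => // h; rewrite -ball_normE /ball_ /= sub0r normrN => hh.
  by rewrite !fctE /= opprD addrA; exact: hd.
have dE : 'd f x = L :> (E -> F) by exact: diff_unique.
have df : differentiable f x by apply/diff_locallyP; rewrite dE.
by split=> // v; rewrite deriveE // dE.
Qed.

Lemma is_derive_fst E F (u : R -> E * F) t w :
  is_derive t (1 : R) u w -> is_derive t (1 : R) (fun s => (u s).1) w.1.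
Proof.
have l : linear (fst : E * F -> E) by [].
pose L : {linear (E * F)%type -> E} :=
  HB.pack (fst : E * F -> E) (GRing.isLinear.Build _ _ _ _ _ l).
by apply: (@is_derive_linear _ _ _ L) => x; exact: cvg_fst.
Qed.

Lemma is_derive_snd E F (u : R -> E * F) t w :
  is_derive t (1 : R) u w -> is_derive t (1 : R) (fun s => (u s).2) w.2.
Proof.
have l : linear (snd : E * F -> F) by [].
pose L : {linear (E * F)%type -> F} :=
  HB.pack (snd : E * F -> F) (GRing.isLinear.Build _ _ _ _ _ l).
by apply: (@is_derive_linear _ _ _ L) => x; exact: cvg_snd.
Qed.

Lemma is_derive_lincomb E (I : finType) (a : I -> R) (u : I -> R -> E) du t :
  (forall i, is_derive t (1 : R) (u i) (du i)) ->
  is_derive t (1 : R) (fun s => \sum_i a i *: u i s) (\sum_i a i *: du i).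
Proof.
move=> h; elim: (index_enum I) => [|i s IH].
  by under eq_fun do rewrite big_nil; rewrite big_nil; exact: is_derive_cst.
under eq_fun do rewrite big_cons; rewrite big_cons.
by apply: is_deriveD => //; exact: is_deriveZ.
Qed.

Definition box E (x0 : E) (T r : R) : set (R * E) :=
  [set p | `|p.1| < T /\ `|p.2 - x0| < r].

Lemma open_box E (x0 : E) (T r : R) : open (box x0 T r).
Proof.
rewrite openE => -[t x] [/= tT xr].
exists ([set s : R | `|s| < T], [set y | `|y - x0| < r]) => //=; split => //=.
  have := @near_norm_lt R R 0 t T; rewrite subr0 => /(_ tT).
  by apply: filterS => s; rewrite subr0.
exact: near_norm_lt.
Qed.

(* Induction on [k]: the tangent system [(x, v)' = (f x, D_v f x)] has one
   derivative less, and the second component of its flow is the derivative of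
   the flow of [f] in the direction [v].  Since [T] and [r] shrink with [k],
   smoothness of the flow is only obtained one [k] at a time. *)
Lemma local_flow_Ck k E (U : set E) (f : E -> E) (x0 : E) :
  findim E -> open U -> U x0 -> Ck k.+2 U f ->
  exists T r phi, [/\ 0 < T, 0 < r, local_flow U f x0 T r phi &
    Ck k (box x0 T r) (fun p : R * E => phi p.1 p.2)].
Proof.
elim: k E U f x0 => [|k IH] E U f x0 fE oU Ux0 Cf.
  have [T [r [phi [T0 r0 fl cphi]]]] := picard fE oU Ux0 (CkS_Ck Cf).
  exists T, r, phi; split => // -[t x] [/= tT xr]; exact: cphi.
have oUT : open (U `*` [set: E]).
  rewrite openE => -[x y] [/= Ux _]; exists (U, setT) => //=.
  by split; [exact: open_nbhs_nbhs|exact: filterT].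
pose fT (p : E * E) := (f p.1, 'D_(p.2) f p.1).
(* Here [f] is $C^{k+3}$, so its tangent system is $C^{k+2}$ and the flow [Phi] below is $C^k$; the
   formula for the derivative of [phi] then makes [phi] of class $C^{k+1}$. *)
have CT : Ck k.+2 (U `*` [set: E]) fT.
  apply: Ck_pair => //; last exact: Ck_derive.
  apply: (Ck_comp fE oUT oU _ (Ck_fst _ _) (CkS_Ck Cf)).
  by case=> x v [].
have fEE : findim (E * E)%type by exact: findim_prod.
have fREE : findim (R * (E * E))%type by exact: findim_prod findim_R _.
have fRE : findim (R * E)%type by exact: findim_prod findim_R _.
(* Directions near 0 are enough, because the second equation is linear in the direction and
   solutions can be rescaled. *)
have [T0 [r0 [Phi [T00 r00 fl CPhi]]]] := IH _ _ fT (x0, 0) fEE oUT (conj Ux0 Logic.I) CT.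
have [rho [L [C [rho0 L0 C0 _ [Df lip tay]]]]] :=
  local_taylor fE oU Ux0 (Ck_le (isT : (2 <= k.+3)%N) Cf).
have [K mvc] := findim_mean_value fE; have [K0 mv] := mvc.
have [I [e [c [_ [N [cc ce _ _ [N0 hN]]]]]]] := findim_norm fE.
have norm0 : `|(x0, 0 : E) - (x0, 0)| < r0 by rewrite subrr normr0.
have Phi0 p : `|p - (x0, 0)| < r0 -> Phi 0 p = p by move=> /fl[].
have cPhi t p : `|t| < T0 -> `|p - (x0, 0)| < r0 ->
    {for (t, p), continuous (fun q : R * (E * E) => Phi q.1 q.2)}.
  by move=> tT pr; apply: (Ck_continuous CPhi).
have [del del0 hdel] : exists2 del, 0 < del & forall t p, `|t| < del ->
    `|p - (x0, 0)| < del -> `|Phi t p - (x0, 0)| < rho.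
  have n0 : `|0 : R| < T0 by rewrite normr0.
  have /for_continuousP/(_ _ rho0)[del del0 h] := cPhi 0 (x0, 0) n0 norm0.
  exists del => // t p tdel pdel; have := h (t, p); rewrite /= Phi0 //; apply.
  by rewrite prod_norm_lt /= subr0 tdel.
(* The bounds ensure, in this order, that [Phi] is defined, that it stays in the ball of the Taylor
   estimate, and that the short Gronwall inequality applies. *)
pose r := Num.min r0 del; pose T := Num.min (Num.min T0 del) (2 * K * L)^-1.
have r_gt0 : 0 < r by rewrite lt_min r00.
have T_gt0 : 0 < T by rewrite !lt_min T00 del0 invr_gt0 !mulr_gt0.
have KLT : K * L * T <= 2^-1.
  apply: le_trans (_ : K * L * (2 * K * L)^-1 <= _).
    by rewrite ler_pM2l ?mulr_gt0 // ge_min lexx orbT.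
  by rewrite [leLHS](_ : _ = 2^-1) //; field; rewrite !gt_eqF.
have pin (x v : E) (s : R) : `|x - x0| < s -> `|v| < s -> `|(x, v) - (x0, 0)| < s.
  by move=> xs vs; rewrite prod_norm_lt /= subr0 xs.
have rr0 s : s < r -> s < r0 by rewrite lt_min => /andP[].
have rdel s : s < r -> s < del by rewrite lt_min => /andP[].
have TT0 s : s < T -> s < T0 by rewrite !lt_min => /andP[/andP[]].
have Tdel s : s < T -> s < del by rewrite !lt_min => /andP[/andP[]].
have zr : `|0 : E| < r by rewrite normr0.
have flow x v t : `|x - x0| < r -> `|v| < r -> `|t| < T ->
    [/\ `|(Phi t (x, v)).1 - x0| < rho, U (Phi t (x, v)).1,
        is_derive t (1 : R) (fun s => (Phi s (x, v)).1) (f (Phi t (x, v)).1) &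
        is_derive t (1 : R) (fun s => (Phi s (x, v)).2)
          ('D_((Phi t (x, v)).2) f (Phi t (x, v)).1)].
  move=> xr vr tT.
  have [_ /(_ t (TT0 _ tT))[[UP _] dP]] := fl _ (pin _ _ _ (rr0 _ xr) (rr0 _ vr)).
  split => //; [|exact: is_derive_fst dP|exact: is_derive_snd dP].
  have := hdel t _ (Tdel _ tT) (pin _ _ _ (rdel _ xr) (rdel _ vr)).
  by rewrite prod_norm_lt => /andP[].
pose phi t x := (Phi t (x, 0)).1.
have phi0 x : `|x - x0| < r -> phi 0 x = x.
  by move=> xr; rewrite /phi Phi0 //; apply: pin; exact: rr0.
have flphi x : `|x - x0| < r -> forall t, `|t| < T -> `|phi t x - x0| < rho /\
    is_derive t (1 : R) (phi^~ x) (f (phi t x)).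
  by move=> xr t tT; have [] := flow x 0 t xr zr tT.
(* The first component solves [x' = f x] whatever [v] is, so uniqueness applies. *)
have fstE x v t : `|x - x0| < r -> `|v| < r -> `|t| < T -> (Phi t (x, v)).1 = phi t x.
  move=> xr vr tT; apply/eqP; rewrite -subr_eq0 -normr_le0.
  have := @solution_dist R E [set x | `|x - x0| < rho] f K L T
    (fun t => (Phi t (x, v)).1) (phi^~ x) mvc (ltW L0) KLT lip _ (flphi x xr) t tT.
  rewrite phi0 // Phi0; last by apply: pin; exact: rr0.
  rewrite subrr normr0 mulr0; apply => s sT.
  by have [] := flow x v s xr vr sT.
have phi_lip x y t : `|x - x0| < r -> `|y - x0| < r -> `|t| < T ->
    `|phi t y - phi t x| <= 2 * `|y - x|.
  move=> xr yr tT.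
  have := @solution_dist R E [set x | `|x - x0| < rho] f K L T (phi^~ y) (phi^~ x)
    mvc (ltW L0) KLT lip (flphi y yr) (flphi x xr) t tT.
  by rewrite !phi0.
pose lam := r / (2 * N).
have lam0 : 0 < lam by rewrite divr_gt0 // mulr_gt0.
have lame i : `|lam *: e i| < r.
  rewrite normrZ (gtr0_norm lam0); apply: le_lt_trans (_ : _ <= lam * N) _.
    rewrite ler_pM2l //; apply: le_trans hN.
    by rewrite (bigD1 i) //= lerDl sumr_ge0.
  rewrite /lam [ltLHS](_ : _ = r / 2); last by field; rewrite gt_eqF.
  by rewrite ltr_pdivrMr // ltr_pMr // ltr1n.
(* The candidate for the derivative of [phi t] at [x], linear in [h] by
   construction; [lam] brings the basis vectors into the domain of [Phi]. *)
pose Psi t x h := \sum_i (c i h * lam^-1) *: (Phi t (x, lam *: e i)).2.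
have Psi0 x h : `|x - x0| < r -> Psi 0 x h = h.
  move=> xr; rewrite [RHS]ce /Psi; apply: eq_bigr => i _.
  rewrite Phi0; last by apply: pin; [exact: rr0|exact: rr0].
  by rewrite /= scalerA mulfVK // gt_eqF.
have dfphi x t : `|x - x0| < r -> `|t| < T -> differentiable f (phi t x).
  by move=> xr tT; have [_ Up _ _] := flow x 0 t xr zr tT; exact: Cf.1.
have dPsi x h t : `|x - x0| < r -> `|t| < T ->
    is_derive t (1 : R) (fun s => Psi s x h) ('D_(Psi t x h) f (phi t x)).
  move=> xr tT.
  have -> : 'D_(Psi t x h) f (phi t x) =
      \sum_i (c i h * lam^-1) *: 'D_((Phi t (x, lam *: e i)).2) f (phi t x).
    rewrite deriveE; last exact: dfphi.
    rewrite /Psi linear_sum; apply: eq_bigr => i _.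
    by rewrite linearZ deriveE //; exact: dfphi.
  apply: is_derive_lincomb => i.
  by have [_ _ _] := flow x _ t xr (lame i) tT; rewrite fstE.
(* The error [phi t y - phi t x - Psi t x (y - x)] starts at 0 and solves the linearised equation up
   to the Taylor remainder. Since [phi t] is 2-Lipschitz the remainder is at most
   [4 * C * |y - x|^2], and [Q] is what Gronwall makes of this. *)
pose Q := 2 * (K * (4 * C) * T).
have Q0 : 0 <= Q by rewrite !mulr_ge0 // ltW.
have est x y t : `|x - x0| < r -> `|y - x0| < r -> `|t| < T ->
    `|phi t y - phi t x - Psi t x (y - x)| <= Q * `|y - x| ^+ 2.
  move=> xr yr tT.
  have eta0 : 0 <= 4 * C * `|y - x| ^+ 2 by rewrite !mulr_ge0 // ltW.
  have := @short_gronwall R E K L (4 * C * `|y - x| ^+ 2) T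
    (fun t => phi t y - phi t x - Psi t x (y - x))
    (fun t => f (phi t y) - f (phi t x) - 'D_(Psi t x (y - x)) f (phi t x))
    mvc (ltW L0) eta0 KLT.
  rewrite !phi0 // Psi0 // subrr normr0 add0r => h.
  apply: le_trans (h _ t tT) _; last first.
    by rewrite /Q [leLHS](_ : _ = 2 * (K * (4 * C) * T) * `|y - x| ^+ 2) //; ring.
  move=> s sT; have [hx dx] := flphi x xr s sT; have [hy dy] := flphi y yr s sT.
  split; first by apply: is_deriveB; exact: dPsi.
  have DB a b : 'D_(a - b) f (phi s x) = 'D_a f (phi s x) - 'D_b f (phi s x).
    by have dd := dfphi x s xr sT; rewrite !deriveE // linearB.
  set w := Psi s x (y - x); set a := phi s y - phi s x.
  have -> : f (phi s y) - f (phi s x) - 'D_w f (phi s x) =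
     (f (phi s y) - f (phi s x) - 'D_a f (phi s x)) + 'D_(a - w) f (phi s x).
    by rewrite (DB a w) addrA subrK.
  apply: le_trans (ler_normD _ _) _; rewrite addrC; apply: lerD; first exact: Df.
  apply: le_trans (tay _ _ hx hy) _; rewrite [4 * C]mulrC -mulrA ler_pM2l //.
  have -> : 4 * `|y - x| ^+ 2 = (2 * `|y - x|) ^+ 2 by ring.
  by rewrite ler_pXn2r ?nnegrE ?mulr_ge0 //; exact: phi_lip.
have dphi p : box x0 T r p -> differentiable (fun p : R * E => phi p.1 p.2) p /\
    forall v, 'D_v (fun p : R * E => phi p.1 p.2) p =
      v.1 *: f (phi p.1 p.2) + Psi p.1 p.2 v.2.
  case: p => t x [/= tT xr].
  pose D (v : R * E) := v.1 *: f (phi t x) + Psi t x v.2.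
  have lD : linear D.
    move=> a [s v] [s' v']; rewrite /D /= scalerDr scalerA scalerDl -!addrA; congr (_ + _).
    rewrite addrCA; congr (_ + _); rewrite /Psi scaler_sumr -big_split /=.
    apply: eq_bigr => i _.
    by rewrite linearP /= scalerA -scalerDl mulrDl mulrA.
  pose LD : {linear (R * E)%type -> E} := HB.pack D (GRing.isLinear.Build _ _ _ _ _ lD).
  apply: (@differentiable_eps _ _ _ _ LD); first exact: findim_linear_continuous.
  move=> eps eps0.
  have eps1 : 0 < eps / (2 * K * L) by rewrite divr_gt0 // !mulr_gt0.
  have := cPhi t (x, 0) (TT0 _ tT) (pin _ _ _ (rr0 _ xr) (rr0 _ zr)).
  move=> /for_continuousP/(_ _ eps1)[d1 d10 hd1].
  pose d := Num.min (Num.min d1 (eps / (2 * (Q + 1)))) (Num.min (T - `|t|) (r - `|x - x0|)).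
  have Q1 : 0 < Q + 1 by rewrite ltr_wpDl.
  exists d.
    by rewrite !lt_min d10 divr_gt0 ?mulr_gt0 //= !subr_gt0 tT xr.
  move=> [s h]; rewrite prod_norm_lt /= => /andP[]; rewrite !lt_min.
  move=> /andP[/andP[s1 s2] /andP[s3 s4]] /andP[/andP[h1 h2] /andP[h3 h4]].
  have yr : `|h + x - x0| < r by apply: (@norm_lt_add _ _ _ x); rewrite addrK.
  have near_t q : between t (s + t) q -> `|q - t| <= `|s|.
    by move=> /between_dist; rewrite addrK.
  have qT q : between t (s + t) q -> `|q| < T.
    move=> /near_t qs; rewrite -[q]subr0; apply: (@norm_lt_add _ _ _ t).
    by rewrite subr0; exact: le_lt_trans s3.
  (* The increment is split into a time step from the displaced point [h + x], treated here by the
     mean value inequality and the continuity of [Phi], and a displacement at fixed time, treated by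
     [est]. Each contributes half of [eps]. *)
  have A1 : `|phi (s + t) (h + x) - (s + t) *: f (phi t x) - (phi t (h + x) - t *: f (phi t x))|
      <= K * (eps / (2 * K)) * `|s|.
    have -> : `|s| = `|s + t - t| by rewrite addrK.
    apply: (mv (fun q => phi q (h + x) - q *: f (phi t x))
      (fun q => f (phi q (h + x)) - f (phi t x))) => q hq.
    have [hq1 hq2] := flphi _ yr q (qT q hq); split.
      apply: is_deriveB.
      have dz : differentiable (fun q : R => q *: f (phi t x)) q by exact: ex_diff.
      apply: DeriveDef; first exact/derivable1_diffP.
      by rewrite deriveE // diff_val scale1r.
    have [hx _] := flphi _ xr t tT.
    apply: le_trans (lip _ _ hx hq1) _.
    have -> : eps / (2 * K) = L * (eps / (2 * K * L)) by field; rewrite !gt_eqF.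
    rewrite ler_pM2l // ltW //.
    have := hd1 (q, (h + x, 0)).
    rewrite prod_norm_lt /= prod_norm_lt /= subrr normr0 d10 andbT addrK h1 andbT => hh.
    have := hh (le_lt_trans (near_t q hq) s1).
    by rewrite prod_norm_lt => /andP[].
  have A2 := est x (h + x) t xr yr tT; rewrite addrK in A2.
  have A3 : Q * `|h| ^+ 2 <= eps / 2 * `|h|.
    rewrite expr2 mulrA ler_wpM2r //.
    apply: le_trans (_ : (Q + 1) * `|h| <= _); first by rewrite ler_wpM2r // lerDl.
    rewrite mulrC -ler_pdivlMr //; apply: ltW; apply: lt_le_trans h2 _.
    by rewrite [leLHS](_ : _ = eps / 2 / (Q + 1)) //; field; rewrite gt_eqF.
  have -> : phi (s + t) (h + x) - phi t x - LD (s, h) =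
      (phi (s + t) (h + x) - (s + t) *: f (phi t x) - (phi t (h + x) - t *: f (phi t x)))
      + (phi t (h + x) - phi t x - Psi t x h).
    rewrite /LD /= /D /= scalerDl.
    rewrite opprB [in RHS]opprD !addrA.
    set a := phi (s + t) _; set b := phi t (h + x); set g := phi t x.
    set fs := s *: _; set ft := t *: _; set ps := Psi _ _ _.
    rewrite -[a - fs - ft + ft - b + b]addrA addrA.
    by rewrite !subrK opprD addrA [a - fs - g]addrAC.
  apply: le_trans (ler_normD _ _) _; rewrite prod_normE /=.
  have -> : eps = K * (eps / (2 * K)) + eps / 2 by field; rewrite gt_eqF.
  rewrite mulrDl; apply: lerD.
    apply: le_trans A1 _; rewrite ler_wpM2l ?le_max ?lexx //.
    by rewrite mulr_ge0 ?divr_ge0 ?mulr_ge0 // ltW.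
  apply: le_trans A2 _; apply: le_trans A3 _; rewrite ler_wpM2l ?le_max ?lexx ?orbT //.
  by rewrite divr_ge0 // ltW.
have CPhiv v : `|v| < r -> Ck k (box x0 T r) (fun p : R * E => Phi p.1 (p.2, v)).
  move=> vr; have := @Ck_comp R _ _ _ k (box x0 T r) (box (x0, 0 : E) T0 r0)
    (fun p : R * E => (p.1, (p.2, v))) (fun q : R * (E * E) => Phi q.1 q.2).
  apply => //; try exact: open_box.
  - move=> [t x] [/= tT xr]; split => /=; first exact: TT0.
    by apply: pin; exact: rr0.
  - apply: Ck_pair; [exact: open_box|exact: Ck_fst|].
    by apply: Ck_pair; [exact: open_box|exact: Ck_snd|exact: Ck_cst].
have Cphi : Ck k (box x0 T r) (fun p : R * E => phi p.1 p.2).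
  apply: (@Ck_comp R _ _ _ k (box x0 T r) setT (fun p : R * E => Phi p.1 (p.2, 0)) fst) => //.
  - exact: open_box.
  - exact: openT.
  - exact: CPhiv.
  - exact: Ck_fst.
exists T, r, phi; split => //.
  move=> x xr; split; first exact: phi0.
  by move=> t tT; have [] := flow x 0 t xr zr tT.
apply/CkS; split; first by move=> p /dphi[].
(* For a fixed direction [v] the derivative involves only [f], [phi] and finitely many values of
   [Phi], all of class $C^k$. *)
move=> v; apply: (@Ck_ext _ _ _ _ _ (fun p : R * E => v.1 *: f (phi p.1 p.2)
   + \sum_i (c i v.2 * lam^-1) *: (Phi p.1 (p.2, lam *: e i)).2)).
- exact: open_box.
- by move=> p; rewrite inE => /dphi[_ ->].
apply: Ck_add; first exact: open_box.
  apply: Ck_scale; [exact: open_box|exact: Ck_cst|].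
  apply: (@Ck_comp R _ _ _ k (box x0 T r) U (fun p : R * E => phi p.1 p.2) f) => //.
  - exact: open_box.
  - by move=> [t x] [/= tT xr]; have [] := flow x 0 t xr zr tT.
  - by apply: Ck_le Cf; rewrite (leqW (leqW (leqnSn k))).
apply: Ck_sum; first exact: open_box.
move=> i; apply: Ck_scale; [exact: open_box|exact: Ck_cst|].
apply: (@Ck_comp R _ _ _ k (box x0 T r) setT
  (fun p : R * E => Phi p.1 (p.2, lam *: e i)) snd) => //.
- exact: open_box.
- exact: openT.
- exact: CPhiv.
- exact: Ck_snd.
Qed.

End SmoothDependence.

(** * Germs and charted spaces *)

Section Germs.
Context {R : realType}.
Implicit Types E F H : normedModType R.

(** Being $C^k$ as a property of the germ at [x]: domains no longer have to be matched when maps are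
    composed or read in other charts. *)
Definition Ckn E F (k : nat) (f : E -> F) (x : E) : Prop :=
  exists W : set E, [/\ open W, W x & Ck k W f].

Lemma Ckn_pt E F k (f : E -> F) x : Ckn k f x -> Ck k [set x] f.
Proof. by move=> [W [_ Wx /Ck_sub]]; apply; move=> _ ->. Qed.

Lemma Ckn_continuous E F k (f : E -> F) x : Ckn k f x -> {for x, continuous f}.
Proof. by move=> [W [oW Wx CW]]; apply: Ck_continuous CW Wx. Qed.

Lemma Ckn_differentiable E F k (f : E -> F) x : Ckn k.+1 f x -> differentiable f x.
Proof. by move=> [W [oW Wx /CkS[dW _]]]; exact: dW. Qed.

Lemma near_Ckn E F k (f : E -> F) x :
  (\forall y \near x, Ck k [set y] f) -> Ckn k f x.
Proof.
move=> h; exists (interior [set y | Ck k [set y] f]); split => //.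
  exact: open_interior.
by apply: Ck_pointwise => y /interior_subset.
Qed.

Lemma Ckn_ext E F k (f g : E -> F) x :
  (\forall y \near x, f y = g y) -> Ckn k f x -> Ckn k g x.
Proof.
move=> fg [W [oW Wx CW]]; exists (W `&` interior [set y | f y = g y]).
have oV : open (W `&` interior [set y | f y = g y]).
  by apply: openI => //; exact: open_interior.
split => //; apply: (@Ck_ext _ _ _ _ _ f) => //.
  by move=> y; rewrite inE => -[_ /interior_subset].
by apply: Ck_sub CW => y [].
Qed.

Lemma Ckn_comp E F H k (f : E -> F) (g : F -> H) x : findim F ->
  Ckn k f x -> Ckn k g (f x) -> Ckn k (g \o f) x.
Proof.
move=> fF Cf [V [oV Vx CV]]; have cf := Ckn_continuous Cf.
have [W [oW Wx CW]] := Cf.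
exists (W `&` interior (f @^-1` V)).
have oV' : open (W `&` interior (f @^-1` V)).
  by apply: openI => //; exact: open_interior.
split => //.
  by split => //; apply: cf; exact: open_nbhs_nbhs.
apply: (Ck_comp fF oV' oV) CV; first by move=> y [_ /interior_subset].
by apply: Ck_sub CW => y [].
Qed.

Lemma Ckn_pair E F H k (f : E -> F) (g : E -> H) x :
  Ckn k f x -> Ckn k g x -> Ckn k (fun y => (f y, g y)) x.
Proof.
move=> [W [oW Wx CW]] [V [oV Vx CV]]; exists (W `&` V); split => //.
  exact: openI.
apply: Ck_pair; first exact: openI.
  by apply: Ck_sub CW => y [].
by apply: Ck_sub CV => y [].
Qed.

Lemma Ckn_cst E F k (a : F) (x : E) : Ckn k (cst a) x.
Proof. by exists setT; split; [exact: openT| |exact: Ck_cst]. Qed.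

Lemma Ckn_id E k (x : E) : Ckn k idfun x.
Proof. by exists setT; split; [exact: openT| |exact: Ck_id]. Qed.

Lemma Ckn_fst E F k (x : E * F) : Ckn k fst x.
Proof. by exists setT; split; [exact: openT| |exact: Ck_fst]. Qed.

Lemma Ckn_snd E F k (x : E * F) : Ckn k snd x.
Proof. by exists setT; split; [exact: openT| |exact: Ck_snd]. Qed.

Lemma derive_near_id E (f : E -> E) x v :
  (\forall y \near x, f y = y) -> 'D_v f x = v.
Proof. by move=> h; rewrite (near_eq_derive v h) derive_id. Qed.

Lemma derive_partial E F H (f : E * F -> H) (x v : E) (y w : F) :
  differentiable f (x, y) ->
  'D_(v, w) f (x, y) = 'D_v (fun z => f (z, y)) x + 'D_w (fun z => f (x, z)) y.
Proof.
move=> df.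
have h1 : 'D_v (fun z => f (z, y)) x = 'D_(v, 0) f (x, y).
  rewrite -[LHS]/('D_v (f \o (fun z => (z, y))) x) derive_comp //.
  by rewrite derive_pair // derive_id derive_cst.
have h2 : 'D_w (fun z => f (x, z)) y = 'D_(0, w) f (x, y).
  rewrite -[LHS]/('D_w (f \o (fun z => (x, z))) y) derive_comp //.
  by rewrite derive_pair // derive_id derive_cst.
rewrite h1 h2 !deriveE // -linearD; congr ('d f _ _).
by rewrite -[RHS]/(v + 0, 0 + w) addr0 add0r.
Qed.

Lemma is_derive_pair E F (u : R -> E) (w : R -> F) t du dw :
  is_derive t (1 : R) u du -> is_derive t (1 : R) w dw ->
  is_derive t (1 : R) (fun s => (u s, w s)) (du, dw).
Proof.
move=> hu hw.
have /derivable1_diffP cu := @ex_derive _ _ _ _ _ _ _ hu.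
have /derivable1_diffP cw := @ex_derive _ _ _ _ _ _ _ hw.
apply: DeriveDef; first by apply/derivable1_diffP; exact: differentiable_pair.
rewrite derive_pair //.
by rewrite (@derive_val _ _ _ _ _ _ _ hu) (@derive_val _ _ _ _ _ _ _ hw).
Qed.

Lemma is_derive_affine E (u : R -> E) (a b t : R) du :
  is_derive (a * t + b) (1 : R) u du ->
  is_derive t (1 : R) (fun s => u (a * s + b)) (a *: du).
Proof.
move=> hu; have /derivable1_diffP cu := @ex_derive _ _ _ _ _ _ _ hu.
have h : is_derive t (1 : R) (fun s : R => a * s + b) a.
  have := @is_deriveD _ _ _ (fun s : R => a *: s) (cst b) t 1 (a *: 1) 0
    (is_deriveZ _ (is_derive_id _ _)) (is_derive_cst _ _ _).
  by rewrite addr0 /GRing.scale /= mulr1.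
have -> : a *: du = 'D_a u (a * t + b).
  by rewrite deriveE // diff1E // derive1E (@derive_val _ _ _ _ _ _ _ hu).
exact: (is_derive_comp h cu).
Qed.

Lemma Ckn_derive E F k (f : E -> F) x v : findim E ->
  Ckn k.+1 f x -> Ckn k (fun p : E * E => 'D_(p.2) f p.1) (x, v).
Proof.
move=> fE [W [oW Wx CW]]; exists (W `*` setT); split => //; last exact: Ck_derive.
rewrite openE => -[y w] [/= Wy _]; exists (W, setT) => //=.
by split; [exact: open_nbhs_nbhs|exact: filterT].
Qed.

Lemma Ck_Ckn E F k (U : set E) (f : E -> F) x :
  open U -> U x -> Ck k U f -> Ckn k f x.
Proof. by move=> oU Ux CU; exists U. Qed.

Lemma prod_ball E F (a : E) (x x0 : F) (r : R) :
  `|x - x0| < r -> `|(a, x) - (a, x0)| < r.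
Proof.
by move=> h; rewrite prod_norm_lt /= subrr normr0 h andbT; apply: le_lt_trans h.
Qed.

End Germs.

(** * Maps of class $C^k$ between charted spaces and velocities of curves in charts *)

Section ChartedSpaces.
Context {R : realType}.

(** The analytic part of [manifold], stated so as to cover also model spaces and products, which are
    not modelled on row vectors. *)
Definition compatible {E : normedModType R} (M : charted_space E) : Prop :=
  findim E /\ forall a b : chart M E, atlas a -> atlas b ->
    Cinfty (cmap a @` (cdom a `&` cdom b)) (cmap b \o cinv a).

Lemma near_cinv (T : topologicalType) (E : normedModType R) (a : chart T E) x
    (P : set T) : cdom a x -> (\forall y \near x, P y) ->
  \forall z \near cmap a x,
    [/\ cdom a (cinv a z), cmap a (cinv a z) = z & P (cinv a z)].
Proof.
move=> ax Px.
have ix : (cmap a @` cdom a) (cmap a x) by exists x.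
have h1 : \forall z \near cmap a x, (cmap a @` cdom a) z.
  exact: open_nbhs_nbhs (conj (open_cimg a) ix).
have h2 : \forall z \near cmap a x, P (cinv a z).
  by apply: (continuous_cinv ix); rewrite cmapK.
by apply: filterS2 h1 h2 => z [y ay <-] Py; rewrite cmapK in Py *.
Qed.

Lemma near_cdom (T : topologicalType) (E : normedModType R) (a : chart T E) x :
  cdom a x -> \forall y \near x, cdom a y.
Proof. by move=> ax; exact: open_nbhs_nbhs (conj (open_cdom a) ax). Qed.

Lemma cimgK (T : topologicalType) (E : normedModType R) (a : chart T E) z :
  (cmap a @` cdom a) z -> cdom a (cinv a z) /\ cmap a (cinv a z) = z.
Proof. by move=> [y ay <-]; rewrite cmapK. Qed.

(* [f] is continuous at [p] and [C^k] near [p] in all charts; the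
   neighbourhood may depend on [k], so that requiring this for all [k] at a
   single point is weaker than [smooth_at]; over an open set the two agree (see
   [ck_smooth_on]). *)
Definition ck_at {E F : normedModType R} (M : charted_space E)
    (N : charted_space F) (k : nat) (f : M -> N) (p : M) : Prop :=
  {for p, continuous f} /\
  forall (a : chart M E) (b : chart N F), atlas a -> atlas b ->
    cdom a p -> cdom b (f p) -> Ckn k (cmap b \o f \o cinv a) (cmap a p).

Arguments ck_at {E F} M N k f p.

(** Read in two charts the identity is a transition map, so this is compatibility of the atlas at a
    point; changes of chart are derived from it. *)
Lemma ck_at_id {E : normedModType R} (M : charted_space E) k p :
  compatible M -> ck_at M M k idfun p.
Proof.
move=> [fE cM]; split; first exact: cvg_id.
move=> a b aa ab ap bp; apply: near_Ckn.
have hb := near_cinv ap (near_cdom bp).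
apply: filterS hb => z [az zE bz].
apply: Ck_sub (cM a b aa ab k) => _ ->; exists (cinv a z) => //.
Qed.

Lemma ck_at_comp {E F H : normedModType R} (M : charted_space E)
    (N : charted_space F) (P : charted_space H) k (f : M -> N) (g : N -> P) p :
  findim F -> ck_at M N k f p -> ck_at N P k g (f p) -> ck_at M P k (g \o f) p.
Proof.
move=> fF [cf Cf] [cg Cg]; split; first exact: continuous_comp.
move=> a c aa ac ap cp; pose b := chart_at (f p).
have ab : atlas b := chart_at_atlas _; have bfp : cdom b (f p) := chart_at_dom _.
apply: (@Ckn_ext _ _ _ _ ((cmap c \o g \o cinv b) \o (cmap b \o f \o cinv a))).
  have : \forall q \near p, cdom b (f q) by apply: cf; exact: near_cdom.
  move=> /(near_cinv ap); apply: filterS => z [az zE bz].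
  by rewrite /= cmapK.
apply: Ckn_comp => //; first exact: Cf.
by rewrite /= cmapK //; exact: Cg.
Qed.

Lemma ck_at_cst {E F : normedModType R} (M : charted_space E)
    (N : charted_space F) k (n0 : N) p : ck_at M N k (cst n0) p.
Proof.
split; first exact: cst_continuous.
by move=> a b _ _ _ _; exact: (@Ckn_cst R E F k (cmap b n0) _).
Qed.

Lemma ck_at_pair {E F H : normedModType R} (M : charted_space E)
    (N : charted_space F) (P : charted_space H) k (f : M -> N) (g : M -> P) p :
  ck_at M N k f p -> ck_at M P k g p ->
  ck_at M (prod_space N P) k (fun q => (f q, g q)) p.
Proof.
move=> [cf Cf] [cg Cg]; split; first exact: cvg_pair.
move=> a _ aa [b [c [ab ac ->]]] ap [/= bp cp].
by apply: Ckn_pair; [exact: Cf|exact: Cg].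
Qed.

Lemma ck_at_fst {E F : normedModType R} (M : charted_space E)
    (N : charted_space F) k (p : prod_space M N) :
  compatible M -> ck_at (prod_space M N) M k fst p.
Proof.
move=> cM; split; first exact: cvg_fst.
move=> _ c [a [b [aa ab ->]]] ac [ap bp] cp.
apply: (@Ckn_comp _ _ _ _ _ fst (cmap c \o idfun \o cinv a)); first exact: cM.1.
  exact: Ckn_fst.
by have [_] := ck_at_id k p.1 cM; apply.
Qed.

Lemma ck_at_snd {E F : normedModType R} (M : charted_space E)
    (N : charted_space F) k (p : prod_space M N) :
  compatible N -> ck_at (prod_space M N) N k snd p.
Proof.
move=> cN; split; first exact: cvg_snd.
move=> _ c [a [b [aa ab ->]]] ac [ap bp] cp.
apply: (@Ckn_comp _ _ _ _ _ snd (cmap c \o idfun \o cinv b)); first exact: cN.1.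
  exact: Ckn_snd.
by have [_] := ck_at_id k p.2 cN; apply.
Qed.

Lemma compatible_model (E : normedModType R) : findim E -> compatible (model_space E).
Proof. by move=> fE; split => // a b -> -> k; exact: Ck_id. Qed.

Lemma compatible_manifold n (M : manifold R n) : compatible M.
Proof. by split; [exact: findim_rV|exact: atlas_compatible]. Qed.

Lemma compatible_prod {E F : normedModType R} (M : charted_space E)
    (N : charted_space F) : compatible M -> compatible N ->
  compatible (prod_space M N).
Proof.
move=> cM cN; split; first by apply: findim_prod; [exact: cM.1|exact: cN.1].
move=> _ _ [a [b [aa ab ->]]] [a' [b' [aa' ab' ->]]] k.
apply: Ck_pointwise => _ [[x y] [[ax b_y] [ax' b_y']] <-].
apply: Ckn_pt; apply: Ckn_pair.
  apply: (@Ckn_comp _ _ _ _ _ fst (cmap a' \o idfun \o cinv a)); first exact: cM.1.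
    exact: Ckn_fst.
  by have [_] := ck_at_id k x cM; apply.
apply: (@Ckn_comp _ _ _ _ _ snd (cmap b' \o idfun \o cinv b)); first exact: cN.1.
  exact: Ckn_snd.
by have [_] := ck_at_id k y cN; apply.
Qed.

Lemma ck_at_model (E F : normedModType R) k (f : E -> F) x :
  Ckn k f x -> ck_at (model_space E) (model_space F) k f x.
Proof.
move=> Cf; split; first exact: Ckn_continuous Cf.
by move=> a b -> -> _ _.
Qed.

Lemma ck_at_model_pair {E F H : normedModType R} (M : charted_space E) k
    (f : M -> F) (g : M -> H) p :
  ck_at M (model_space F) k f p -> ck_at M (model_space H) k g p ->
  ck_at M (model_space (F * H)%type) k (fun q => (f q, g q)) p.
Proof.
move=> [cf Cf] [cg Cg]; split; first exact: cvg_pair.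
move=> a b aa -> ap _.
by apply: Ckn_pair; [exact: (Cf a (id_chart F))|exact: (Cg a (id_chart H))].
Qed.

Lemma ck_at_cmap {E : normedModType R} (M : charted_space E) k (a : chart M E) p :
  compatible M -> atlas a -> cdom a p -> ck_at M (model_space E) k (cmap a) p.
Proof.
move=> cM aa ap; split; first exact: continuous_cmap.
move=> b c ab -> bp _; have [_ h] := ck_at_id k p cM.
exact: (h b a).
Qed.

Lemma ck_at_cinv {E : normedModType R} (M : charted_space E) k (a : chart M E) y :
  compatible M -> atlas a -> (cmap a @` cdom a) y ->
  ck_at (model_space E) M k (cinv a) y.
Proof.
move=> cM aa ay; split; first exact: continuous_cinv.
move=> b c -> ac _ cy /=; have [_ h] := ck_at_id k (cinv a y) cM.
have [ay' yE] := cimgK ay.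
by have := h a c aa ac ay' cy; rewrite yE.
Qed.

Lemma ck_at_ext {E F : normedModType R} (M : charted_space E)
    (N : charted_space F) k (f g : M -> N) p :
  (\forall q \near p, f q = g q) -> ck_at M N k f p -> ck_at M N k g p.
Proof.
move=> fg [cf Cf]; have fgp : f p = g p := nbhs_singleton fg; split.
  move: cf; rewrite /prop_for /continuous_at fgp => cf; apply: cvg_trans cf.
  by apply: near_eq_cvg; apply: filterS fg.
move=> a b aa ab ap bp; rewrite -fgp in bp; apply: Ckn_ext (Cf a b aa ab ap bp).
by move: (near_cinv ap fg); apply: filterS => z [_ _ /= ->].
Qed.

(** [smooth_at] offers one pair of charts, [ck_at] asks for all. Near [p] the map factors as a
    chart, its local expression and an inverse chart, and each factor is $C^k$ in every pair of
    charts. *)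
Lemma smooth_at_ck {E F : normedModType R} (M : charted_space E)
    (N : charted_space F) (f : M -> N) p k : compatible M -> compatible N ->
  smooth_at M N f p -> ck_at M N k f p.
Proof.
move=> cM cN [a [b [U [aa ab [oU Up Ua Ub Cf]]]]].
have ap : cdom a p by exact: Ua.
have bp : cdom b (f p) by apply: Ub; exists p.
have nU : \forall q \near p, U q by exact: open_nbhs_nbhs.
have Cr : Ckn k (cmap b \o f \o cinv a) (cmap a p).
  apply: near_Ckn; apply: filterS (near_cinv ap nU) => z [az zE Uz].
  by apply: Ck_sub (Cf k) => _ ->; exists (cinv a z).
have h1 : ck_at M (model_space E) k (cmap a) p by exact: ck_at_cmap.
have h2 : ck_at (model_space E) (model_space F) k (cmap b \o f \o cinv a) (cmap a p).
  exact: ck_at_model.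
have h3 : ck_at (model_space F) N k (cinv b) ((cmap b \o f \o cinv a) (cmap a p)).
  by apply: ck_at_cinv => //=; rewrite cmapK //; exists (f p).
have h := ck_at_comp cN.1 (ck_at_comp cM.1 h1 (h2 : ck_at _ (model_space F) k _ _)) h3.
apply: (ck_at_ext _ h).
apply: filterS nU => q Uq /=; rewrite (cmapK (Ua _ Uq)) cmapK //.
by apply: Ub; exists q.
Qed.

(** The neighbourhood required by [smooth_at] must not depend on [k]. It is chosen from the charts,
    continuity and [D] alone; on it the order [k] is verified one point at a time. *)
Lemma ck_smooth_on {E F : normedModType R} (M : charted_space E)
    (N : charted_space F) (f : M -> N) (D : set M) : open D ->
  (forall q, D q -> forall k, ck_at M N k f q) -> smooth_on M N D f.
Proof.
move=> oD Cf p Dp; pose a := chart_at p; pose b := chart_at (f p).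
have aa : atlas a := chart_at_atlas _; have ap : cdom a p := chart_at_dom _.
have ab : atlas b := chart_at_atlas _; have bp : cdom b (f p) := chart_at_dom _.
exists a, b, (D `&` (cdom a `&` interior (f @^-1` cdom b))); split => //.
split => //.
- by apply: openI => //; apply: openI; [exact: open_cdom|exact: open_interior].
- by split => //; split => //; apply: (Cf p Dp 0%N).1; exact: near_cdom.
- by move=> q [_ []].
- by move=> _ [q [Dq [_ /interior_subset bq]] <-].
move=> k; apply: Ck_pointwise => _ [q [Dq [aq /interior_subset bq]] <-].
by apply: Ckn_pt; apply: (Cf q Dq k).2.
Qed.

(** [velocity] uses the chart chosen at the current point, which changes along the curve. Here the
    chart is arbitrary, and differentiability is part of the relation. *)
Definition cvel {E : normedModType R} {M : charted_space E} (a : chart M E)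
    (gamma : R -> M) (s : R) (v : E) : Prop :=
  [/\ cdom a (gamma s), {for s, continuous gamma}
    & is_derive s (1 : R) (cmap a \o gamma) v].

Lemma cvel_unique {E : normedModType R} {M : charted_space E} (a : chart M E)
    (gamma : R -> M) (s : R) (v w : E) : cvel a gamma s v -> cvel a gamma s w -> v = w.
Proof.
move=> [_ _ hv] [_ _ hw].
by rewrite -(@derive_val _ _ _ _ _ _ _ hv) -(@derive_val _ _ _ _ _ _ _ hw).
Qed.

Lemma cvel_ext {E : normedModType R} {M : charted_space E} (a : chart M E)
    (g h : R -> M) (s : R) (v : E) :
  (\forall t \near s, g t = h t) -> cvel a g s v -> cvel a h s v.
Proof.
move=> gh [ag cg dg]; have gs := nbhs_singleton gh; split; first by rewrite -gs.
  move: cg; rewrite /prop_for /continuous_at gs => cg; apply: cvg_trans cg.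
  by apply: near_eq_cvg; apply: filterS gh.
by apply: near_eq_is_derive dg; apply: filterS gh => t /= ->.
Qed.

Lemma cvel_chain {E F : normedModType R} {M : charted_space E}
    {N : charted_space F} (a : chart M E) (b : chart N F) (f : M -> N)
    (gamma : R -> M) (s : R) (v : E) : atlas a -> atlas b ->
  cvel a gamma s v -> ck_at M N 1 f (gamma s) -> cdom b (f (gamma s)) ->
  cvel b (f \o gamma) s ('D_v (cmap b \o f \o cinv a) (cmap a (gamma s))).
Proof.
move=> aa ab [ag cg dg] [cf Cf] bfg; split => //.
  exact: continuous_comp.
have := is_derive_comp dg (Ckn_differentiable (Cf a b aa ab ag bfg)).
apply: near_eq_is_derive.
have : \forall t \near s, cdom a (gamma t) by apply: cg; exact: near_cdom.
by apply: filterS => t at_ /=; rewrite cmapK.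
Qed.

Lemma cvel_pair {E F : normedModType R} {M : charted_space E}
    {N : charted_space F} (a : chart M E) (b : chart N F)
    (g : R -> M) (h : R -> N) (s : R) (v : E) (w : F) :
  cvel a g s v -> cvel b h s w ->
  @cvel _ (prod_space M N) (prod_chart a b) (fun t => (g t, h t)) s (v, w).
Proof.
move=> [ag cg dg] [bh ch dh]; split => //.
  exact: cvg_pair.
exact: is_derive_pair.
Qed.

Lemma cvel_chain2 {E F H : normedModType R} {M : charted_space E}
    {N : charted_space F} {P : charted_space H} (a : chart M E) (b : chart N F)
    (c : chart P H) (f : M -> N -> P) (g : R -> M) (h : R -> N) s v w :
  atlas a -> atlas b -> atlas c -> cvel a g s v -> cvel b h s w ->
  ck_at (prod_space M N) P 1 (fun q => f q.1 q.2) (g s, h s) ->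
  cdom c (f (g s) (h s)) ->
  cvel c (fun t => f (g t) (h t)) s
    ('D_v (cmap c \o f^~ (h s) \o cinv a) (cmap a (g s)) +
     'D_w (cmap c \o f (g s) \o cinv b) (cmap b (h s))).
Proof.
move=> aa ab ac vg vh Cf cgh; have [ag _ _] := vg; have [bh _ _] := vh.
have aab : @atlas R _ (prod_space M N) (prod_chart a b) by exists a, b.
have := cvel_chain aab ac (cvel_pair vg vh) Cf cgh.
rewrite /= derive_partial /=; last first.
  exact: (Ckn_differentiable (Cf.2 _ c aab ac (conj ag bh) cgh)).
by rewrite !cmapK.
Qed.

Lemma cvel_affine {E : normedModType R} {M : charted_space E} (c : chart M E)
    (g : R -> M) (a b s : R) (v : E) :
  cvel c g (a * s + b) v -> cvel c (fun t => g (a * t + b)) s (a *: v).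
Proof.
move=> [cg ctg dg]; split => //; last exact: (is_derive_affine dg).
apply: (@continuous_comp _ _ _ (fun t : R => a * t + b) g) => //.
apply: cvgD; last exact: cvg_cst.
by apply: cvgM; [exact: cvg_cst|exact: cvg_id].
Qed.

End ChartedSpaces.

Arguments ck_at {R E F} M N k f p.

(** * Integral curves and right-invariant equations on a Lie group *)

Section IntegralCurves.
Context {R : realType}.

(** If [P] is locally constant on [J], then [J] meets [P] in a set both open and closed in [J];
    intervals are connected. *)
Lemma interval_propagate (J P : set R) : is_interval J -> J 0 -> P 0 ->
  (forall s, J s -> \forall r \near s, J r -> (P r <-> P s)) ->
  forall s, J s -> P s.
Proof.
move=> /connected_intervalP cJ J0 P0 h.
have -> : J = J `&` P; last by move=> s [].
apply/esym; apply: cJ; first by exists 0.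
  exists (interior [set r | J r -> P r]); first exact: open_interior.
  apply/seteqP; split=> s [Js Hs]; split => //; last exact: (interior_subset Hs).
  by apply: filterS (h s Js) => r hr /hr[_]; exact.
exists (closure (J `&` P)); first exact: closed_closure.
apply/seteqP; split=> s [Js Hs]; split => //.
  by apply: subset_closure.
have [r [[Jr Pr] /(_ Jr)[+ _]]] := Hs _ (h s Js).
exact.
Qed.

Lemma ode_local_unique (E : normedModType R) (U : set E) (f : E -> E)
    (u v : R -> E) (s : R) : findim E -> open U -> Ck 1 U f -> U (u s) -> u s = v s ->
  (\forall t \near s, is_derive t (1 : R) u (f (u t)) /\ is_derive t (1 : R) v (f (v t))) ->
  \forall t \near s, u t = v t.
Proof.
move=> fE oU Cf Us uv hd.
have [du dv] := nbhs_singleton hd.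
have [r [L [r0 L0 _ _ lip]]] := local_lipschitz fE fE oU Us Cf.
have [K mvc] := findim_mean_value fE; have [K0 _] := mvc.
have cu := is_derive_continuous du; have cv := is_derive_continuous dv.
have nu : \forall t \near s, `|u t - u s| < r.
  apply: (cu [set x | `|x - u s| < r]); apply: near_norm_lt.
  by rewrite subrr normr0.
have nv : \forall t \near s, `|v t - u s| < r.
  apply: (cv [set x | `|x - u s| < r]); apply: near_norm_lt.
  by rewrite uv subrr normr0.
have /nbhs_ballP[del del0 hdel] : \forall t \near s, [/\
    is_derive t (1 : R) u (f (u t)), is_derive t (1 : R) v (f (v t)),
    `|u t - u s| < r & `|v t - u s| < r].
  by apply: filterS3 hd nu nv => t [].
pose T := Num.min del (2 * K * L)^-1.
have T0 : 0 < T by rewrite lt_min del0 invr_gt0 !mulr_gt0.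
have KLT : K * L * T <= 2^-1.
  apply: le_trans (_ : K * L * (2 * K * L)^-1 <= _).
    by rewrite ler_pM2l ?mulr_gt0 // ge_min lexx orbT.
  by rewrite [leLHS](_ : _ = 2^-1) //; field; rewrite !gt_eqF.
have hT q : `|q| < T -> [/\
    is_derive (1 * q + s) (1 : R) u (f (u (1 * q + s))),
    is_derive (1 * q + s) (1 : R) v (f (v (1 * q + s))),
    `|u (1 * q + s) - u s| < r & `|v (1 * q + s) - u s| < r].
  rewrite lt_min => /andP[qd _]; apply: hdel; rewrite -ball_normE /ball_ /=.
  by rewrite mul1r opprD addrCA subrr addr0 normrN.
apply/nbhs_ballP; exists T => // t; rewrite -ball_normE /ball_ /= distrC => ts.
apply/eqP; rewrite -subr_eq0 -normr_le0.
have := @solution_dist R E [set x | `|x - u s| < r] f K L T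
  (fun q => u (1 * q + s)) (fun q => v (1 * q + s)) mvc (ltW L0) KLT lip _ _ (t - s) ts.
rewrite !mul1r !add0r subrK uv subrr normr0 mulr0; apply.
  move=> q /hT[h1 _ h3 _]; split; first by move: h3; rewrite uv.
  by have := is_derive_affine h1; rewrite scale1r.
move=> q /hT[_ h2 _ h4]; split; first by move: h4; rewrite uv.
by have := is_derive_affine h2; rewrite scale1r.
Qed.

Context {E : normedModType R} {M : charted_space E}.

Lemma transition_near (a b : chart M E) p : cdom a p -> cdom b p ->
  \forall z \near cmap a p, [/\ cdom a (cinv a z), cmap a (cinv a z) = z
    & cdom b (cinv a z)].
Proof. by move=> ap bp; exact: near_cinv ap (near_cdom bp). Qed.

Lemma transition_differentiable (a b : chart M E) p : compatible M ->
  atlas a -> atlas b -> cdom a p -> cdom b p ->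
  differentiable (cmap b \o cinv a) (cmap a p).
Proof.
move=> cM aa ab ap bp; have [_ h] := ck_at_id 1 p cM.
exact: (Ckn_differentiable (h a b aa ab ap bp)).
Qed.

(** The cocycle rule for the differentials of the transition maps. *)
Lemma derive_transition (a b c : chart M E) p v : compatible M ->
  atlas a -> atlas b -> atlas c -> cdom a p -> cdom b p -> cdom c p ->
  'D_('D_v (cmap b \o cinv a) (cmap a p)) (cmap c \o cinv b) (cmap b p) =
  'D_v (cmap c \o cinv a) (cmap a p).
Proof.
move=> cM aa ab ac ap bp cp.
have h1 := transition_differentiable cM aa ab ap bp.
have h2 := transition_differentiable cM ab ac bp cp.
have -> : cmap b p = (cmap b \o cinv a) (cmap a p) by rewrite /= cmapK.
rewrite -derive_comp //; last by rewrite /= cmapK.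
apply: near_eq_derive; apply: filterS (transition_near ap bp) => z [az _ bz] /=.
by rewrite (cmapK bz).
Qed.

Lemma derive_chart_id (a : chart M E) p v : cdom a p ->
  'D_v (cmap a \o cinv a) (cmap a p) = v.
Proof.
move=> ap; apply: derive_near_id.
by apply: filterS (transition_near ap ap) => z [].
Qed.

Variable X : forall p : M, tangent p.

Lemma integral_curveP (J : set R) (gamma : R -> M) :
  integral_curve X J gamma <->
  forall t, J t -> cvel (chart_at (gamma t)) gamma t (X (gamma t)).
Proof.
split=> h t Jt.
  have [[cg dg] vg] := h t Jt; split => //; first exact: chart_at_dom.
  by apply: DeriveDef => //; rewrite -vg /velocity derive1E.
have [_ cg dg] := h t Jt; split; first by split => //; exact: (@ex_derive _ _ _ _ _ _ _ dg).
by rewrite /velocity derive1E (@derive_val _ _ _ _ _ _ _ dg).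
Qed.

Lemma cvel_chartP (a : chart M E) (gamma : R -> M) t : compatible M -> atlas a ->
  cdom a (gamma t) ->
  cvel (chart_at (gamma t)) gamma t (X (gamma t)) <->
  cvel a gamma t (tangent_coord a (X (gamma t))).
Proof.
move=> cM aa ap; have ac := chart_at_atlas (gamma t); have cp := chart_at_dom (gamma t).
split=> h; first exact: (cvel_chain ac aa h (ck_at_id 1 _ cM) ap).
have := cvel_chain aa ac h (ck_at_id 1 _ cM) cp.
rewrite /tangent_coord -[_ \o idfun]/(cmap (chart_at (gamma t))).
by rewrite derive_transition // derive_chart_id.
Qed.

(** Agreement propagates because it is open, by local uniqueness in a chart, and so is disagreement,
    by the Hausdorff property. *)
Lemma integral_curve_unique (J : set R) (g h : R -> M) :
  compatible M -> hausdorff_space M -> smooth_vector_field X ->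
  open J -> is_interval J -> J 0 ->
  integral_curve X J g -> integral_curve X J h -> g 0 = h 0 ->
  forall t, J t -> g t = h t.
Proof.
move=> cM hM sX oJ iJ J0 /integral_curveP ig /integral_curveP ih gh0.
apply: interval_propagate => // s Js.
have nJ : \forall r \near s, J r by exact: open_nbhs_nbhs.
have [_ cg _] := ig s Js; have [_ ch _] := ih s Js.
have [ghs|ghs] := pselect (g s = h s); last first.
  have gh : g s != h s by apply/eqP.
  have := hM; rewrite open_hausdorff => /(_ _ _ gh)[[A B] /= [gA hB] [oA oB AB0]].
  have nA : \forall r \near s, A (g r).
    by apply: cg; apply: open_nbhs_nbhs; split => //; rewrite inE in gA.
  have nB : \forall r \near s, B (h r).
    by apply: ch; apply: open_nbhs_nbhs; split => //; rewrite inE in hB.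
  apply: filterS2 nA nB => r Ar Br _; split => // grhr; exfalso.
  have : (A `&` B) (g r) by split => //; rewrite grhr.
  by move/eqP : AB0 => ->.
pose a := chart_at (g s); have aa : atlas a := chart_at_atlas _.
have ag : cdom a (g s) := chart_at_dom _.
have ah : cdom a (h s) by rewrite -ghs.
have nag : \forall r \near s, cdom a (g r) by apply: cg; exact: near_cdom.
have nah : \forall r \near s, cdom a (h r) by apply: ch; exact: near_cdom.
have := @ode_local_unique E (cmap a @` cdom a)
  (fun x => tangent_coord a (X (cinv a x))) (cmap a \o g) (cmap a \o h) s cM.1
  (open_cimg a) (sX a aa 1%N) _ _ _.
have H1 : (cmap a @` cdom a) ((cmap a \o g) s) by exists (g s).
have H2 : (cmap a \o g) s = (cmap a \o h) s by rewrite /= ghs.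
have H3 : \forall t \near s, is_derive t (1 : R) (cmap a \o g)
     (tangent_coord a (X (cinv a ((cmap a \o g) t)))) /\
     is_derive t (1 : R) (cmap a \o h) (tangent_coord a (X (cinv a ((cmap a \o h) t)))).
  apply: filterS3 nJ nag nah => t Jt agt aht; rewrite /= !cmapK //.
  have [_ _ d1] := (cvel_chartP cM aa agt).1 (ig t Jt).
  by have [_ _ d2] := (cvel_chartP cM aa aht).1 (ih t Jt).
move=> /(_ H1 H2 H3) => near_eq.
apply: filterS3 near_eq nag nah => t /= e agt aht _; split => // _.
by rewrite -(cmapK agt) e cmapK.
Qed.

End IntegralCurves.

(** * Right-invariant equations on a Lie group *)

Section LieGroups.
Context {R : realType} {d : nat} (G : lie_group R d).
Implicit Type g : G.

Lemma lmulVK (x y : G) : lmul (linv x) (lmul x y) = y.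
Proof. by rewrite lmulA lmulVg lmul1g. Qed.

Lemma lmulKV (x y : G) : lmul x (lmul (linv x) y) = y.
Proof. by rewrite lmulA lmulgV lmul1g. Qed.

Lemma lmulgK (x y : G) : lmul (lmul x y) (linv y) = x.
Proof. by rewrite -lmulA lmulgV lmulg1. Qed.

Lemma lmulgKV (x y : G) : lmul (lmul x (linv y)) y = x.
Proof. by rewrite -lmulA lmulVg lmulg1. Qed.

Lemma linv_unique (x y : G) : lmul x y = lone G -> linv x = y.
Proof. by move=> h; rewrite -[LHS]lmulg1 -h lmulVK. Qed.

Lemma linvM (x y : G) : linv (lmul x y) = lmul (linv y) (linv x).
Proof. by apply: linv_unique; rewrite lmulA lmulgK lmulgV. Qed.

Lemma linv1 : linv (lone G) = lone G.
Proof. by apply: linv_unique; rewrite lmul1g. Qed.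

Let cG : compatible G. Proof. exact: compatible_manifold. Qed.
Let cGG : compatible (prod_space G G). Proof. exact: compatible_prod. Qed.

Lemma ck_lmul {E : normedModType R} (M : charted_space E) k (f g : M -> G) p :
  ck_at M G k f p -> ck_at M G k g p ->
  ck_at M G k (fun q => lmul (f q) (g q)) p.
Proof.
move=> Cf Cg.
have Cm : ck_at (prod_space G G) G k (fun q => lmul q.1 q.2) (f p, g p).
  by apply: smooth_at_ck => //; exact: smooth_lmul.
exact: (ck_at_comp cGG.1 (ck_at_pair Cf Cg) Cm).
Qed.

Lemma ck_linv {E : normedModType R} (M : charted_space E) k (f : M -> G) p :
  ck_at M G k f p -> ck_at M G k (fun q => linv (f q)) p.
Proof.
move=> Cf; have Ci : ck_at G G k (@linv R d G) (f p).
  by apply: smooth_at_ck => //; exact: smooth_linv.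
exact: (ck_at_comp cG.1 Cf Ci).
Qed.

Lemma ck_lmulr k g x : ck_at G G k (fun h => lmul h g) x.
Proof. by apply: ck_lmul; [exact: ck_at_id|exact: ck_at_cst]. Qed.

Lemma ck_lmull k g x : ck_at G G k (lmul g) x.
Proof. by apply: (ck_lmul (f := cst g)); [exact: ck_at_cst|exact: ck_at_id]. Qed.

Definition chart1 : chart G 'rV[R]_d := chart_at (lone G).

Lemma atlas_chart1 : atlas chart1. Proof. exact: chart_at_atlas. Qed.
Lemma chart1_dom : cdom chart1 (lone G). Proof. exact: chart_at_dom. Qed.

(** The differential of multiplication at $(1, 1)$ is addition, since both partial maps there are
    the identity. *)
Lemma cvel_lmul1 (g h : R -> G) s v w : g s = lone G -> h s = lone G ->
  cvel chart1 g s v -> cvel chart1 h s w ->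
  cvel chart1 (fun t => lmul (g t) (h t)) s (v + w).
Proof.
move=> g1 h1 vg vh.
have Cm : ck_at (prod_space G G) G 1 (fun q => lmul q.1 q.2) (g s, h s).
  by apply: smooth_at_ck => //; exact: smooth_lmul.
have := cvel_chain2 atlas_chart1 atlas_chart1 atlas_chart1 vg vh Cm.
rewrite g1 h1 lmul1g => /(_ chart1_dom).
have -> : (@lmul R d G)^~ (lone G) = idfun by apply/funext => x; rewrite lmulg1.
have -> : lmul (lone G) = idfun by apply/funext => x; rewrite lmul1g.
by rewrite -[_ \o idfun]/(cmap chart1) !derive_chart_id //; exact: chart1_dom.
Qed.

(* [F' = dR_F u], expressed in the chart at the identity. *)
Definition driven (J : set R) (u : R -> 'rV[R]_d) (F : R -> G) : Prop :=
  forall s, J s -> cvel chart1 (fun t => lmul (F t) (linv (F s))) s (u s).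

Lemma driven_sub (J J' : set R) u F : J' `<=` J -> driven J u F -> driven J' u F.
Proof. by move=> JJ' h s /JJ'; exact: h. Qed.

(** The factor [g] cancels in $F(t) g (F(s) g)^{-1}$. *)
Lemma driven_mulr J u F g : driven J u F -> driven J u (fun t => lmul (F t) g).
Proof.
move=> h s Js; apply: cvel_ext (h s Js); near=> t.
by rewrite linvM -!lmulA lmulKV.
Unshelve. all: by end_near. Qed.

Lemma cvel_shift {E : normedModType R} {M : charted_space E} (c : chart M E)
    (g : R -> M) (b s : R) (v : E) :
  cvel c g (s + b) v -> cvel c (fun t => g (t + b)) s v.
Proof.
move=> h; have := @cvel_affine R E M c g 1 b s v.
rewrite mul1r scale1r => /(_ h); apply: cvel_ext.
by near=> t; rewrite mul1r.
Unshelve. all: by end_near. Qed.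

Lemma driven_shift J u F b : driven J u F ->
  driven [set t | J (t + b)] (fun t => u (t + b)) (fun t => F (t + b)).
Proof. by move=> h s /= Js; exact: (cvel_shift (h _ Js)). Qed.

Lemma zero_velocity_near (J : set R) (q : R -> G) s : open J -> J s ->
  (forall r, J r -> forall b, atlas b -> cdom b (q r) -> cvel b q r 0) ->
  \forall r \near s, q r = q s.
Proof.
move=> oJ Js h; pose b := chart_at (q s).
have ab : atlas b := chart_at_atlas _; have bq : cdom b (q s) := chart_at_dom _.
have nJ : \forall r \near s, J r by exact: open_nbhs_nbhs.
have [_ cq _] := h s Js b ab bq.
have nb : \forall r \near s, cdom b (q r) by apply: cq; exact: near_cdom.
have /nbhs_ballP[del del0 hdel] : \forall r \near s, J r /\ cdom b (q r).
  by apply: filterS2 nJ nb.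
have [K [K0 mv]] := findim_mean_value (findim_rV d : findim 'rV[R]_d).
apply/nbhs_ballP; exists del => // r rs; have [Jr br] := hdel r rs.
rewrite -(cmapK br) -(cmapK bq); congr (cinv b _).
apply/eqP; rewrite -subr_eq0 -normr_le0.
have := mv (cmap b \o q) (fun=> 0) s r 0; rewrite mulr0 mul0r; apply => t tb.
rewrite normr0; split => //.
have [|Jt bt] := hdel t; last by have [] := h t Jt b ab bt.
move: rs; rewrite -!ball_normE /ball_ /= => rs; apply: le_lt_trans rs.
by rewrite distrC [`|s - r|]distrC; exact: between_dist.
Qed.

(* [F1^-1 F2] has zero velocity. *)
Lemma driven_unique (J : set R) (u : R -> 'rV[R]_d) (F1 F2 : R -> G) :
  open J -> is_interval J -> J 0 -> driven J u F1 -> driven J u F2 -> F1 0 = F2 0 ->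
  forall t, J t -> F1 t = F2 t.
Proof.
move=> oJ iJ J0 h1 h2 F0.
pose q t := lmul (linv (F1 t)) (F2 t).
have vq s : J s -> forall b, atlas b -> cdom b (q s) -> cvel b q s 0.
  move=> Js b ab bq.
  pose k1 t := lmul (F1 t) (linv (F1 s)); pose k2 t := lmul (F2 t) (linv (F2 s)).
  have k1s : k1 s = lone G by rewrite /k1 lmulgV.
  have k2s : k2 s = lone G by rewrite /k2 lmulgV.
  have v1 : cvel chart1 k1 s (u s) := h1 s Js.
  have v2 : cvel chart1 k2 s (u s) := h2 s Js.
  (* Both [k1] and [k2] pass through the identity at [s] with velocity [u s]. As [k2 = k1 r], the
     velocity [w] of [r] satisfies [u s = u s + w], so the differential of the inverse need not be
     computed. *)
  pose r t := lmul (linv (k1 t)) (k2 t).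
  have rs : r s = lone G by rewrite /r k1s k2s linv1 lmul1g.
  have [w vr] : exists w, cvel chart1 r s w.
    have i1 : cdom chart1 (linv (k1 s)) by rewrite k1s linv1; exact: chart1_dom.
    have Ci : ck_at G G 1 (@linv R d G) (k1 s) by apply: ck_linv; exact: ck_at_id.
    have vi := cvel_chain atlas_chart1 atlas_chart1 v1 Ci i1.
    by eexists; apply: (cvel_lmul1 _ _ vi v2); rewrite //= k1s linv1.
  have v2' := cvel_lmul1 k1s rs v1 vr.
  have w0 : w = 0.
    have v2'' : cvel chart1 k2 s (u s + w).
      by apply: cvel_ext v2'; near=> t; rewrite /r lmulKV.
    by have /eqP := cvel_unique v2 v2''; rewrite -{1}(addr0 (u s)) => /eqP /addrI.
  (* [q] is [r] translated on both sides by constants, so its velocity vanishes as well. *)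
  pose f x := lmul (lmul (linv (F1 s)) x) (F2 s).
  have fr t : f (r t) = q t.
    rewrite /f /r /k1 /k2 /q linvM -!lmulA.
    have -> : linv (linv (F1 s)) = F1 s by apply: linv_unique; rewrite lmulVg.
    by rewrite lmulVg lmulg1 lmulVK.
  have Cf : ck_at G G 1 f (r s).
    by apply: ck_lmul; [exact: ck_lmull|exact: ck_at_cst].
  have bf : cdom b (f (r s)) by rewrite fr.
  have := cvel_chain atlas_chart1 ab vr Cf bf; rewrite w0 derive0.
  by apply: cvel_ext; near=> t; rewrite /= fr.
have qE : forall t, J t -> q t = lone G.
  apply: interval_propagate => //; first by rewrite /q F0 lmulVg.
  by move=> s Js; have := zero_velocity_near oJ Js vq; apply: filterS => r -> _.
by move=> t /qE qt; rewrite -[LHS]lmulg1 -qt /q lmulKV.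
Unshelve. all: by end_near. Qed.

(* The system [x' = f x], [K' = dR_K (w x)], [K 0 = 1] read in the chart at the
   identity. *)
Lemma driven_flow k (E : normedModType R) (U : set E) (f : E -> E)
    (w : E -> 'rV[R]_d) (x0 : E) :
  findim E -> open U -> U x0 -> Ck k.+2 U f -> Ck k.+2 U w ->
  exists (T r : R) (phi : R -> E -> E) (K : R -> E -> G),
    [/\ 0 < T, 0 < r, local_flow U f x0 T r phi,
        Ck k (box x0 T r) (fun p : R * E => phi p.1 p.2) &
    (forall x, `|x - x0| < r -> K 0 x = lone G /\
       driven [set t | `|t| < T] (fun t => w (phi t x)) (K^~ x)) /\
    forall p, box x0 T r p ->
      ck_at (model_space (R * E)%type) G k (fun p => K p.1 p.2) p].
Proof.
move=> fE oU Ux0 Cf Cw; pose c := chart1.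
have ac : atlas c := atlas_chart1; have c1 : cdom c (lone G) := chart1_dom.
pose ce := cmap c (lone G).
pose mu (z : 'rV[R]_d * 'rV[R]_d) := cmap c (lmul (cinv c z.1) (cinv c z.2)).
have fd : findim 'rV[R]_d := findim_rV d.
have fdd : findim ('rV[R]_d * 'rV[R]_d)%type by exact: findim_prod.
(* One order more than for [f] and [w], because [mu] enters the system through its derivative. *)
have Cmu h : (cmap c @` cdom c) h -> Ckn k.+3 mu (ce, h).
  move=> /cimgK[ch hE].
  have Cm : ck_at (prod_space G G) G k.+3 (fun q => lmul q.1 q.2) (lone G, cinv c h).
    by apply: smooth_at_ck => //; exact: smooth_lmul.
  have acc : @atlas R _ (prod_space G G) (prod_chart c c) by exists c, c.
  have := Cm.2 (prod_chart c c) c acc ac (conj c1 ch).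
  by rewrite /= hE lmul1g => /(_ ch).
pose V := (cmap c @` cdom c) `*` U.
have oV : open V.
  rewrite openE => -[h x] [/= hV hU]; exists (cmap c @` cdom c, U) => //=.
  by split; apply: open_nbhs_nbhs; split => //; exact: open_cimg.
(* Differentiating the product in its left factor at the identity, in the direction [w], gives
   [dR_K w] in the chart. *)
pose fs (p : 'rV[R]_d * E) : 'rV[R]_d * E := ('D_(w p.2, 0) mu (ce, p.1), f p.2).
have Cfs : Ck k.+2 V fs.
  apply: Ck_pointwise => -[h x] [hV hU]; apply: Ckn_pt; apply: Ckn_pair; last first.
    exact: (Ckn_comp fE (Ckn_snd _ _) (Ck_Ckn oU hU Cf)).
  have := @Ckn_comp R _ _ _ k.+2
    (fun p : 'rV[R]_d * E => ((ce, p.1), (w p.2, 0 : 'rV[R]_d)))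
    (fun z => 'D_(z.2) mu z.1) (h, x); apply.
  - exact: findim_prod.
  - apply: Ckn_pair; apply: Ckn_pair; try exact: Ckn_cst; first exact: Ckn_fst.
    exact: (Ckn_comp fE (Ckn_snd _ _) (Ck_Ckn oU hU Cw)).
  - by apply: Ckn_derive => //; exact: Cmu.
have fdE : findim ('rV[R]_d * E)%type by exact: findim_prod.
have Vce : V (ce, x0) by split => //; exists (lone G).
have [T [r [Phi [T0 r0 fl CPhi]]]] := local_flow_Ck fdE oV Vce Cfs.
have CPhie : Ck k (box x0 T r) (fun p : R * E => Phi p.1 (ce, p.2)).
  have := @Ck_comp R _ _ _ k (box x0 T r) (box (ce, x0) T r)
    (fun p : R * E => (p.1, (ce, p.2))) (fun q => Phi q.1 q.2).
  apply => //; try exact: open_box.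
  - exact: findim_prod (findim_R) _.
  - by move=> [t x] [/= tT xr]; split => //; exact: prod_ball.
  - apply: Ck_pair; [exact: open_box|exact: Ck_fst|].
    by apply: Ck_pair; [exact: open_box|exact: Ck_cst|exact: Ck_snd].
exists T, r, (fun t x => (Phi t (ce, x)).2), (fun t x => cinv c (Phi t (ce, x)).1).
have Vfl x t : `|x - x0| < r -> `|t| < T -> V (Phi t (ce, x)).
  by move=> xr tT; have [_ /(_ t tT)[]] := fl _ (prod_ball ce xr).
split => //.
- move=> x xr; have [P0 Pt] := fl _ (prod_ball ce xr); split; first by rewrite P0.
  by move=> t /Pt[[_ PU] dP]; split => //; exact: (is_derive_snd dP).
- apply: (@Ck_comp R _ _ _ k (box x0 T r) setT (fun p : R * E => Phi p.1 (ce, p.2)) snd) => //.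
  + exact: open_box.
  + exact: openT.
  + exact: Ck_snd.
split; last first.
  move=> [t x] [/= tT xr]; have [hV _] := Vfl x t xr tT.
  have C1 : ck_at (model_space (R * E)%type) (model_space 'rV[R]_d) k
      (fun p => (Phi p.1 (ce, p.2)).1) (t, x).
    apply: ck_at_model; apply: (@Ckn_comp _ _ _ _ k (fun p : R * E => Phi p.1 (ce, p.2)) fst) => //.
      have btx : box x0 T r (t, x) by split.
      exact: (Ck_Ckn (@open_box R E x0 T r) btx CPhie).
    exact: Ckn_fst.
  by apply: (ck_at_comp fd C1); exact: ck_at_cinv.
move=> x xr; have [P0 Pt] := fl _ (prod_ball ce xr).
split; first by rewrite P0 /= cmapK.
move=> s /= sT; pose h t := (Phi t (ce, x)).1; pose K t := cinv c (h t).
have [hV _] := Vfl x s xr sT; have [cK hE] := cimgK hV.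
have dh : is_derive s (1 : R) h ('D_(w (Phi s (ce, x)).2, 0) mu (ce, h s)).
  by have [_ dP] := Pt s sT; exact: (is_derive_fst dP).
set wx := w _ in dh *.
have nT : \forall t \near s, `|t| < T.
  exact: (open_nbhs_nbhs (conj (@open_symmetric_interval R T) sT)).
have vK : cvel c K s ('D_(wx, 0) mu (ce, h s)).
  split; first exact: cK.
    apply: (@continuous_comp _ _ _ h (cinv c)); first exact: is_derive_continuous dh.
    exact: continuous_cinv.
  apply: near_eq_is_derive dh; apply: filterS nT => t tT.
  have [hVt _] := Vfl x t xr tT; have [_ e] := cimgK hVt.
  by rewrite /K /h /= e.
have cKK : cdom c (lmul (K s) (linv (K s))) by rewrite lmulgV.
have := cvel_chain ac ac vK (ck_lmulr 1 (linv (K s)) _) cKK.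
rewrite [X in cvel _ _ _ X](_ : _ = wx) //.
have -> : cmap c (K s) = h s by exact: hE.
rewrite derive_partial; last exact: (Ckn_differentiable (Cmu _ hV)).
rewrite derive0 addr0.
have cK1 : cdom c (lmul (lone G) (K s)) by rewrite lmul1g.
have C1 := Ckn_differentiable ((ck_lmulr 1 (K s) (lone G)).2 c c ac ac c1 cK1).
have C2 := Ckn_differentiable ((ck_lmulr 1 (linv (K s)) (K s)).2 c c ac ac cK cKK).
rewrite hE in C2.
(* [f1] is right translation by [K s] and [f2] right translation by its inverse; their composite is
   the identity near [ce], so the velocity brought back to the identity is [wx]. *)
pose f1 z := mu (z, h s).
pose f2 := cmap c \o (fun g => lmul g (linv (K s))) \o cinv c.
have f1ce : f1 ce = h s by rewrite /f1 /mu /= cmapK // lmul1g.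
have C1' : differentiable f1 ce := C1.
have C2' : differentiable f2 (f1 ce) by rewrite f1ce.
rewrite -[LHS]/('D_('D_wx f1 ce) f2 (h s)) -f1ce -derive_comp //.
apply: derive_near_id.
have nK : \forall g \near lone G, cdom c (lmul g (K s)).
  by apply: (ck_lmulr 0 (K s) (lone G)).1; exact: near_cdom.
apply: filterS (near_cinv c1 nK) => z [_ zE cz].
by rewrite /= /f2 /f1 /mu /= (cmapK cz) -/(K s) lmulgK.
Qed.

End LieGroups.

(** * One-parameter subgroups *)

Section OneParameterSubgroups.
Context {R : realType} {d : nat} (G : lie_group R d).

Let cG : compatible G. Proof. exact: compatible_manifold. Qed.
Let cR : compatible (model_space (R : normedModType R)).
Proof. exact: compatible_model (findim_R). Qed.

Lemma symmetric_interval (T : R) : is_interval [set t : R | `|t| < T].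
Proof.
move=> x y /= xT yT z /andP[xz zy]; move: xT yT; rewrite !ltr_norml.
by move=> /andP[? ?] /andP[? ?]; apply/andP; split; lra.
Qed.

Lemma local_one_parameter k (xi : 'rV[R]_d) : exists (T : R) (g : R -> G),
  [/\ 0 < T, g 0 = lone G, driven [set t | `|t| < T] (cst xi) g
    & ck_at (model_space (R : normedModType R)) G k g 0].
Proof.
(* The state space is the Lie algebra with the zero vector field and [w] the identity, so the
   driving term stays equal to the initial state [xi]. *)
have [T [r [phi [K [T0 r0 fl _ [hK ckK]]]]]] := @driven_flow R d G k 'rV[R]_d setT
  (cst 0) idfun xi (findim_rV d) openT Logic.I (Ck_cst _ _ _) (Ck_id _ _).
have xir : `|xi - xi| < r by rewrite subrr normr0.
have [K0 dK] := hK xi xir; have [phi0 dphi] := fl xi xir.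
have phiE t : `|t| < T -> phi t xi = xi.
  move=> tT; have [C [C0 mv]] := findim_mean_value (findim_rV d : findim 'rV[R]_d).
  apply/eqP; rewrite -subr_eq0 -normr_le0.
  have := mv (phi^~ xi) (fun=> 0) 0 t 0; rewrite mulr0 mul0r phi0; apply => s hs.
  suff sT : `|s| < T by have [_ h] := dphi s sT; rewrite normr0.
  by apply: le_lt_trans tT; have := between_dist hs; rewrite !subr0.
exists T, (K^~ xi); split => //.
  by move=> t /= tT; have := dK t tT; rewrite phiE.
have b0 : box xi T r (0, xi) by rewrite /box /= normr0 subrr normr0.
have C1 : ck_at (model_space (R : normedModType R)) (model_space (R * 'rV[R]_d)%type) k
    (fun t => (t, xi)) 0.
  by apply: ck_at_model; apply: Ckn_pair; [exact: Ckn_id|exact: Ckn_cst].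
exact: (ck_at_comp (findim_prod findim_R (findim_rV d)) C1 (ckK (0, xi) b0)).
Qed.

Lemma iter_square (n : nat) (g h : G) : lmul g h = lmul h g ->
  iter n (fun x => lmul x x) (lmul g h) =
  lmul (iter n (fun x => lmul x x) g) (iter n (fun x => lmul x x) h).
Proof.
elim: n g h => [//|n IH] g h gh; rewrite !iterSr -IH.
  by congr (iter n _ _); rewrite -!lmulA; congr (lmul g _); rewrite !lmulA gh.
have e : lmul g (lmul h h) = lmul (lmul h h) g.
  by rewrite lmulA gh -!lmulA gh.
by rewrite -lmulA e lmulA e -!lmulA.
Qed.

(* A local solution [g] satisfies [g (s + t) = g s g t] for small times by
   uniqueness, and [t |-> g (t / 2^n)^(2^n)] extends it to all times. *)
Lemma one_parameter_exists (xi : 'rV[R]_d) : exists Gam : R -> G,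
  [/\ forall k t, ck_at (model_space (R : normedModType R)) G k Gam t,
      forall s t, Gam (s + t) = lmul (Gam s) (Gam t)
    & driven setT (cst xi) Gam].
Proof.
have [T [g [T0 g0 dg _]]] := local_one_parameter 0 xi.
(* The solution [g] comes from order 0. For each [k] it agrees near 0 with the solution built for
   that [k], by uniqueness, and so is $C^k$ at 0 for every [k]. *)
have ckg k : ck_at (model_space (R : normedModType R)) G k g 0.
  have [T' [h [T'0 h0 dh ckh]]] := local_one_parameter k xi.
  apply: ck_at_ext ckh.
  pose S := Num.min T T'.
  have S0 : 0 < S by rewrite lt_min T0.
  have n0 : `|0 : R| < S by rewrite normr0.
  have d1 : driven [set t | `|t| < S] (cst xi) h.
    by apply: driven_sub dh => t /=; rewrite lt_min => /andP[].
  have d2 : driven [set t | `|t| < S] (cst xi) g.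
    by apply: driven_sub dg => t /=; rewrite lt_min => /andP[].
  have hg := driven_unique (@open_symmetric_interval R S) (@symmetric_interval S) n0 d1 d2.
  apply: filterS (open_nbhs_nbhs (conj (@open_symmetric_interval R S) n0)) => t.
  by apply: hg; rewrite h0 g0.
(* Halving keeps [s + t] in the domain of [g]. *)
pose S := T / 2.
have S0 : 0 < S by rewrite divr_gt0.
have gD s t : `|s| < S -> `|t| < S -> g (s + t) = lmul (g s) (g t).
  move=> sS tS; have n0 : `|0 : R| < S by rewrite normr0.
  have d1 : driven [set q | `|q| < S] (cst xi) (fun q => lmul (g (q + t)) (linv (g t))).
    apply: driven_mulr; have := @driven_shift R d G _ _ _ t dg; apply: driven_sub => q /= qS.
    by apply: le_lt_trans (ler_normD _ _) _; rewrite /S in qS tS; lra.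
  have d2 : driven [set q | `|q| < S] (cst xi) g.
    by apply: driven_sub dg => q /= qS; rewrite /S in qS; lra.
  have := driven_unique (@open_symmetric_interval R S) (@symmetric_interval S) n0 d1 d2.
  by rewrite add0r lmulgV g0 => /(_ erefl s sS) <-; rewrite lmulgKV.
pose sq := fun x : G => lmul x x.
pose dbl n t := iter n sq (g (t * 2^-1 ^+ n)).
have small t : exists n, `|t * 2^-1 ^+ n| < S.
  have : (fun n => `|t| * 2^-1 ^+ n) @ \oo --> (0 : R).
    by apply: cvg_geometric; rewrite ger0_norm // invf_lt1 // ltr1n.
  move=> /cvgrPdist_lt/(_ _ S0)[n _ /(_ n (leqnn _))] /=.
  by rewrite sub0r normrN !normrM normr_id => h; exists n; rewrite normrM.
have smaller t n m : (n <= m)%N -> `|t * 2^-1 ^+ n| < S -> `|t * 2^-1 ^+ m| < S.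
  move=> nm; apply: le_lt_trans; rewrite !normrM ler_wpM2l // !ger0_norm ?exprn_ge0 //.
  by apply: ler_wiXn2l; rewrite ?invr_ge0 ?invf_le1 ?ler1n.
have dblS t n : `|t * 2^-1 ^+ n| < S -> dbl n.+1 t = dbl n t.
  move=> h; rewrite /dbl iterSr; congr (iter n _ _).
  rewrite /sq -gD; try exact: smaller h.
  by congr g; rewrite exprS; field.
have dbl_le t n m : (n <= m)%N -> `|t * 2^-1 ^+ n| < S -> dbl m t = dbl n t.
  move=> /subnK <- h; elim: (m - n)%N => // j IH; rewrite addSn dblS //.
  by apply: smaller h; rewrite leq_addl.
have /choice[N hN] := small.
pose Gam t := dbl (N t) t.
have GamE n t : `|t * 2^-1 ^+ n| < S -> Gam t = dbl n t.
  move=> h; rewrite /Gam -(dbl_le t (N t) (maxn n (N t))) ?leq_maxr //.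
  by rewrite -(dbl_le t n (maxn n (N t))) ?leq_maxl.
have GamD s t : Gam (s + t) = lmul (Gam s) (Gam t).
  pose n := maxn (N s) (maxn (N t) (N (s + t))).
  have hs : `|s * 2^-1 ^+ n| < S by apply: smaller (hN s); rewrite leq_maxl.
  have ht : `|t * 2^-1 ^+ n| < S.
    by apply: smaller (hN t); rewrite leq_max leq_max leqnn orbT.
  have hst : `|(s + t) * 2^-1 ^+ n| < S.
    by apply: smaller (hN (s + t)); rewrite !leq_max leqnn !orbT.
  rewrite !(GamE n) // /dbl mulrDl gD // iter_square //.
  by rewrite -!gD // addrC.
have Gamg t : `|t| < S -> Gam t = g t.
  by move=> h; rewrite (GamE 0%N) /dbl /= expr0 mulr1.
have n0 : `|0 : R| < S by rewrite normr0.
have nearg : \forall t \near (0 : R), g t = Gam t.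
  apply: filterS (open_nbhs_nbhs (conj (@open_symmetric_interval R S) n0)) => t tS.
  by rewrite Gamg.
have GamB s t : Gam t = lmul (Gam (t - s)) (Gam s) by rewrite -GamD subrK.
exists Gam; split => //.
  (* Regularity at 0 is carried to [t] by the group law. *)
  move=> k t; have ck0 : ck_at (model_space (R : normedModType R)) G k Gam (t - t).
    by rewrite subrr; apply: ck_at_ext (ckg k).
  have -> : Gam = fun q => lmul (Gam (q - t)) (Gam t) by apply/funext => q; exact: GamB.
  apply: ck_lmul; last exact: ck_at_cst.
  have cs : ck_at (model_space (R : normedModType R)) (model_space (R : normedModType R)) k
      (fun q => q - t) t.
    apply: ck_at_model; exists setT; split => //; first exact: openT.
    by apply: Ck_add; [exact: openT|exact: Ck_id|exact: Ck_cst].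
  exact: (ck_at_comp findim_R cs ck0).
move=> s _; have T00 : `|0 : R| < T by rewrite normr0.
have v0 : cvel (chart1 G) Gam (s + - s) xi.
  rewrite subrr; have := dg 0 T00; apply: cvel_ext.
  by apply: filterS nearg => t <-; rewrite g0 linv1 lmulg1.
have := cvel_shift v0; apply: cvel_ext; near=> t.
by rewrite (GamB s t) lmulgK.
Unshelve. all: by end_near. Qed.

(** By the group law $g(t) g(s)^{-1} = g(t - s)$, so the velocity at 0 determines the equation at
    every time; uniqueness of one-parameter subgroups follows from [driven_unique]. *)
Lemma one_parameter_driven (xi : lie_algebra G) (g : R -> G) :
  one_parameter_subgroup xi g -> g 0 = lone G /\ driven setT (cst xi) g.
Proof.
move=> [sg gD vg].
have g0 : g 0 = lone G.
  by have := lmulgK (g 0) (g 0); rewrite -gD addr0 lmulgV.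
split; [exact: g0|move=> s _].
have ckg : ck_at (model_space (R : normedModType R)) G 1 g 0 by exact: smooth_at_ck.
have c0 : cdom (chart1 G) (g 0) by rewrite g0; exact: chart1_dom.
have v0 : cvel (chart1 G) g (s + - s) xi.
  rewrite subrr; split; [exact: c0|exact: ckg.1|].
  have dg := Ckn_differentiable (ckg.2 (id_chart _) _ erefl (@atlas_chart1 R d G) Logic.I c0).
  apply: DeriveDef; first exact/derivable1_diffP.
  by rewrite -derive1E -vg /velocity g0.
have := cvel_shift v0; apply: cvel_ext; near=> t.
have -> : g t = lmul (g (t - s)) (g s) by rewrite -gD subrK.
by rewrite lmulgK.
Unshelve. all: by end_near. Qed.

Lemma lie_expE (xi : lie_algebra G) (Gam : R -> G) :
  (forall k t, ck_at (model_space (R : normedModType R)) G k Gam t) ->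
  (forall s t, Gam (s + t) = lmul (Gam s) (Gam t)) ->
  driven setT (cst xi) Gam -> forall t, lie_exp (t *: xi) = Gam t.
Proof.
move=> ck GD dG t.
have G0 : Gam 0 = lone G.
  by have := lmulgK (Gam 0) (Gam 0); rewrite -GD addr0 lmulgV.
have vG : cvel (chart1 G) Gam (t * 0 + 0) xi.
  rewrite mulr0 addr0; apply: cvel_ext (dG 0 Logic.I); near=> s.
  by rewrite G0 linv1 lmulg1.
(* The summand 0 matches the affine reparametrisation in [cvel_affine]. *)
have h1 : one_parameter_subgroup (t *: xi) (fun s => Gam (t * s + 0)).
  have hG : Gam (t * 0 + 0) = lone G by rewrite mulr0 addr0.
  split.
  - move=> q0.
    apply: (@ck_smooth_on _ _ _ (model_space (R : normedModType R)) G _ setT) => //.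
      exact: openT.
    move=> q _ k.
    have cs : ck_at (model_space (R : normedModType R)) (model_space (R : normedModType R)) k
        (fun s => t * s + 0) q.
      apply: ck_at_model; exists setT; split => //; first exact: openT.
      apply: Ck_add; [exact: openT| |exact: Ck_cst].
      by apply: (@Ck_scale _ _ _ _ _ (cst t)); [exact: openT|exact: Ck_cst|exact: Ck_id].
    exact: (ck_at_comp findim_R cs (ck k _)).
  - by move=> s s'; rewrite -GD !addr0 mulrDr.
  - have [_ _ dG'] := cvel_affine vG.
    rewrite /velocity hG derive1E; exact: (@derive_val _ _ _ _ _ _ _ dG').
apply: xget_unique; first by exists (fun s => Gam (t * s + 0)) => //; rewrite mulr1 addr0.
move=> _ [g hg ->]; have [g0 dg] := one_parameter_driven hg.
have [Gt0 dGt] := one_parameter_driven h1.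
have iT : is_interval [set: R] by [].
have := driven_unique openT iT Logic.I dg dGt; rewrite g0 Gt0 => /(_ erefl 1 Logic.I) ->.
by rewrite mulr1 addr0.
Unshelve. all: by end_near. Qed.

End OneParameterSubgroups.

(** * Actions and the lifted flow *)

Section Actions.
Context {R : realType} {d n : nat} {G : lie_group R d} {M : manifold R n}.
Variable A : smooth_action G M.

Notation line := (model_space (R : normedModType R)).

Let cG : compatible G. Proof. exact: compatible_manifold. Qed.
Let cM : compatible M. Proof. exact: compatible_manifold. Qed.
Let cR : compatible line. Proof. exact: compatible_model (findim_R). Qed.
Let cGM : compatible (prod_space G M). Proof. exact: compatible_prod. Qed.
Let cRM : compatible (prod_space line M). Proof. exact: compatible_prod. Qed.

Lemma ck_act {E : normedModType R} (P : charted_space E) k (f : P -> G) (g : P -> M) p :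
  ck_at P G k f p -> ck_at P M k g p -> ck_at P M k (fun q => A (f q) (g q)) p.
Proof.
move=> Cf Cg.
have Ca : ck_at (prod_space G M) M k (fun q => A q.1 q.2) (f p, g p).
  by apply: smooth_at_ck => //; exact: smooth_act.
exact: (ck_at_comp cGM.1 (ck_at_pair Cf Cg) Ca).
Qed.

(** The chain rule for the orbit map of [m] along the one-parameter subgroup of [psi m]; only this
    differential at the identity is used afterwards. *)
Lemma induced_vector_fieldE (psi : M -> lie_algebra G) (m : M) :
  induced_vector_field A psi m =
  'D_(psi m) (cmap (chart_at m) \o A^~ m \o cinv (chart1 G)) (cmap (chart1 G) (lone G)).
Proof.
have [Gam [ckG GD dG]] := one_parameter_exists G (psi m).
have expE t : lie_exp (t *: psi m) = Gam t by exact: lie_expE.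
have G0 : Gam 0 = lone G.
  by have := lmulgK (Gam 0) (Gam 0); rewrite -GD addr0 lmulgV.
have curveE : (fun t : R => A (lie_exp (t *: psi m)) m) = (fun t => A (Gam t) m).
  by apply/funext => t; rewrite expE.
have vG : cvel (chart1 G) Gam 0 (psi m).
  by apply: cvel_ext (dG 0 Logic.I); near=> s; rewrite G0 linv1 lmulg1.
have ckA : ck_at G M 1 (fun g => A g m) (Gam 0).
  by apply: ck_act; [exact: ck_at_id|exact: ck_at_cst].
have cm : cdom (chart_at m) (A (Gam 0) m) by rewrite G0 act1; exact: chart_at_dom.
have [_ _ dA] := cvel_chain (@atlas_chart1 R d G) (chart_at_atlas m) vG ckA cm.
rewrite /induced_vector_field /velocity expE G0 act1 curveE derive1E.
by rewrite (@derive_val _ _ _ _ _ _ _ dA) G0.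
Unshelve. all: by end_near. Qed.

(* With [k t = F t (F s)^-1] and [z t = k(t)^-1 . x t], differentiating
   [x = k . z] at [s] gives [X = psi_M + z'], so [z' s = Y]; and
   [F^-1 . x = (F s)^-1 . z]. *)
Lemma driven_act (X Y : forall m : M, tangent m) (psi : M -> lie_algebra G)
    (J : set R) (x : R -> M) (F : R -> G) :
  (forall g m, tangent_map (A g) (Y m) = Y (A g m)) ->
  (forall m, X m = Y m + induced_vector_field A psi m) ->
  integral_curve X J x -> driven J (fun t => psi (x t)) F ->
  integral_curve Y J (fun t => A (linv (F t)) (x t)).
Proof.
move=> Yinv XY /integral_curveP ix dF; apply/integral_curveP => s Js.
pose k t := lmul (F t) (linv (F s)); pose z t := A (linv (k t)) (x t).
have ks : k s = lone G by rewrite /k lmulgV.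
have vk : cvel (chart1 G) k s (psi (x s)) := dF s Js.
pose a := chart_at (x s); have aa : atlas a := chart_at_atlas _.
have ax : cdom a (x s) := chart_at_dom _.
have vx : cvel a x s (X (x s)) := ix s Js.
have zs : z s = x s by rewrite /z ks linv1 act1.
(* Only differentiability of [z] is taken from this chain rule, whose value involves the
   differential of [linv]; the velocity is read off from [x = k . z] instead. *)
have [v vz] : exists v, cvel a z s v.
  have C : ck_at (prod_space G M) M 1 (fun q => A (linv q.1) q.2) (k s, x s).
    by apply: ck_act; [apply: ck_linv; exact: ck_at_fst|exact: ck_at_snd].
  have az : cdom a (A (linv (k s)) (x s)) by rewrite -[A _ _]/(z s) zs.
  by eexists; exact: (cvel_chain2 (f := fun g m => A (linv g) m)
    (@atlas_chart1 R d G) aa aa vk vx C az).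
have vE : v = Y (x s).
  have C : ck_at (prod_space G M) M 1 (fun q => A q.1 q.2) (k s, z s).
    by apply: smooth_at_ck => //; exact: smooth_act.
  have az : cdom a (A (k s) (z s)) by rewrite ks act1 zs.
  have := cvel_chain2 (@atlas_chart1 R d G) aa aa vk vz C az.
  rewrite ks zs.
  have -> : A (lone G) = idfun :> (M -> M) by apply/funext => m; rewrite act1.
  rewrite -[_ \o idfun]/(cmap a) derive_chart_id // -induced_vector_fieldE => vx'.
  have vx'' : cvel a x s (induced_vector_field A psi (x s) + v).
    apply: cvel_ext vx'; near=> t.
    by rewrite /z -actM lmulgV act1.
  have := cvel_unique vx vx''; rewrite XY addrC => /addrI; exact.
pose g := linv (F s).
have yE t : A g (z t) = A (linv (F t)) (x t).
  by rewrite /z -actM /g /k linvM lmulA lmulgV lmul1g.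
pose b := chart_at (A g (x s)); have ab : atlas b := chart_at_atlas _.
have bz : cdom b (A g (z s)) by rewrite zs; exact: chart_at_dom.
have Cg : ck_at M M 1 (A g) (z s).
  by apply: (ck_act (f := cst g)); [exact: ck_at_cst|exact: ck_at_id].
have := cvel_chain aa ab vz Cg bz; rewrite zs vE.
have -> : 'D_(Y (x s)) (cmap b \o A g \o cinv a) (cmap a (x s)) = Y (A g (x s)).
  exact: Yinv.
by apply: cvel_ext; near=> t; rewrite /= yE.
Unshelve. all: by end_near. Qed.

(** * The lifted flow on $G \times M$ *)

Section Reach.
Variables (X : forall m : M, tangent m) (psi : M -> lie_algebra G).
Hypothesis sX : smooth_vector_field X.
Hypothesis spsi : smooth M (model_space (lie_algebra G)) psi.

Definition lifted_curve (J : set R) (m : M) (F : R -> G) (x : R -> M) : Prop :=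
  [/\ open J, is_interval J, J 0 & [/\ integral_curve X J x,
    driven J (fun t => psi (x t)) F, F 0 = lone G & x 0 = m]].

(* The solution of [x' = X x], [F' = dR_F (psi x)] starting at [(1, m)] is
   defined up to time [t], where it equals [(g, q)]. *)
Definition reach (t : R) (m : M) (g : G) (q : M) : Prop :=
  exists J F x, [/\ lifted_curve J m F x, J t, F t = g & x t = q].

Lemma is_intervalI (J J' : set R) :
  is_interval J -> is_interval J' -> is_interval (J `&` J').
Proof.
move=> iJ iJ' x y [Jx J'x] [Jy J'y] z xyz.
by split; [exact: iJ xyz|exact: iJ' xyz].
Qed.

Lemma integral_curve_sub (J J' : set R) x : J' `<=` J ->
  integral_curve X J x -> integral_curve X J' x.
Proof. by move=> JJ' h t /JJ'; exact: h. Qed.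

Lemma integral_curve_eq (J J' : set R) x x' : open J -> is_interval J -> J 0 ->
  open J' -> is_interval J' -> J' 0 -> integral_curve X J x ->
  integral_curve X J' x' -> x 0 = x' 0 -> forall t, J t -> J' t -> x t = x' t.
Proof.
move=> oJ iJ J0 oJ' iJ' J'0 hx hx' x0 t Jt J't.
apply: (@integral_curve_unique R _ M X (J `&` J')) => //.
- exact: manifold_hausdorff.
- exact: openI.
- exact: is_intervalI.
- by apply: integral_curve_sub hx => r [].
- by apply: integral_curve_sub hx' => r [].
Qed.

Lemma lifted_curve_eq J J' m F F' x x' : lifted_curve J m F x ->
  lifted_curve J' m F' x' -> forall t, J t -> J' t -> F t = F' t /\ x t = x' t.
Proof.
move=> [oJ iJ J0 [hx dF F0 x0]] [oJ' iJ' J'0 [hx' dF' F'0 x'0]] t Jt J't.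
have xx' : forall t, J t -> J' t -> x t = x' t.
  by apply: (@integral_curve_eq J J') => //; rewrite x0 x'0.
split; last exact: xx'.
apply: (@driven_unique R d G (J `&` J') (fun t => psi (x t))) => //.
- exact: openI.
- exact: is_intervalI.
- by apply: driven_sub dF => r [].
- by move=> s [Js J's]; rewrite xx' //; exact: dF'.
- by rewrite F0 F'0.
Qed.

Lemma reach_unique t m g g' q q' : reach t m g q -> reach t m g' q' -> g = g' /\ q = q'.
Proof.
move=> [J [F [x [l Jt <- <-]]]] [J' [F' [x' [l' J't <- <-]]]].
exact: (lifted_curve_eq l l').
Qed.

Lemma integral_curve_shift J x s : integral_curve X J x ->
  integral_curve X [set t | J (t + s)] (fun t => x (t + s)).
Proof.
by move=> /integral_curveP h; apply/integral_curveP => t /= /h; exact: cvel_shift.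
Qed.

Lemma open_shift (J : set R) s : open J -> open [set t | J (t + s)].
Proof.
move=> oJ; apply: (@open_comp _ _ (fun t : R => t + s) J) => // t _.
by apply: cvgD; [exact: cvg_id|exact: cvg_cst].
Qed.

Lemma is_interval_shift (J : set R) s : is_interval J -> is_interval [set t | J (t + s)].
Proof. by move=> iJ x y Jx Jy z /andP[xz zy]; apply: iJ Jx Jy _ _; rewrite !lerD2r xz. Qed.

Lemma is_intervalU (J J' : set R) s : is_interval J -> is_interval J' -> J s -> J' s ->
  is_interval (J `|` J').
Proof.
move=> iJ iJ' Js J's x y hx hy z /andP[xz zy].
have [zs|/ltW sz] := leP z s.
  by case: hx => hx; [left; apply: iJ hx Js _ _|right; apply: iJ' hx J's _ _]; rewrite xz.
by case: hy => hy; [left; apply: iJ Js hy _ _|right; apply: iJ' J's hy _ _]; rewrite sz.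
Qed.

(** The cocycle law of the lifted flow. The second solution is delayed by [s] and multiplied on the
    right by [g]; both intervals contain [s], so their union is an interval, and the solutions agree
    on the overlap by uniqueness. *)
Lemma reach_comp s t m g p g' p' : reach s m g p -> reach t p g' p' ->
  reach (s + t) m (lmul g' g) p'.
Proof.
move=> [J1 [F1 [x1 [l1 J1s F1s x1s]]]] [J2 [F2 [x2 [l2 J2t F2t x2t]]]].
have [oJ1 iJ1 J10 [hx1 dF1 F10 x10]] := l1.
have [oJ2 iJ2 J20 [hx2 dF2 F20 x20]] := l2.
pose J2' := [set r | J2 (r + - s)].
have oJ2' : open J2' by exact: open_shift.
have iJ2' : is_interval J2' by exact: is_interval_shift.
have J2's : J2' s by rewrite /J2' /= subrr.
have hx2' : integral_curve X J2' (fun r => x2 (r - s)) by exact: integral_curve_shift.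
have dF2' : driven J2' (fun r => psi (x2 (r - s))) (fun r => lmul (F2 (r - s)) g).
  by apply: driven_mulr; exact: (@driven_shift R d G J2 _ F2 (- s) dF2).
have agree r : J1 r -> J2' r -> x1 r = x2 (r - s) /\ F1 r = lmul (F2 (r - s)) g.
  move=> J1r J2r.
  (* The overlap is moved back by [s], so that the uniqueness results, which start at time 0, can be
     used. *)
  pose K := [set q | J1 (q + s)] `&` J2.
  have oK : open K by apply: openI => //; exact: open_shift.
  have iK : is_interval K by apply: is_intervalI => //; exact: is_interval_shift.
  have K0 : K 0 by split => //=; rewrite add0r.
  have hK1 : integral_curve X K (fun q => x1 (q + s)).
    by apply: (@integral_curve_sub [set q | J1 (q + s)]) => [q []|] //; exact: integral_curve_shift.
  have hK2 : integral_curve X K x2 by apply: integral_curve_sub hx2 => q [].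
  have xE q : K q -> x1 (q + s) = x2 q.
    move=> Kq; apply: (@integral_curve_eq K K (fun q => x1 (q + s)) x2) => //.
    by rewrite add0r x1s x20.
  have dK1 : driven K (fun q => psi (x2 q)) (fun q => F1 (q + s)).
    move=> q Kq; rewrite -xE //.
    by apply: (@driven_shift R d G J1 (fun t => psi (x1 t)) F1 s dF1 q); have [] := Kq.
  have dK2 : driven K (fun q => psi (x2 q)) (fun q => lmul (F2 q) g).
    by apply: driven_mulr; apply: driven_sub dF2 => q [].
  have FE q : K q -> F1 (q + s) = lmul (F2 q) g.
    move=> Kq; apply: (driven_unique oK iK K0 dK1 dK2) => //.
    by rewrite add0r F1s F20 lmul1g.
  have Kr : K (r - s) by split => //=; rewrite subrK.
  by have := xE _ Kr; have := FE _ Kr; rewrite subrK => -> ->.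
pose x r := if pselect (J1 r) then x1 r else x2 (r - s).
pose F r := if pselect (J1 r) then F1 r else lmul (F2 (r - s)) g.
have xE1 r : J1 r -> x r = x1 r by rewrite /x; case: pselect.
have FE1 r : J1 r -> F r = F1 r by rewrite /F; case: pselect.
have xE2 r : J2' r -> x r = x2 (r - s).
  by move=> J2r; rewrite /x; case: pselect => // J1r; have [-> _] := agree r J1r J2r.
have FE2 r : J2' r -> F r = lmul (F2 (r - s)) g.
  by move=> J2r; rewrite /F; case: pselect => // J1r; have [_ ->] := agree r J1r J2r.
exists (J1 `|` J2'), F, x; split.
- split; first exact: openU.
  + exact: (is_intervalU iJ1 iJ2' J1s J2's).
  + by left.
  split; rewrite ?xE1 ?FE1 //.
  + apply/integral_curveP => r [Jr|Jr].
      rewrite xE1 //; have := (integral_curveP X J1 x1).1 hx1 r Jr.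
      apply: cvel_ext; apply: filterS (open_nbhs_nbhs (conj oJ1 Jr)) => q Jq.
      by rewrite xE1.
    rewrite xE2 //; have := (integral_curveP X J2' _).1 hx2' r Jr.
    apply: cvel_ext; apply: filterS (open_nbhs_nbhs (conj oJ2' Jr)) => q Jq.
    by rewrite xE2.
  + move=> r [Jr|Jr].
      rewrite xE1 // FE1 //; have := dF1 r Jr.
      apply: cvel_ext; apply: filterS (open_nbhs_nbhs (conj oJ1 Jr)) => q Jq.
      by rewrite FE1.
    rewrite xE2 // FE2 //; have := dF2' r Jr.
    apply: cvel_ext; apply: filterS (open_nbhs_nbhs (conj oJ2' Jr)) => q Jq.
    by rewrite FE2.
- by right; rewrite /J2' /= addrAC subrr add0r.
- have J2st : J2' (s + t) by rewrite /J2' /= addrAC subrr add0r.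
  by rewrite FE2 // addrAC subrr add0r F2t.
- have J2st : J2' (s + t) by rewrite /J2' /= addrAC subrr add0r.
  by rewrite xE2 // addrAC subrr add0r x2t.
Qed.

(** [driven_flow] read through a chart at [p], with a time of existence common to all points of [W].
    The order [k] comes first, as [T], [W] and the maps are chosen after it. *)
Lemma local_reach k (p : M) : exists (T : R) (W : set M) (GG : R -> M -> G) (PP : R -> M -> M),
  [/\ 0 < T, open W, W p & forall t m, `|t| < T -> W m ->
   [/\ reach t m (GG t m) (PP t m),
    ck_at (prod_space line M) G k (fun q => GG q.1 q.2) (t, m) &
    ck_at (prod_space line M) M k (fun q => PP q.1 q.2) (t, m)]].
Proof.
pose a := chart_at p; have aa : atlas a := chart_at_atlas _.
have ap : cdom a p := chart_at_dom _.
pose U := cmap a @` cdom a; have oU : open U := open_cimg a.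
have Up : U (cmap a p) by exists p.
pose f y := tangent_coord a (X (cinv a y)).
pose w y : 'rV[R]_d := psi (cinv a y).
have Cw : Ck k.+2 U w.
  apply: Ck_pointwise => y Uy; apply: Ckn_pt; have [ay yE] := cimgK Uy.
  have Cp : ck_at M (model_space 'rV[R]_d) k.+2 psi (cinv a y).
    by apply: smooth_at_ck => //; exact: compatible_model (findim_rV d).
  have := Cp.2 a (id_chart _) aa erefl ay Logic.I.
  by rewrite yE.
have [T [r [phi [K [T0 r0 fl Cphi [hK ckK]]]]]] :=
  @driven_flow R d G k 'rV[R]_n U f w (cmap a p) (findim_rV n) oU Up (sX aa k.+2) Cw.
pose W := interior [set m | cdom a m /\ `|cmap a m - cmap a p| < r].
have Wp : W p.
  have n1 := near_cdom ap.
  have n2 : \forall m \near p, `|cmap a m - cmap a p| < r.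
    have cc : {for p, continuous (cmap a)} := continuous_cmap ap.
    have n2 : \forall y \near cmap a p, `|y - cmap a p| < r.
      by apply: near_norm_lt; rewrite subrr normr0.
    exact: (cc _ n2).
  by apply: filterS2 n1 n2.
exists T, W, (fun t m => K t (cmap a m)), (fun t m => cinv a (phi t (cmap a m))).
split => //; first exact: open_interior.
move=> t m tT /interior_subset[am mr].
have [phi0 dphi] := fl _ mr; have [K0 dK] := hK _ mr.
have nT (s : R) : `|s| < T -> \forall q \near s, `|q| < T.
  by move=> sT; exact: (open_nbhs_nbhs (conj (@open_symmetric_interval R T) sT)).
split.
- exists [set s | `|s| < T], (K^~ (cmap a m)), (fun t => cinv a (phi t (cmap a m))).
  split => //; split; [exact: open_symmetric_interval|exact: symmetric_interval| |].
    by rewrite /= normr0.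
  split => //; last by rewrite phi0 cmapK.
  apply/integral_curveP => s /= sT; have [Us ds] := dphi s sT; have [as_ sE] := cimgK Us.
  pose x t := cinv a (phi t (cmap a m)).
  apply: (@cvel_chartP R _ M X a x s cM aa as_).2; split; first exact: as_.
    apply: (@continuous_comp _ _ _ (phi^~ (cmap a m)) (cinv a)).
      exact: is_derive_continuous ds.
    exact: continuous_cinv.
  apply: near_eq_is_derive ds; apply: filterS (nT s sT) => q qT /=.
  by have [Uq _] := dphi q qT; have [_ ->] := cimgK Uq.
- have C1 : ck_at (prod_space line M) (model_space (R * 'rV[R]_n)%type) k
      (fun q => (q.1, cmap a q.2)) (t, m).
    apply: ck_at_model_pair; first exact: ck_at_fst.
    by apply: (ck_at_comp cM.1 (ck_at_snd k _ cM)); exact: ck_at_cmap.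
  have btm : box (cmap a p) T r (t, cmap a m) by split.
  exact: (ck_at_comp (findim_prod findim_R (findim_rV n)) C1 (ckK _ btm)).
- have C1 : ck_at (prod_space line M) (model_space (R * 'rV[R]_n)%type) k
      (fun q => (q.1, cmap a q.2)) (t, m).
    apply: ck_at_model_pair; first exact: ck_at_fst.
    by apply: (ck_at_comp cM.1 (ck_at_snd k _ cM)); exact: ck_at_cmap.
  have btm : box (cmap a p) T r (t, cmap a m) by split.
  have C2 : ck_at (model_space (R * 'rV[R]_n)%type) (model_space 'rV[R]_n) k
      (fun p => phi p.1 p.2) (t, cmap a m).
    apply: ck_at_model; exact: (Ck_Ckn (@open_box R _ (cmap a p) T r) btm Cphi).
  have C3 := ck_at_comp (findim_prod findim_R (findim_rV n)) C1 C2.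
  apply: (ck_at_comp (findim_rV n) C3); apply: ck_at_cinv => //.
  by have [] := dphi t tT.
Qed.

(** The maps [FF] and [PP] may change with [k]; [reach] ties them near [(s, m0)] to the one lifted
    solution. *)
Definition good k (m0 : M) (s : R) : Prop :=
  exists (FF : R * M -> G) (PP : R * M -> M),
  [/\ ck_at (prod_space line M) G k FF (s, m0),
      ck_at (prod_space line M) M k PP (s, m0) &
      \forall q \near (s, m0), reach q.1 q.2 (FF q) (PP q)].

Lemma near_time (P : set R) (s : R) (m0 : M) : (\forall t \near s, P t) ->
  \forall q \near (s, m0), P q.1.
Proof. by move=> h; apply: (cvg_fst (F := nbhs s) (G := nbhs m0)). Qed.

(** The lifted flow up to the fixed time [r] is followed by a local one of duration [q.1 - r] from
    the point reached; [r'] may lie on either side of [r]. *)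
Lemma good_step k (J : set R) (gam : R -> M) (T : R) (W : set M) GG PPb :
  open J -> is_interval J -> J 0 -> integral_curve X J gam ->
  open W -> (forall t m, `|t| < T -> W m ->
   [/\ reach t m (GG t m) (PPb t m),
    ck_at (prod_space line M) G k (fun q => GG q.1 q.2) (t, m) &
    ck_at (prod_space line M) M k (fun q => PPb q.1 q.2) (t, m)]) ->
  forall r r', J r -> W (gam r) -> `|r' - r| < T -> good k (gam 0) r -> good k (gam 0) r'.
Proof.
move=> oJ iJ J0 ig oW hW r r' Jr Wr rr' [FF [PP [ckF ckP nR]]].
set m0 := gam 0 in ckF ckP nR *.
have PPr : PP (r, m0) = gam r.
  have [J' [F [x [[oJ' iJ' J'0 [hx _ _ x0]] J'r _ <-]]]] := nbhs_singleton nR.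
  by apply: (@integral_curve_eq J' J x gam).
(* Time is frozen at [r] in the first stage: the variable time enters only through the local
   flow. *)
pose i (q : R * M) := (r, q.2).
have cki : ck_at (prod_space line M) (prod_space line M) k i (r', m0).
  by apply: ck_at_pair; [exact: ck_at_cst|exact: ck_at_snd].
have ci := cki.1.
have ckPi : ck_at (prod_space line M) M k (PP \o i) (r', m0).
  exact: (ck_at_comp cRM.1 cki ckP).
have ckFi : ck_at (prod_space line M) G k (FF \o i) (r', m0).
  exact: (ck_at_comp cRM.1 cki ckF).
have cksub : ck_at (prod_space line M) line k (fun q => q.1 - r) (r', m0).
  have cs : ck_at line line k (fun t => t - r) r'.
    apply: ck_at_model; exists setT; split => //; first exact: openT.
    by apply: Ck_add; [exact: openT|exact: Ck_id|exact: Ck_cst].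
  have c1 : ck_at (prod_space line M) line k fst (r', m0) by exact: ck_at_fst.
  exact: (ck_at_comp findim_R c1 cs).
pose j (q : R * M) := (q.1 - r, PP (i q)).
have ckj : ck_at (prod_space line M) (prod_space line M) k j (r', m0).
  exact: ck_at_pair.
have WPP : W (PP (i (r', m0))) by rewrite /i /= PPr.
have [_ ckG ckB] := hW _ _ rr' WPP.
exists (fun q => lmul (GG (q.1 - r) (PP (i q))) (FF (i q))), (fun q => PPb (q.1 - r) (PP (i q))).
split.
- by apply: ck_lmul => //; exact: (ck_at_comp cRM.1 ckj ckG).
- exact: (ck_at_comp cRM.1 ckj ckB).
have n1 : \forall q \near (r', m0), `|q.1 - r| < T.
  by apply: (near_time (P := [set t | `|t - r| < T])); exact: near_norm_lt.
have n2 : \forall q \near (r', m0), W (PP (i q)).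
  by apply: ckPi.1; exact: open_nbhs_nbhs.
have n3 : \forall q \near (r', m0), reach (i q).1 (i q).2 (FF (i q)) (PP (i q)).
  exact: (ci _ nR).
apply: filterS3 n1 n2 n3 => q q1 q2 q3.
have [q4 _ _] := hW _ _ q1 q2.
by have := reach_comp q3 q4; rewrite /= addrC subrK.
Qed.

(** The local flow around [gam s] serves from all nearby times, so [good] passes from [s] to [r] and
    from [r] to [s]; connectedness of [J] replaces a subdivision of the time interval. *)
Lemma integral_curve_good k (J : set R) (gam : R -> M) :
  open J -> is_interval J -> J 0 -> integral_curve X J gam ->
  forall s, J s -> good k (gam 0) s.
Proof.
move=> oJ iJ J0 ig; apply: interval_propagate => //.
  have [T [W [GG [PP [T0 oW Wp hW]]]]] := local_reach k (gam 0).
  have n0 : `|0 : R| < T by rewrite normr0.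
  have [_ c1 c2] := hW 0 _ n0 Wp.
  exists (fun q => GG q.1 q.2), (fun q => PP q.1 q.2); split => //.
  exists ([set t | `|t| < T], W) => /=.
    by split; apply: open_nbhs_nbhs; split => //; exact: open_symmetric_interval.
  by move=> [t m] [/= tT Wm]; have [] := hW t m tT Wm.
move=> s Js; have [T [W [GG [PP [T0 oW Wp hW]]]]] := local_reach k (gam s).
have step := good_step oJ iJ J0 ig oW hW.
have cg : {for s, continuous gam} by have [[]] := ig s Js.
have nW : \forall r \near s, W (gam r) by apply: cg; exact: open_nbhs_nbhs.
have nT : \forall r \near s, `|r - s| < T by apply: near_norm_lt; rewrite subrr normr0.
apply: filterS2 nW nT => r Wr rT Jr; split; last exact: step.
by apply: step => //; rewrite distrC.
Qed.

End Reach.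
End Actions.

(** * Comparison of the flows of $X$ and $Y$ *)

Theorem theorem1p6 (R : realType) (d n : nat) (G : lie_group R d)
    (M : manifold R n) (A : smooth_action G M)
    (X Y : forall m : M, tangent m)
    (hX : invariant_vector_field A X) (hY : invariant_vector_field A Y)
    (hXY : isomorphic_vector_fields A X Y) :
  exists F : R -> M -> G,
    smooth_on (prod_space (model_space R) M) G (flow_domain X)
      (fun q => F q.1 q.2)
    /\ forall (t : R) (m : M), flow_domain X (t, m) ->
         flow_domain Y (t, m) /\ flow X t m = A (F t m) (flow Y t m).
Proof.
have [psi [spsi _] XY] := hXY.
have [sX _] := hX; have [sY Yinv] := hY.
have cM := compatible_manifold M.
have flow_unique (Z : forall m : M, tangent m) t m p p' : smooth_vector_field Z ->
    flows_to Z t m p -> flows_to Z t m p' -> p = p'.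
  move=> sZ [J [x [oJ iJ J0 Jt [ix x0 <-]]]] [J' [x' [oJ' iJ' J'0 J't [ix' x'0 <-]]]].
  by apply: (integral_curve_eq sZ oJ iJ J0 oJ' iJ' J'0 ix ix') => //; rewrite x0.
have flowE (Z : forall m : M, tangent m) t m p : smooth_vector_field Z ->
    flows_to Z t m p -> flow Z t m = p.
  by move=> sZ h; apply: xget_unique => // p' h'; exact: flow_unique sZ h' h.
(* Defined by uniqueness, without reference to [k]; the default value 1 is taken only off the flow
   domain of [X]. *)
pose F t m := xget (lone G) [set g | exists q, reach X psi t m g q].
have FE t m g q : reach X psi t m g q -> F t m = g.
  move=> h; apply: xget_unique; first by exists q.
  by move=> g' [q' h']; have [] := reach_unique sX h' h.
have reach_flow t m g q : reach X psi t m g q -> flows_to X t m q.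
  by move=> [J [F' [x [[oJ iJ J0 [ix _ _ x0]] Jt _ xt]]]]; exists J, x.
have Dgood q k : flow_domain X q -> good X psi k q.2 q.1.
  case: q => t m [_ [J [x [oJ iJ J0 Jt [ix /= <- _]]]]].
  exact: (integral_curve_good sX spsi k oJ iJ J0 ix Jt).
exists F; split.
  apply: ck_smooth_on.
    (* Order 0 already provides lifted solutions for all nearby times and initial points, whence the
       flow domain is open. *)
    rewrite openE => -[t m] /(Dgood _ 0%N)[FF [PP [_ _ nR]]].
    apply: filterS nR => -[t' m'] h; exists (PP (t', m')).
    exact: (reach_flow _ _ _ _ h).
  (* The map [FF] depends on [k], but uniqueness of [reach] identifies it with [F] near [(t, m)]. *)
  move=> [t m] /Dgood Dtm k; have [FF [PP [ckF _ nR]]] := Dtm k.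
  apply: ck_at_ext ckF; apply: filterS nR => q h.
  by rewrite (FE _ _ _ _ h).
move=> t m Dtm; have [FF [PP [_ _ /nbhs_singleton /= h]]] := Dgood _ 0%N Dtm.
have flX := flowE X t m _ sX (reach_flow _ _ _ _ h).
have [J [F' [x [[oJ iJ J0 [ix dF F0 x0]] Jt Ft xt]]]] := h.
(* The same interval [J] serves for [Y], and the curve starts at [m] because [F' 0] is the
   identity. *)
have flY : flows_to Y t m (A (linv (F' t)) (x t)).
  exists J, (fun s => A (linv (F' s)) (x s)); split => //; split => //.
    exact: (driven_act Yinv XY ix dF).
  by rewrite F0 linv1 act1.
split; first by exists (A (linv (F' t)) (x t)).
rewrite flX (flowE Y t m _ sY flY) (FE _ _ _ _ h) -Ft -xt -actM lmulgV.
by rewrite act1.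
Qed.
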